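(* For any $\gamma\in(0,2)$, the limit \[ e_\gamma=\lim_{\epsilon\searrow0}\left(\Big(\log\frac1\delta\Big)^2\inf_{M_\gamma}E^\gamma_\epsilon-\frac{\pi\gamma^2}{2}\log\frac1\delta\right),\qquad\delta=\epsilon\log\frac1\epsilon, \] exists (as a real number).
   Context: $B_1^+(0)=B_1(0)\cap\mathbb{R}^2_+$, $\partial^+B_1(0)=\partial B_1(0)\cap\mathbb{R}^2_+$. For $\gamma\in(0,2)$, $M_\gamma=\{\mu\in W^{1,2}(-1,1):\mu(0)=1,\ \mu(\pm1)\le1-\gamma\}$. For $\mu\in M_\gamma$, $W^{1,2}_\mu(B_1^+(0))$ is the set of $w\in W^{1,2}(B_1^+(0))$ with $w(x_1,0)=\mu(x_1)$ on $(-1,1)$ and $w\le1-\gamma$ on $\partial^+B_1(0)$, and $E^\gamma_\epsilon(\mu)=\frac\epsilon2\int_{-1}^1\frac{(\mu')^2}{1-\mu^2}dx_1+\frac12\inf_{w\in W^{1,2}_\mu(B_1^+(0))}\int_{B_1^+(0)}|\nabla w|^2dx$.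
   Formalization: The exchange density (μ')²/(1−μ²) is set to +∞ where |μ|≥1 and μ'≠0, and to 0 where |μ|≥1 and μ'=0, so finite energy forces |μ|≤1; with the literal formula, profiles oscillating above 1 make the infimum −∞. *)

(* Defs.v *)
From HB Require Import structures.
From mathcomp Require Import all_boot all_order all_algebra.
From mathcomp Require Import all_classical all_reals all_analysis.
Set Implicit Arguments. Unset Strict Implicit. Unset Printing Implicit Defensive.
Import Order.TTheory GRing.Theory Num.Theory.
Import numFieldNormedType.Exports.
Local Open Scope classical_set_scope.
Local Open Scope ring_scope.

Section Defs.
Variable R : realType.
Local Notation mu := (@lebesgue_measure R).
Definition oI11 : set R := `]-1, 1[.
Definition cI11 : set R := `[-1, 1].
Definition oIpi : set R := `]0, pi[.
Definition oIsq (x : R) : set R := `]0, Num.sqrt (1 - x ^+ 2)[.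
Definition cIm1 (x : R) : set R := `[-1, x].

Definition pd1 (w : R -> R -> R) (x y : R) : R := derive1 (fun t => w t y) x.
Definition pd2 (w : R -> R -> R) (x y : R) : R := derive1 (fun t => w x t) y.

Definition C1R2 (w : R -> R -> R) : Prop :=
  (forall x y, derivable (fun t => w t y) x 1 /\ derivable (fun t => w x t) y 1) /\
  continuous (fun p : R * R => w p.1 p.2) /\
  continuous (fun p : R * R => pd1 w p.1 p.2) /\
  continuous (fun p : R * R => pd2 w p.1 p.2).

(* integral over the half disk B_1^+(0) = {(x,y) : x^2+y^2<1, y>0}
   (as an iterated Lebesgue integral of a nonnegative function) *)
Definition hd_int (f : R -> R -> R) : \bar R :=
  (\int[mu]_(x in oI11) \int[mu]_(y in oIsq x)
      (f x y)%:E)%E.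

(* Admissible approximating sequences: (w n) is a Cauchy sequence of C^1
   functions in W^{1,2}(B_1^+), whose limit w has trace mu on (-1,1) x {0}
   and trace <= 1 - gamma on the arc d^+B_1 (arc parametrised by angle,
   i.e. arc-length measure). *)
Definition dir_adm (gamma : R) (m : R -> R) (w : nat -> R -> R -> R) : Prop :=
  (forall n, C1R2 (w n)) /\
  (forall e : R, 0 < e -> exists N : nat, forall n k : nat, (N <= n)%N -> (N <= k)%N ->
     (hd_int (fun x y => ((w n x y - w k x y) ^+ 2
        + (pd1 (w n) x y - pd1 (w k) x y) ^+ 2
        + (pd2 (w n) x y - pd2 (w k) x y) ^+ 2)%R) < e%:E)%E) /\
  ((fun n => \int[mu]_(x in oI11) ((w n x 0 - m x) ^+ 2)%R%:E)%E @ \oo --> 0%E) /\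
  ((fun n => \int[mu]_(t in oIpi)
       ((Num.max (w n (cos t) (sin t) - (1 - gamma)) 0) ^+ 2)%R%:E)%E @ \oo --> 0%E).

(* Dirichlet energies int |grad w|^2 of the W^{1,2}_mu(B_1^+) functions *)
Definition dir_vals (gamma : R) (m : R -> R) : set (\bar R) :=
  [set a | exists w, dir_adm gamma m w /\
     (fun n => hd_int (fun x y => pd1 (w n) x y ^+ 2 + pd2 (w n) x y ^+ 2)) @ \oo --> a].

Definition dir_inf (gamma : R) (m : R -> R) : \bar R := ereal_inf (dir_vals gamma m).

(* m in W^{1,2}(-1,1) (continuous representative) with weak derivative g *)
Definition W12_1d (m g : R -> R) : Prop :=
  measurable_fun cI11 g /\
  mu.-integrable cI11 (EFin \o g) /\
  (\int[mu]_(x in cI11) ((g x) ^+ 2)%R%:E < +oo)%E /\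
  forall x, -1 <= x <= 1 -> m x = m (-1) + Rintegral mu (cIm1 x) g.

Definition M_gamma (gamma : R) (m : R -> R) : Prop :=
  m 0 = 1 /\ m 1 <= 1 - gamma /\ m (-1) <= 1 - gamma.

Definition ratio (m g : R -> R) (x : R) : \bar R :=
  if `|m x| < 1 then ((g x) ^+ 2 / (1 - m x ^+ 2))%:E
  else if g x == 0 then 0%E else +oo%E.

Definition E_gamma (gamma eps : R) (m g : R -> R) : \bar R :=
  ((eps / 2)%R%:E * (\int[mu]_(x in oI11) ratio m g x)
   + (1 / 2)%R%:E * dir_inf gamma m)%E.

Definition inf_E (gamma eps : R) : \bar R :=
  ereal_inf [set E | exists m g, M_gamma gamma m /\ W12_1d m g /\ E = E_gamma gamma eps m g].

Definition delta (eps : R) : R := eps * ln (1 / eps).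

End Defs.

(* Main.v *)
(* Put eps = exp (- L) / L, so that log (1 / delta) = L + o(1), and let
   G(L) = L^2 inf E - pi gamma^2 L / 2. For L < L', shrink a near-minimiser at L
   to the half-disk of radius exp (L - L'), multiply 1 - w by L / L', and fill the
   remaining annulus with a logarithm: this competitor at L' gives
   G(L') <= G(L) + C exp (- L) / L. Pairing grad w with an explicit divergence-free
   dipole field, regularised at a distance of order exp (- L) from the origin,
   bounds G from below. Hence G converges, and so does the rescaled energy. *)
From HB Require Import structures.
From mathcomp Require Import all_boot all_order all_algebra.
From mathcomp Require Import all_classical all_reals all_analysis.
From mathcomp Require Import measurable_realfun ring lra.
Require Import Defs.
Set Implicit Arguments. Unset Strict Implicit. Unset Printing Implicit Defensive.
Import Order.TTheory GRing.Theory Num.Theory.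
Import numFieldNormedType.Exports.
Local Open Scope classical_set_scope.
Local Open Scope ring_scope.

(** The step from L to L' loses so little because everything balances. Shrinking with lam = L / L'
    multiplies both parts of the energy by lam^2, which the prefactor L'^2 undoes, and the annulus
    adds pi gamma^2 (L' - L) / 2, exactly the growth of the subtracted term. Only the exchange
    energy of the annulus is lost. In the lower bound the trace is known only through |1 - m| <= 2 K
    |x|, with K the exchange integral. A single logarithmic source has base flux s / (x^2 + s^2),
    which costs a further logarithm against |x|. The weighted pair of sources costs only O(K s), and
    s is tuned so that the exchange energy pays for it. The obstacle is the admissible class, given
    by Cauchy sequences of C^1 functions with traces attained in the limit. A competitor has to be
    produced as such a sequence, and a near-minimiser must vanish on the arc before it can be shrunk
    and extended by zero. This forces a truncation at a small height k, sent to 0 only at the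
    end. *)

(** * Joint continuity and measurability on the plane *)

Section cont2.
Context {R : realType}.
Implicit Types (f g : R -> R -> R).

Definition cont2 f := continuous (fun p : R * R => f p.1 p.2).

(** The product measure lives on the product sigma-algebra, so continuity helps only once open sets
    are known to belong to it: an open set is the countable union of the rational boxes that it
    contains. *)
Lemma open_measurable_prod (A : set (R * R)) :
  open A -> measurable (A : set (measurableTypeR R * measurableTypeR R)).
Proof.
move=> oA.
pose box (q : (rat * rat) * (rat * rat)) : set (R * R) :=
  `]ratr q.1.1, ratr q.1.2[%classic `*` `]ratr q.2.1, ratr q.2.2[%classic.
have -> : A = \bigcup_q (if `[< box q `<=` A >] then box q else set0).
  apply/seteqP; split => [[x y] Axy|p [q _]]; last first.
    by case: asboolP => // qA; exact: qA.
  have /nbhs_ballP[e /= e0 eA] := open_nbhs_nbhs (conj oA Axy).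
  have [a] := @rat_in_itvoo R (x - e) x (ltac:(by rewrite ltrBlDr ltrDl)).
  rewrite in_itv /= => /andP[xa ax].
  have [b] := @rat_in_itvoo R x (x + e) (ltac:(by rewrite ltrDl)).
  rewrite in_itv /= => /andP[xb bx].
  have [c] := @rat_in_itvoo R (y - e) y (ltac:(by rewrite ltrBlDr ltrDl)).
  rewrite in_itv /= => /andP[yc cy].
  have [d] := @rat_in_itvoo R y (y + e) (ltac:(by rewrite ltrDl)).
  rewrite in_itv /= => /andP[yd dy].
  exists ((a, b), (c, d)) => //; rewrite asboolT.
    by split; rewrite /= in_itv /= ?ax ?xb ?cy ?yd.
  move=> [z t] [] /=; rewrite !in_itv /= => /andP[az zb] /andP[ct td].
  apply: eA; split; rewrite /ball /= /ball_ ltr_norml; apply/andP; split; lra.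
apply: countable_bigcupT_measurable; first exact: countableP.
move=> q; case: asboolP => // _.
by apply: measurableX; exact: measurable_itv.
Qed.

Lemma cont2_measurable f : cont2 f ->
  measurable_fun setT
    (fun p : measurableTypeR R * measurableTypeR R => f p.1 p.2).
Proof.
move=> cf.
apply: (measurability _ (measurable_realfun.RGenOpens.measurableE R)).
move=> _ [_ [a [b ->] <-]]; rewrite setTI.
apply: open_measurable_prod; move/continuousP: cf; apply; exact: interval_open.
Qed.

Lemma cont2_cst (c : R) : cont2 (fun _ _ => c).
Proof. by move=> p; exact: cvg_cst. Qed.

Lemma cont2_x : cont2 (fun x _ => x).
Proof. by move=> p; exact: cvg_fst. Qed.

Lemma cont2_y : cont2 (fun _ y => y).
Proof. by move=> p; exact: cvg_snd. Qed.

Lemma cont2D f g : cont2 f -> cont2 g -> cont2 (fun x y => f x y + g x y).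
Proof. by move=> cf cg p; exact: (cvgD (cf p) (cg p)). Qed.

Lemma cont2N f : cont2 f -> cont2 (fun x y => - f x y).
Proof. by move=> cf p; exact: (cvgN (cf p)). Qed.

Lemma cont2M f g : cont2 f -> cont2 g -> cont2 (fun x y => f x y * g x y).
Proof. by move=> cf cg p; exact: (cvgM (cf p) (cg p)). Qed.

Lemma cont2X f n : cont2 f -> cont2 (fun x y => f x y ^+ n).
Proof.
move=> cf; elim: n => [|n IH]; first exact: cont2_cst.
rewrite (_ : (fun x y => _) = fun x y => f x y * f x y ^+ n); first exact: cont2M.
by apply/funext => x; apply/funext => y; rewrite exprS.
Qed.

Lemma cont2V f : (forall x y, f x y != 0) -> cont2 f ->
  cont2 (fun x y => (f x y)^-1).
Proof. by move=> f0 cf p; exact: (cvgV (f0 _ _) (cf p)). Qed.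

Lemma cont2_comp (phi : R -> R) f : continuous phi -> cont2 f ->
  cont2 (fun x y => phi (f x y)).
Proof.
move=> cphi cf p.
by apply: (@continuous_comp _ _ _ (fun p : R * R => f p.1 p.2) phi);
  [exact: cf|exact: cphi].
Qed.

Lemma cont2_subst f g h : cont2 f -> cont2 g -> cont2 h ->
  cont2 (fun x y => f (g x y) (h x y)).
Proof.
move=> cf cg ch p.
apply: (@continuous_comp _ _ _ (fun p : R * R => (g p.1 p.2, h p.1 p.2))
  (fun p : R * R => f p.1 p.2)); last exact: cf.
exact: (cvg_pair (cg p) (ch p)).
Qed.

Lemma cont2_curve f (a b : R -> R) : cont2 f -> continuous a -> continuous b ->
  continuous (fun t => f (a t) (b t)).
Proof.
move=> cf ca cb t.
apply: (@continuous_comp _ _ _ (fun t => (a t, b t))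
  (fun p : R * R => f p.1 p.2)); last exact: cf.
exact: (cvg_pair (ca t) (cb t)).
Qed.

Lemma cont2_bounded f : cont2 f ->
  exists2 M, 0 <= M & forall x y, x ^+ 2 + y ^+ 2 <= 1 -> `|f x y| <= M.
Proof.
move=> cf; pose K : set (R * R) := `[-1, 1]%classic `*` `[-1, 1]%classic.
have cK : compact K by apply: compact_setX; exact: segment_compact.
have := @continuous_compact _ _ (fun p : R * R => f p.1 p.2) K.
move=> /(_ (continuous_subspaceT cf) cK) /compact_bounded[M [_ MP]].
exists (`|M| + 1) => [|x y xy1]; first by rewrite addr_ge0.
have M1 : M < `|M| + 1 by rewrite (le_lt_trans (ler_norm M))// ltrDl.
apply: (MP _ M1); exists (x, y) => //; split => /=; rewrite in_itv /=; nra.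
Qed.

End cont2.

(** Purely structural search: goals that it cannot decompose are handed back, and hypotheses are
    recognised by [constr_eq], without unfolding. *)
Ltac cont2_tac :=
  lazymatch goal with
  | |- cont2 (fun _ _ => ?c) => exact (@cont2_cst _ c)
  | |- cont2 (fun x _ => x) => exact (@cont2_x _)
  | |- cont2 (fun _ y => y) => exact (@cont2_y _)
  | |- cont2 (fun x y => @?f x y + @?g x y) =>
      refine (@cont2D _ f g _ _); cont2_tac
  | |- cont2 (fun x y => - @?f x y) => refine (@cont2N _ f _); cont2_tac
  | |- cont2 (fun x y => @?f x y * @?g x y) =>
      refine (@cont2M _ f g _ _); cont2_tac
  | |- cont2 (fun x y => @?f x y ^+ ?n) => refine (@cont2X _ f n _); cont2_tac
  | |- cont2 (fun x y => ?g x y) =>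
      match goal with H : cont2 ?f |- _ => constr_eq f g; exact H | _ => idtac end
  | |- cont2 ?g =>
      match goal with H : cont2 ?f |- _ => constr_eq f g; exact H | _ => idtac end
  | |- _ => idtac
  end.

(** * Integration over the half-disk *)

Section halfdisk.
Context {R : realType}.
Local Notation mu := (@lebesgue_measure R).
Local Notation mu2 := (mu \x mu)%E.
Implicit Types (f g : R -> R -> R).

Definition HD : set (R * R) := [set p | p.1 ^+ 2 + p.2 ^+ 2 < 1 /\ 0 < p.2].

Lemma measurable_HD : measurable (HD : set (measurableTypeR R * measurableTypeR R)).
Proof.
apply: open_measurable_prod; rewrite (_ : HD =
  (fun p : R * R => p.1 ^+ 2 + p.2 ^+ 2) @^-1` [set t | t < 1] `&`
  (fun p : R * R => p.2) @^-1` [set t | 0 < t]); last by apply/seteqP; split.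
apply: openI.
  apply: open_comp; last exact: open_lt.
  by move=> p _; have := (cont2D (cont2X (n := 2) cont2_x) (cont2X (n := 2) cont2_y)) p.
by apply: open_comp; [move=> p _; exact: cvg_snd|exact: open_gt].
Qed.

Lemma HD_disk x y : HD (x, y) -> x ^+ 2 + y ^+ 2 <= 1.
Proof. by case=> /ltW. Qed.

Lemma mu2_HD_fin : (mu2 HD < +oo)%E.
Proof.
apply: (@le_lt_trans _ _ (mu2 (`[-1, 1]%classic `*` `[-1, 1]%classic))).
  apply: le_measure; rewrite ?inE.
  - exact: measurable_HD.
  - by apply: measurableX; exact: measurable_itv.
  - by move=> [x y] [/= xy y0]; split => /=; rewrite in_itv /=; nra.
rewrite product_measure1E//= lebesgue_measure_itv /= lte_fin.
by case: ifP => _; rewrite -?EFinD -?EFinM ?mule0 ltry.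
Qed.

(** A real-valued integral against the product measure gives linearity and comparison at once;
    [II_hd_int] and [II_yx] recover both iterated integrals by Fubini. *)
Definition II f : R := Rintegral mu2 HD (fun p => f p.1 p.2).

Lemma integrable_HD f : cont2 f ->
  mu2.-integrable HD (EFin \o (fun p => f p.1 p.2)).
Proof.
move=> cf; have [M M0 fM] := cont2_bounded cf.
apply: measurable_bounded_integrable.
- exact: measurable_HD.
- exact: mu2_HD_fin.
- by apply: measurable_funTS; exact: cont2_measurable.
- exists M; split; first exact: num_real.
  by move=> N MN [x y] /= xyH; rewrite (le_trans (fM _ _ (HD_disk xyH)))// ltW.
Qed.

Lemma eq_II f g : (forall x y, HD (x, y) -> f x y = g x y) -> II f = II g.
Proof. by move=> fg; apply: eq_Rintegral => -[x y] /set_mem; exact: fg. Qed.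

Lemma IID f g : cont2 f -> cont2 g ->
  II (fun x y => f x y + g x y) = II f + II g.
Proof.
by move=> cf cg; apply: RintegralD;
  [exact: measurable_HD|exact: integrable_HD|exact: integrable_HD].
Qed.

Lemma IIZ (c : R) f : cont2 f -> II (fun x y => c * f x y) = c * II f.
Proof.
by move=> cf; apply: RintegralZl; [exact: measurable_HD|exact: integrable_HD].
Qed.

Lemma le_II f g : cont2 f -> cont2 g ->
  (forall x y, HD (x, y) -> f x y <= g x y) -> II f <= II g.
Proof.
move=> cf cg fg; apply: le_Rintegral;
  [exact: measurable_HD|exact: integrable_HD|exact: integrable_HD|].
by move=> [x y]; exact: fg.
Qed.

Lemma II_ge0 f : (forall x y, HD (x, y) -> 0 <= f x y) -> 0 <= II f.
Proof. by move=> f0; apply: Rintegral_ge0 => -[x y]; exact: f0. Qed.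

Let hf f : measurableTypeR R * measurableTypeR R -> \bar R :=
  ((EFin \o (fun p => f p.1 p.2)) \_ HD)%E.

Let integrable_hf f : cont2 f -> mu2.-integrable setT (hf f).
Proof.
move=> cf; have := integrable_HD cf.
by rewrite (integrable_mkcond _ measurable_HD).
Qed.

Let II_hf f : cont2 f -> (II f)%:E = (\int[mu2]_p hf f p)%E.
Proof.
move=> cf; rewrite /II /Rintegral fineK; first by rewrite integral_mkcond.
by apply: integrable_fin_num; [exact: measurable_HD|exact: integrable_HD].
Qed.

Lemma II_hd_int f : cont2 f -> (II f)%:E = hd_int f.
Proof.
move=> cf; rewrite II_hf// -(integral12_prod_meas1 (integrable_hf cf)).
rewrite /hd_int [RHS]integral_mkcond; apply: eq_integral => x _ /=.
rewrite patchE; case: ifPn => [/set_mem|/negP xI].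
  rewrite /oI11 /= in_itv /= => xI.
  rewrite [RHS]integral_mkcond; apply: eq_integral => y _; rewrite /hf !patchE.
  have -> // : ((x, y) \in HD) = (y \in oIsq x).
  apply/idP/idP => /set_mem H; apply/mem_set; move: H; rewrite /HD/oIsq/= in_itv /=.
    move=> [xy y0]; rewrite y0 /= -(ger0_norm (ltW y0)) -sqrtr_sqr ltr_sqrt; nra.
  move=> /andP[y0 ys]; split => //.
  have: y ^+ 2 < Num.sqrt (1 - x ^+ 2) ^+ 2 by rewrite ltrXn2r// ltW.
  by rewrite sqr_sqrtr; nra.
apply: integral0_eq => y _; rewrite /hf patchE memNset// => -[/= xy y0].
by apply: xI; apply/mem_set; rewrite /oI11 /= in_itv /=; apply/andP; split; nra.
Qed.

(** Fubini in the order opposite to [hd_int]: an x-derivative has to be integrated along horizontal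
    chords. *)
Lemma II_yx f : cont2 f -> (II f)%:E =
  (\int[mu]_(y in `]0%R, 1%R[) \int[mu]_(x in
     `](- Num.sqrt (1 - y ^+ 2))%R, (Num.sqrt (1 - y ^+ 2))%R[) (f x y)%:E)%E.
Proof.
move=> cf; rewrite II_hf// -(integral21_prod_meas1 (integrable_hf cf)).
rewrite [RHS]integral_mkcond; apply: eq_integral => y _ /=.
rewrite patchE; case: ifPn => [/set_mem|/negP yI].
  rewrite /= in_itv /= => /andP[y0 y1].
  rewrite [RHS]integral_mkcond; apply: eq_integral => x _; rewrite /hf !patchE.
  set s := Num.sqrt _.
  have s0 : 0 <= s by exact: sqrtr_ge0.
  have s2 : s ^+ 2 = 1 - y ^+ 2 by rewrite sqr_sqrtr//; nra.
  have -> // : ((x, y) \in HD) = (x \in `]- s, s[%classic).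
  apply/idP/idP => /set_mem H; apply/mem_set; move: H; rewrite /HD/= in_itv /=.
    by move=> [xy _]; apply/andP; split; nra.
  by move=> /andP[xs1 xs2]; split => //; nra.
apply: integral0_eq => x _; rewrite /hf patchE memNset// => -[/= xy y0].
by apply: yI; apply/mem_set; rewrite /= in_itv /=; apply/andP; split; nra.
Qed.

End halfdisk.

(** * Fundamental theorem and substitution on intervals *)

Section fundamental_theorem.
Context {R : realType}.
Local Notation mu := (@lebesgue_measure R).
Implicit Types (F f G : R -> R).

Lemma measurable_continuous f (D : set R) : continuous f -> measurable_fun D f.
Proof. by move=> cf; apply: measurable_funTS; exact: continuous_measurable_fun. Qed.

Lemma integrable_continuous_cc f (a b : R) : continuous f ->
  mu.-integrable `[a, b] (EFin \o f).
Proof.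
move=> cf; apply: continuous_compact_integrable; first exact: segment_compact.
exact: continuous_subspaceT.
Qed.

Lemma integrable_continuous_oo f (a b : R) : continuous f ->
  mu.-integrable `]a, b[ (EFin \o f).
Proof.
move=> cf; apply: (integrableS _ _ _ (integrable_continuous_cc a b cf)) => //.
exact: subset_itv_oo_cc.
Qed.

Lemma integral_oo_cc f (a b : R) : measurable_fun setT f ->
  (\int[mu]_(x in `]a, b[) (f x)%:E = \int[mu]_(x in `[a, b]) (f x)%:E)%E.
Proof.
move=> mf; have mf' D : measurable_fun D (EFin \o f).
  by apply/measurable_EFinP; exact: measurable_funTS.
by rewrite -integral_itv_bndo_bndc// -integral_itv_obnd_cbnd.
Qed.

(** Differentiability is asked only inside the interval, because the fields used later are frozen
    below y = 0 and have a kink there. *)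
Lemma FTC2_oo F f (a b : R) : a <= b ->
  (forall x, a <= x <= b -> {for x, continuous F}) -> continuous f ->
  (forall x, a < x < b -> is_derive x 1 F (f x)) ->
  (\int[mu]_(x in `]a, b[) (f x)%:E = (F b - F a)%:E)%E.
Proof.
rewrite le_eqVlt => /predU1P[<- *|ab cF cf dF].
  by rewrite set_itvoo0 ?integral_set0 ?subrr.
rewrite integral_oo_cc; last exact: continuous_measurable_fun.
rewrite (@continuous_FTC2 _ f F)//.
- exact: continuous_subspaceT.
- split.
  + by move=> x /[!in_itv] /= /dF[].
  + by apply: cvg_at_right_filter; apply: cF; rewrite lexx ltW.
  + by apply: cvg_at_left_filter; apply: cF; rewrite lexx ltW.
- by move=> x /[!in_itv] /= /dF ?; rewrite derive1E derive_val.
Qed.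

Lemma antiderivative f (a : R) : continuous f ->
  exists F, forall x, a < x -> is_derive x 1 F (f x).
Proof.
move=> cf; exists (fun x => \int[mu]_(t in [set` `[a, x]]) (f t)) => x ax.
have x1 : x < x + 1 by rewrite ltrDl.
have [d e] := @continuous_FTC1_closed R f a x (x + 1) x1
  (integrable_continuous_cc _ _ cf) ax (cf x).
by rewrite -e derive1E; exact: DeriveDef.
Qed.

Lemma is_derive_continuous F (x l : R) : is_derive x 1 F l -> {for x, continuous F}.
Proof. by move=> [] /derivable1_diffP/differentiable_continuous. Qed.

Lemma antiderivative_integral f (m : R) : continuous f -> exists F : R -> R,
  (forall x, m < x -> is_derive x 1 F (f x)) /\
  forall a b, m < a -> a <= b ->
    (\int[mu]_(x in `]a, b[) (f x)%:E = (F b - F a)%:E)%E.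
Proof.
move=> cf; have [F dF] := antiderivative m cf; exists F; split => // a b ma ab.
apply: FTC2_oo => // x /andP[ax _].
- by apply: is_derive_continuous (dF _ _); exact: lt_le_trans ax.
- by apply: dF; exact: lt_trans ax.
Qed.

Lemma integral_oo_split f (a c b : R) : continuous f -> a <= c -> c <= b ->
  (\int[mu]_(x in `]a, b[) (f x)%:E =
   \int[mu]_(x in `]a, c[) (f x)%:E + \int[mu]_(x in `]c, b[) (f x)%:E)%E.
Proof.
move=> cf ac cb; have [F [_ FE]] := antiderivative_integral (a - 1) cf.
rewrite !FE ?(le_trans ac) -?EFinD; [by congr EFin; ring|lra..].
Qed.

(* The sign [k] covers increasing and decreasing substitutions at once. *)
Lemma integral_substitution F f G (a b m k : R) : a <= b -> k * k = 1 ->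
  (forall x : R, is_derive x 1 F (k * f x)) -> continuous f -> continuous G ->
  (forall x, a <= x <= b -> m < F x) -> exists A : R -> R,
  (\int[mu]_(x in `]a, b[) (G (F x) * f x)%:E = (k * (A (F b) - A (F a)))%:E)%E /\
  forall c d, m < c -> c <= d -> (\int[mu]_(y in `]c, d[) (G y)%:E = (A d - A c)%:E)%E.
Proof.
move=> ab k1 dF cf cG mF.
have [A [dA AE]] := antiderivative_integral m cG.
have cF : continuous F by move=> x; exact: is_derive_continuous (dF x).
have dAF x : a <= x <= b -> is_derive x 1 (k \*: (A \o F)) (G (F x) * f x).
  move=> /mF mFx; rewrite [_ * _](_ : _ = k *: (G (F x) * (k * f x))); last first.
    by rewrite /GRing.scale /=; transitivity ((k * k) * (G (F x) * f x));
      [rewrite k1 mul1r|ring].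
  by apply: is_deriveZ; apply: is_derive1_comp; exact: dA.
exists A; split => //.
rewrite mulrBr; apply: (@FTC2_oo (k \*: (A \o F))).
- exact: ab.
- by move=> x xab; exact: is_derive_continuous (dAF _ xab).
- move=> x; apply: cvgM; last exact: cf.
  by apply: continuous_comp; [exact: cF|exact: cG].
- by move=> x /andP[/ltW ax /ltW xb]; apply: dAF; rewrite ax.
Qed.

End fundamental_theorem.

(** * Divergence theorem on the half-disk *)

Section divergence.
Context {R : realType}.
Local Notation mu := (@lebesgue_measure R).
Implicit Types (F G f g : R -> R -> R).

Definition arc f : R := Rintegral mu (@oIpi R) (fun t => f (cos t) (sin t)).
Definition flat (g : R -> R) : R := Rintegral mu (@oI11 R) g.

Lemma continuous_arc f : cont2 f -> continuous (fun t => f (cos t) (sin t)).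
Proof.
by move=> cf; apply: cont2_curve => //; [exact: continuous_cos|exact: continuous_sin].
Qed.

Lemma arcE f : cont2 f -> (arc f)%:E =
  (\int[mu]_(t in @oIpi R) (f (cos t) (sin t))%:E)%E.
Proof.
move=> cf; rewrite /arc /Rintegral fineK//; apply: integrable_fin_num; first exact: measurable_itv.
exact: (integrable_continuous_oo 0 pi (continuous_arc cf)).
Qed.

Lemma flatE (g : R -> R) : continuous g ->
  (flat g)%:E = (\int[mu]_(x in @oI11 R) (g x)%:E)%E.
Proof.
move=> cg; rewrite /flat /Rintegral fineK//; apply: integrable_fin_num; first exact: measurable_itv.
exact: (integrable_continuous_oo (-1) 1 cg).
Qed.

Lemma continuous_sqrt1B : continuous (fun x : R => Num.sqrt (1 - x ^+ 2)).
Proof.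
move=> x; apply: (@continuous_comp _ _ _ (fun x : R => 1 - x ^+ 2)).
  by apply: cvgB; [exact: cvg_cst|exact: exprn_continuous].
exact: sqrt_continuous.
Qed.

Lemma sqrt1B_sin (t : R) : 0 <= t <= pi -> Num.sqrt (1 - cos t ^+ 2) = sin t.
Proof. by move=> tpi; rewrite -sin2cos2 sqrtr_sqr ger0_norm// sin_ge0_pi. Qed.

(** On each vertical chord the integral is a difference of endpoint values. The substitution x = cos
    t turns the upper one into an arc integral, with Jacobian sin t = y. *)
Lemma divergence_vertical G g : cont2 G -> cont2 g ->
  (forall x y : R, 0 < y -> is_derive y 1 (G x) (g x y)) ->
  II g = arc (fun x y => G x y * y) - flat (fun x => G x 0).
Proof.
move=> cG cg dG.
have cGs : continuous (fun x => G x (Num.sqrt (1 - x ^+ 2))).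
  apply: cont2_curve => //; last exact: continuous_sqrt1B.
  by move=> x; exact: cvg_id.
have cG0 : continuous (fun x => G x 0).
  by apply: cont2_curve => // x; [exact: cvg_id|exact: cvg_cst].
apply: EFin_inj; rewrite II_hd_int// /hd_int EFinB arcE; last by cont2_tac.
rewrite flatE//.
under eq_integral => x _.
  have -> : (\int[mu]_(y in oIsq x) (g x y)%:E =
      (G x (Num.sqrt (1 - x ^+ 2)))%:E - (G x 0)%:E)%E.
    apply: FTC2_oo; first exact: sqrtr_ge0.
    - by move=> y _; apply: (@cont2_curve _ G) => // z; [exact: cvg_cst|exact: cvg_id].
    - by apply: cont2_curve => // z; [exact: cvg_cst|exact: cvg_id].
    - by move=> y /andP[y0 _]; exact: dG.
  over.
rewrite integralB//=; last 3 first.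
- exact: measurable_itv.
- exact: (integrable_continuous_oo (-1) 1 cGs).
- exact: (integrable_continuous_oo (-1) 1 cG0).
congr (_ - _)%E.
(* The sign is -1 because cos decreases on [0, pi]; -2 is a base point strictly below its range. *)
have [||||||A [A1 A2]] := @integral_substitution _ cos sin
  (fun x => G x (Num.sqrt (1 - x ^+ 2))) 0 pi (-2) (-1).
- exact: pi_ge0.
- by rewrite mulrNN mulr1.
- by move=> x; rewrite mulN1r; exact: is_derive_cos.
- exact: continuous_sin.
- exact: cGs.
- by move=> x _; rewrite (@lt_le_trans _ _ (-1)) ?cos_geN1//; lra.
rewrite A2; [|lra|lra]; rewrite cospi cos0 in A1.
rewrite (_ : A 1 - A (-1) = -1 * (A (-1) - A 1)); last by ring.
rewrite -A1; apply: eq_integral => t /set_mem /=; rewrite in_itv /= => /andP[t0 t1].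
by rewrite sqrt1B_sin// ?ltW.
Qed.

(** A horizontal field is tangent to the base, hence no flat term. The right and left ends of the
    chords are parametrised by y = sin t on [0, pi/2] and on [pi/2, pi], where sqrt (1 - y^2) is cos
    t and - cos t respectively. *)
Lemma divergence_horizontal F f : cont2 F -> cont2 f ->
  (forall x y : R, 0 < y -> is_derive x 1 (fun t => F t y) (f x y)) ->
  II f = arc (fun x y => F x y * x).
Proof.
move=> cF cf dF.
pose P s y := F (s * Num.sqrt (1 - y ^+ 2)) y.
have cP s : continuous (P s).
  apply: cont2_curve => //; last by move=> x; exact: cvg_id.
  by move=> x; apply: cvgM; [exact: cvg_cst|exact: continuous_sqrt1B].
apply: EFin_inj; rewrite II_yx// arcE; last by cont2_tac.
under eq_integral => y yI.
  have -> : (\int[mu]_(x in `](- Num.sqrt (1 - y ^+ 2))%R, (Num.sqrt (1 - y ^+ 2))%R[)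
      (f x y)%:E = (P 1 y)%:E - (P (-1) y)%:E)%E.
    rewrite /P mul1r mulN1r; apply: (@FTC2_oo _ (fun t => F t y)).
    - by rewrite ge0_cp ?sqrtr_ge0.
    - by move=> x _; apply: cont2_curve => // z; [exact: cvg_id|exact: cvg_cst].
    - by apply: cont2_curve => // z; [exact: cvg_id|exact: cvg_cst].
    - move=> x _; apply: dF; move/set_mem: yI => /=.
      by rewrite in_itv /= => /andP[].
  over.
rewrite integralB//=; last 2 first.
- exact: (integrable_continuous_oo 0 1 (cP 1)).
- exact: (integrable_continuous_oo 0 1 (cP (-1))).
have pi0 := pi_ge0 R.
have [||||||A [A1 A2]] := @integral_substitution _ sin cos (P 1) 0 (pi / 2) (-2) 1.
- by rewrite divr_ge0.
- by rewrite mulr1.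
- by move=> x; rewrite mul1r; exact: is_derive_sin.
- exact: continuous_cos.
- exact: cP.
- by move=> x _; rewrite (@lt_le_trans _ _ (-1)) ?sin_geN1//; lra.
have [||||||B [B1 B2]] := @integral_substitution _ sin cos
  (P (-1)) (pi / 2) pi (-2) 1.
- by lra.
- by rewrite mulr1.
- by move=> x; rewrite mul1r; exact: is_derive_sin.
- exact: continuous_cos.
- exact: cP.
- by move=> x _; rewrite (@lt_le_trans _ _ (-1)) ?sin_geN1//; lra.
rewrite A2; [|lra|lra]; rewrite B2; [|lra|lra].
rewrite sin0 sin_pihalf sinpi in A1 B1.
have cH : continuous (fun t => F (cos t) (sin t) * cos t).
  by apply: (@continuous_arc (fun x y => F x y * x)); cont2_tac.
rewrite (integral_oo_split (c := pi / 2) cH); [|lra|lra].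
rewrite !mul1r in A1 B1.
rewrite -EFinN opprB -A1 -B1; congr (_ + _)%E.
  apply: eq_integral => t /set_mem /=; rewrite in_itv /= => /andP[t0 t1].
  by rewrite /P mul1r -cos2sin2 sqrtr_sqr ger0_norm// cos_ge0_pihalf; lra.
apply: eq_integral => t /set_mem /=; rewrite in_itv /= => /andP[t0 t1].
rewrite /P mulN1r -cos2sin2 sqrtr_sqr ler0_norm ?opprK//.
have := @cos_ge0_pihalf R (pi - t); rewrite cosB cospi sinpi; lra.
Qed.

Lemma arcD f g : cont2 f -> cont2 g ->
  arc (fun x y => f x y + g x y) = arc f + arc g.
Proof.
move=> cf cg; apply: RintegralD; first exact: measurable_itv.
- exact: (integrable_continuous_oo 0 pi (continuous_arc cf)).
- exact: (integrable_continuous_oo 0 pi (continuous_arc cg)).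
Qed.

Lemma arcZ (c : R) f : cont2 f -> arc (fun x y => c * f x y) = c * arc f.
Proof.
move=> cf; apply: RintegralZl; first exact: measurable_itv.
exact: (integrable_continuous_oo 0 pi (continuous_arc cf)).
Qed.

Lemma le_arc f g : cont2 f -> cont2 g ->
  (forall x y, x ^+ 2 + y ^+ 2 = 1 -> 0 <= y -> f x y <= g x y) -> arc f <= arc g.
Proof.
move=> cf cg fg; apply: le_Rintegral; first exact: measurable_itv.
- exact: (integrable_continuous_oo 0 pi (continuous_arc cf)).
- exact: (integrable_continuous_oo 0 pi (continuous_arc cg)).
- move=> t; rewrite /oIpi /= in_itv /= => /andP[t0 t1]; apply: fg; first exact: cos2Dsin2.
  by rewrite sin_ge0_pi// !ltW.
Qed.

Lemma eq_arc f g : (forall x y, x ^+ 2 + y ^+ 2 = 1 -> f x y = g x y) -> arc f = arc g.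
Proof. by move=> fg; apply: eq_Rintegral => t _; apply: fg; exact: cos2Dsin2. Qed.

Lemma arc_cst (c : R) : arc (fun _ _ => c) = c * pi.
Proof.
rewrite /arc Rintegral_cst; last exact: measurable_itv.
congr (c * _); rewrite -[RHS]/(fine pi%:E); apply: (congr1 fine).
by rewrite [LHS]lebesgue_measure_itv /= lte_fin pi_gt0 sube0.
Qed.

Theorem divergence_halfdisk F G f g : cont2 F -> cont2 G -> cont2 f -> cont2 g ->
  (forall x y : R, 0 < y -> is_derive x 1 (fun t => F t y) (f x y)) ->
  (forall x y : R, 0 < y -> is_derive y 1 (G x) (g x y)) ->
  II (fun x y => f x y + g x y) =
  arc (fun x y => F x y * x + G x y * y) - flat (fun x => G x 0).
Proof.
move=> cF cG cf cg dF dG; rewrite IID// (divergence_horizontal cF cf dF).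
rewrite (divergence_vertical cG cg dG) arcD; [by rewrite addrA|cont2_tac..].
Qed.

End divergence.

(** * Positive part and its C^{1,1} regularisations *)

Section pospart.
Context {R : realType}.
Implicit Types (a b k s x y l : R) (f : R -> R).

(** A quadratic remainder yields the derivative of a piecewise formula without any case distinction
    at its breakpoints. *)
Lemma is_derive_quad f x l (C : R) :
  (forall y, `|f y - f x - l * (y - x)| <= C * (y - x) ^+ 2) -> is_derive x 1 f l.
Proof.
move=> fC.
have C0 : 0 <= C by have := le_trans (normr_ge0 _) (fC (x + 1)); nra.
have h : (fun h => h^-1 *: (f (h *: 1 + x) - f x)) @ 0^' --> l.
  apply/cvgrPdist_le => e e0; near=> h.
  have h0 : h != 0 by near: h; exact: nbhs_dnbhs_neq.
  have -> : h *: 1 + x = x + h by rewrite /GRing.scale /= mulr1 addrC.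
  have := fC (x + h); rewrite (addrC x h) addrK => H.
  rewrite /GRing.scale /= distrC.
  have -> : h^-1 * (f (h + x) - f x) - l = h^-1 * (f (h + x) - f x - l * h).
    by field.
  rewrite normrM normfV ler_pdivrMl ?normr_gt0//; apply: le_trans H _.
  have : `|h| <= e / (C + 1).
    by near: h; apply: dnbhs0_le; rewrite divr_gt0// ltr_wpDl.
  rewrite ler_pdivlMr ?ltr_wpDl// -(real_normK (num_real h)); have := normr_ge0 h; nra.
by apply: DeriveDef; [apply/cvg_ex; exists l|exact/cvg_lim].
Unshelve. all: by end_near. Qed.

Definition pospart x := Num.max x 0.
Definition sqp x := pospart x ^+ 2.

Lemma pospartP x : (0 <= x) * (pospart x = x) + (x <= 0) * (pospart x = 0).
Proof. by rewrite /pospart; case: (leP x 0); [right|left; rewrite ltW]. Qed.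

Lemma pospart_ge0 x : 0 <= pospart x.
Proof. by case: (pospartP x) => -[? ->]. Qed.

Lemma pospart_le0 x : x <= 0 -> pospart x = 0.
Proof. by move=> x0; apply/max_idPr. Qed.

Lemma pospart_id x : 0 <= x -> pospart x = x.
Proof. by move=> x0; apply/max_idPl. Qed.

Lemma continuous_pospart : continuous pospart.
Proof.
move=> x; apply: (@continuous_max R R id (fun=> 0) x); first exact: cvg_id.
exact: cvg_cst.
Qed.

(** Lower bound by convexity, upper bound because the derivative is 2-Lipschitz. The derivatives of
    [ramp] and [cutf], which are combinations of translates of [sqp], follow from it. *)
Lemma sqp_taylor x y :
  0 <= sqp y - sqp x - 2 * pospart x * (y - x) <= (y - x) ^+ 2.
Proof.
rewrite /sqp; case: (pospartP x) => -[? ->]; case: (pospartP y) => -[? ->];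
  by apply/andP; split; have := sqr_ge0 (y - x); nra.
Qed.

Lemma is_derive_sqp x : is_derive x 1 sqp (2 * pospart x).
Proof.
apply: (@is_derive_quad _ _ _ 1) => y; have /andP[? ?] := sqp_taylor x y.
by rewrite ger0_norm// mul1r.
Qed.

(* A C^{1,1} regularisation of the positive part, equal to [s - k] for s >= 2k. *)
Definition ramp k s := (sqp s - sqp (s - 2 * k)) / (4 * k).
Definition ramp' k s := (pospart s - pospart (s - 2 * k)) / (2 * k).

Lemma is_derive_ramp k s : 0 < k -> is_derive s 1 (ramp k) (ramp' k s).
Proof.
move=> k0; apply: (@is_derive_quad _ _ _ (1 / (4 * k))) => y.
have /andP[A1 A2] := sqp_taylor s y.
have /andP[B1 B2] := sqp_taylor (s - 2 * k) (y - 2 * k).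
have e : y - 2 * k - (s - 2 * k) = y - s by ring.
rewrite e in B1 B2.
have -> : ramp k y - ramp k s - ramp' k s * (y - s) =
  (1 / (4 * k)) * ((sqp y - sqp s - 2 * pospart s * (y - s)) -
  (sqp (y - 2 * k) - sqp (s - 2 * k) - 2 * pospart (s - 2 * k) * (y - s))).
  by rewrite /ramp /ramp'; field; rewrite gt_eqF.
have k4 : 0 <= 1 / (4 * k) by rewrite divr_ge0//; lra.
rewrite normrM ger0_norm//; apply: ler_wpM2l => //.
by rewrite ler_norml; apply/andP; split; lra.
Qed.

Lemma ramp_taylor k s y : 0 < k ->
  `|ramp k y - ramp k s - ramp' k s * (y - s)| <= (y - s) ^+ 2 / (4 * k).
Proof.
move=> k0.
have /andP[A1 A2] := sqp_taylor s y.
have /andP[B1 B2] := sqp_taylor (s - 2 * k) (y - 2 * k).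
have e : y - 2 * k - (s - 2 * k) = y - s by ring.
rewrite e in B1 B2.
have -> : ramp k y - ramp k s - ramp' k s * (y - s) =
  ((sqp y - sqp s - 2 * pospart s * (y - s)) -
  (sqp (y - 2 * k) - sqp (s - 2 * k) - 2 * pospart (s - 2 * k) * (y - s))) / (4 * k).
  by rewrite /ramp /ramp'; field; rewrite gt_eqF.
rewrite normrM normfV (@ger0_norm _ (4 * k)); last by lra.
apply: ler_wpM2r; first by rewrite invr_ge0; lra.
by rewrite ler_norml; apply/andP; split; lra.
Qed.

Lemma ramp'_itv k s : 0 < k -> 0 <= ramp' k s <= 1.
Proof.
move=> k0; rewrite /ramp' ler_pdivlMr ?ler_pdivrMr; [|lra..].
by case: (pospartP s) => -[? ->]; case: (pospartP (s - 2 * k)) => -[? ->];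
  apply/andP; split; lra.
Qed.

Lemma ramp'_lip k a b : 0 < k -> `|ramp' k a - ramp' k b| <= `|a - b| / (2 * k).
Proof.
move=> k0; rewrite /ramp' -mulrBl normrM normfV (@ger0_norm _ (2 * k)); last lra.
apply: ler_wpM2r; first by rewrite invr_ge0; lra.
wlog ab : a b / a <= b => [H|].
  by case: (leP a b) => [/H//|/ltW/H]; rewrite distrC (distrC a).
rewrite distrC (distrC a) (ger0_norm (x := b - a)) ?subr_ge0// ler_norml.
case: (pospartP a) => -[? ->]; case: (pospartP (a - 2 * k)) => -[? ->];
case: (pospartP b) => -[? ->]; case: (pospartP (b - 2 * k)) => -[? ->];
  by apply/andP; split; lra.
Qed.

Lemma ramp'_le0 k s : 0 < k -> s <= 0 -> ramp' k s = 0.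
Proof.
by move=> k0 s0; rewrite /ramp' !pospart_le0 ?subrr ?mul0r//; lra.
Qed.

Lemma ramp_le0 k s : 0 < k -> s <= 0 -> ramp k s = 0.
Proof.
by move=> k0 s0; rewrite /ramp /sqp !pospart_le0 ?subrr ?mul0r//; lra.
Qed.

Lemma ramp_affine k s : 0 < k -> 2 * k <= s -> ramp k s = s - k.
Proof.
move=> k0 s0; rewrite /ramp /sqp !pospart_id; [|lra..].
by field; rewrite gt_eqF.
Qed.

Lemma ramp_mono k a b : 0 < k -> a <= b -> 0 <= ramp k b - ramp k a <= b - a.
Proof.
move=> k0 ab; rewrite /ramp /sqp -mulrBl ler_pdivlMr ?ler_pdivrMr; [|lra..].
case: (pospartP a) => -[? ->]; case: (pospartP (a - 2 * k)) => -[? ->];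
case: (pospartP b) => -[? ->]; case: (pospartP (b - 2 * k)) => -[? ->];
  by apply/andP; split; nra.
Qed.

Lemma ramp_lip k a b : 0 < k -> `|ramp k a - ramp k b| <= `|a - b|.
Proof.
move=> k0; wlog ab : a b / a <= b => [H|].
  by case: (leP a b) => [/H//|/ltW/H]; rewrite distrC (distrC a).
have /andP[? ?] := ramp_mono k0 ab.
by rewrite distrC (distrC a) !ger0_norm ?subr_ge0//; lra.
Qed.

Lemma ramp_itv k s : 0 < k -> s - k <= ramp k s /\ 0 <= ramp k s <= pospart s.
Proof.
move=> k0; case: (leP s 0) => s0.
  by rewrite ramp_le0// pospart_le0// lexx; split => //; lra.
have /andP[] := ramp_mono k0 (ltW s0); rewrite (ramp_le0 k0 (lexx 0)) !subr0.
move=> -> rs; rewrite pospart_id ?rs; last exact: ltW.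
split=> //.
case: (leP (2 * k) s) => s2; first by rewrite ramp_affine.
rewrite /ramp /sqp (pospart_le0 (x := s - 2 * k)) ?(pospart_id (ltW s0)); last lra.
by rewrite ler_pdivlMr; [nra|lra].
Qed.

Lemma continuous_ramp k : 0 < k -> continuous (ramp k).
Proof. by move=> k0 x; exact: is_derive_continuous (is_derive_ramp x k0). Qed.

Lemma continuous_ramp' k : continuous (ramp' k).
Proof.
move=> x; apply: cvgMr_tmp; apply: cvgB; first exact: continuous_pospart.
apply: (@continuous_comp _ _ _ (fun x => x - 2 * k)); last exact: continuous_pospart.
by apply: cvgB; [exact: cvg_id|exact: cvg_cst].
Qed.

(** A C^{1,1} step from 0 for x <= 0 to 1 for x >= 1, with second derivative 4 on the first half of
    [0, 1] and -4 on the second. *)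
Definition cutf x := 2 * sqp x - 4 * sqp (x - 1 / 2) + 2 * sqp (x - 1).
Definition cutf' x := 4 * pospart x - 8 * pospart (x - 1 / 2) + 4 * pospart (x - 1).

Lemma is_derive_cutf x : is_derive x 1 cutf (cutf' x).
Proof.
apply: (@is_derive_quad _ _ _ 8) => y.
have /andP[A1 A2] := sqp_taylor x y.
have /andP[B1 B2] := sqp_taylor (x - 1 / 2) (y - 1 / 2).
have /andP[C1 C2] := sqp_taylor (x - 1) (y - 1).
have e c : y - c - (x - c) = y - x by ring.
rewrite e in B1 B2; rewrite e in C1 C2.
rewrite /cutf /cutf' ler_norml; apply/andP; split; lra.
Qed.

Lemma continuous_cutf' : continuous cutf'.
Proof.
have c a k : continuous (fun x => k * pospart (x - a)).
  move=> x; apply: cvgMl_tmp.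
  apply: (@continuous_comp _ _ _ (fun x => x - a)); last exact: continuous_pospart.
  by apply: cvgB; [exact: cvg_id|exact: cvg_cst].
rewrite (_ : cutf' = fun x => 4 * pospart (x - 0) - 8 * pospart (x - 1 / 2)
  + 4 * pospart (x - 1)); last by apply/funext => x; rewrite subr0.
by move=> x; apply: cvgD; [apply: cvgB|]; exact: c.
Qed.

Lemma cutf_le0 x : x <= 0 -> cutf x = 0.
Proof.
by move=> x0; rewrite /cutf /sqp !pospart_le0 ?expr0n/= ?mulr0 ?subr0 ?addr0//; lra.
Qed.

Lemma cutf_itv x : 0 <= cutf x <= 1.
Proof.
rewrite /cutf /sqp; case: (pospartP x) => -[? ->];
case: (pospartP (x - 1 / 2)) => -[? ->]; case: (pospartP (x - 1)) => -[? ->];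
  by apply/andP; split; nra.
Qed.

(** The first power of the distance to 1 on the right is the weight [lay] of [layer_energy], to
    which the gradient of the cutoff will be charged. *)
Lemma cutf'_sqr x : 0 <= x -> cutf' x ^+ 2 <= 16 * pospart (1 - x).
Proof.
rewrite /cutf' => x0; case: (pospartP x) => -[? ->];
case: (pospartP (x - 1 / 2)) => -[? ->]; case: (pospartP (x - 1)) => -[? ->];
case: (pospartP (1 - x)) => -[? ->]; nra.
Qed.

End pospart.

(** * Calculus of C^1 functions and estimates in a layer along the arc *)

Section C1w.
Context {R : realType}.
Implicit Types (f g w V : R -> R -> R) (a b c tau : R).

(** The partial derivatives are carried as explicit functions, so that the calculus rules produce
    closed formulas for the gradients entering the energies. *)
Record C1w f f1 f2 : Prop := MkC1w {
  C1w_cont : cont2 f;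
  C1w_cont1 : cont2 f1;
  C1w_cont2 : cont2 f2;
  C1w_d1 : forall x y : R, is_derive x 1 (fun t => f t y) (f1 x y);
  C1w_d2 : forall x y : R, is_derive y 1 (f x) (f2 x y) }.

Lemma C1w_pd1 f f1 f2 : C1w f f1 f2 -> pd1 f = f1.
Proof.
move=> [_ _ _ d1 _]; apply/funext => x; apply/funext => y.
by rewrite /pd1 derive1E; have [_] := d1 x y.
Qed.

Lemma C1w_pd2 f f1 f2 : C1w f f1 f2 -> pd2 f = f2.
Proof.
move=> [_ _ _ _ d2]; apply/funext => x; apply/funext => y.
by rewrite /pd2 derive1E; have [_] := d2 x y.
Qed.

Lemma C1w_C1R2 f f1 f2 : C1w f f1 f2 -> C1R2 f.
Proof.
move=> h; split; first by case: h => _ _ _ d1 d2 x y; split; [case: (d1 x y)|case: (d2 x y)].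
by rewrite (C1w_pd1 h) (C1w_pd2 h); case: h.
Qed.

Lemma C1R2_C1w w : C1R2 w -> C1w w (pd1 w) (pd2 w).
Proof.
move=> [d [cw [c1 c2]]].
have d1 (x y : R) : is_derive x 1 (fun t => w t y) (pd1 w x y).
  by rewrite /pd1 derive1E; apply: DeriveDef; [exact: (d x y).1|].
have d2 (x y : R) : is_derive y 1 (fun t => w x t) (pd2 w x y).
  by rewrite /pd2 derive1E; apply: DeriveDef; [exact: (d x y).2|].
exact: (MkC1w cw c1 c2 d1 d2).
Qed.

Lemma C1w_cst c : C1w (fun _ _ => c) (fun _ _ => 0) (fun _ _ => 0).
Proof. by split; try exact: cont2_cst; move=> x y; exact: is_derive_cst. Qed.

Lemma C1wD f f1 f2 g g1 g2 : C1w f f1 f2 -> C1w g g1 g2 ->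
  C1w (fun x y => f x y + g x y) (fun x y => f1 x y + g1 x y)
    (fun x y => f2 x y + g2 x y).
Proof.
move=> [? ? ? df1 df2] [? ? ? dg1 dg2]; split; try by cont2_tac.
  by move=> x y; exact: (is_deriveD (df1 x y) (dg1 x y)).
by move=> x y; exact: (is_deriveD (df2 x y) (dg2 x y)).
Qed.

Lemma C1wM f f1 f2 g g1 g2 : C1w f f1 f2 -> C1w g g1 g2 ->
  C1w (fun x y => f x y * g x y) (fun x y => f1 x y * g x y + f x y * g1 x y)
    (fun x y => f2 x y * g x y + f x y * g2 x y).
Proof.
move=> [? ? ? df1 df2] [? ? ? dg1 dg2]; split; try by cont2_tac.
  move=> x y; apply: is_derive_eq (is_deriveM (df1 x y) (dg1 x y)) _.
  by rewrite /GRing.scale /= addrC mulrC.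
move=> x y; apply: is_derive_eq (is_deriveM (df2 x y) (dg2 x y)) _.
by rewrite /GRing.scale /= addrC mulrC.
Qed.

Lemma C1w_comp (phi phi' : R -> R) f f1 f2 :
  (forall x : R, is_derive x 1 phi (phi' x)) -> continuous phi' -> C1w f f1 f2 ->
  C1w (fun x y => phi (f x y)) (fun x y => phi' (f x y) * f1 x y)
    (fun x y => phi' (f x y) * f2 x y).
Proof.
move=> dphi cphi' [cf cf1 cf2 df1 df2]; split.
- by apply: cont2_comp => // x; exact: is_derive_continuous (dphi x).
- by apply: cont2M => //; exact: cont2_comp.
- by apply: cont2M => //; exact: cont2_comp.
- by move=> x y; exact: (is_derive1_comp (dphi _) (df1 x y)).
- by move=> x y; exact: (is_derive1_comp (dphi _) (df2 x y)).
Qed.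

Lemma C1wZ c f f1 f2 : C1w f f1 f2 ->
  C1w (fun x y => c * f x y) (fun x y => c * f1 x y) (fun x y => c * f2 x y).
Proof.
move=> h; apply: (@C1w_comp ( *%R c) (fun=> c)) => // x; last exact: cvg_cst.
by apply: is_derive_eq (is_deriveZ c (is_derive_id x 1)) _; rewrite /GRing.scale /= mulr1.
Qed.

Lemma C1w_eq f f1 f2 g1 g2 : C1w f f1 f2 -> (forall x y, f1 x y = g1 x y) ->
  (forall x y, f2 x y = g2 x y) -> C1w f g1 g2.
Proof.
move=> h e1 e2; have -> : g1 = f1 by apply/funext => x; apply/funext.
by have -> : g2 = f2 by apply/funext => x; apply/funext.
Qed.

Lemma C1w_dilate a f f1 f2 : C1w f f1 f2 ->
  C1w (fun x y => f (a * x) (a * y)) (fun x y => a * f1 (a * x) (a * y))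
    (fun x y => a * f2 (a * x) (a * y)).
Proof.
move=> [cf cf1 cf2 df1 df2].
have da (x : R) : is_derive x 1 ( *%R a) a.
  by apply: is_derive_eq (is_deriveZ a (is_derive_id x 1)) _; rewrite /GRing.scale /= mulr1.
have cs g : cont2 g -> cont2 (fun x y => g (a * x) (a * y)).
  by move=> cg; apply: (cont2_subst cg); cont2_tac.
apply: MkC1w; [exact: cs|exact: (cont2M (@cont2_cst _ a) (cs _ cf1))
  |exact: (cont2M (@cont2_cst _ a) (cs _ cf2))| |].
- move=> x y; apply: is_derive_eq (@is_derive1_comp _ (fun t => f t (a * y))
    ( *%R a) _ _ _ (df1 _ _) (da x)) _; exact: mulrC.
- move=> x y; apply: is_derive_eq (@is_derive1_comp _ (f (a * x))
    ( *%R a) _ _ _ (df2 _ _) (da y)) _; exact: mulrC.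
Qed.

Lemma C1w_x : C1w (fun x _ => x) (fun _ _ => 1) (fun _ _ => 0).
Proof.
by split; try cont2_tac; move=> x y; [exact: is_derive_id|exact: is_derive_cst].
Qed.

Lemma C1w_y : C1w (fun _ y => y) (fun _ _ => 0) (fun _ _ => 1).
Proof.
by split; try cont2_tac; move=> x y; [exact: is_derive_cst|exact: is_derive_id].
Qed.

Lemma C1w_sumsq : C1w (fun x y => x ^+ 2 + y ^+ 2) (fun x _ => 2 * x) (fun _ y => 2 * y).
Proof.
by apply: C1w_eq (C1wD (C1wM C1w_x C1w_x) (C1wM C1w_y C1w_y)) _ _ => x y; ring.
Qed.

Definition energy f1 f2 : R := II (fun x y => f1 x y ^+ 2 + f2 x y ^+ 2).

(** Integrates the y-derivative of (y - 1) f^2: the weight is nonpositive on the arc, so only the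
    base trace survives. It supplies the L^2 part of the Cauchy condition of [dir_adm] from
    gradients and base traces. *)
Lemma poincare f f1 f2 : C1w f f1 f2 ->
  II (fun x y => f x y ^+ 2) <= 2 * flat (fun x => f x 0 ^+ 2) + 4 * energy f1 f2.
Proof.
move=> h; have [cf cf1 cf2 _ _] := h.
pose G x y := (y - 1) * f x y ^+ 2.
pose g x y := f x y ^+ 2 + 2 * (y - 1) * f x y * f2 x y.
have cG : cont2 G by rewrite /G; cont2_tac.
have cg : cont2 g by rewrite /g; cont2_tac.
have dG (x y : R) : 0 < y -> is_derive y 1 (G x) (g x y).
  move=> _; apply: is_derive_eq
    (C1w_d2 (C1wM (C1wD C1w_y (C1w_cst (- 1))) (C1wM h h)) x y) _.
  by rewrite /g; ring.
have := divergence_vertical cG cg dG.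
have -> : flat (fun x => G x 0) = - flat (fun x => f x 0 ^+ 2).
  rewrite -mulN1r -RintegralZl; last 2 first.
  - exact: measurable_itv.
  - apply: (@integrable_continuous_oo _ (fun x => f x 0 ^+ 2)).
    apply: (@cont2_curve _ (fun x y => f x y ^+ 2)); first by cont2_tac.
      by move=> x; exact: cvg_id.
    by move=> x; exact: cvg_cst.
  by apply: eq_Rintegral => x _; rewrite /G sub0r.
have aG : arc (fun x y => G x y * y) <= 0.
  rewrite -[leRHS](mul0r pi) -arc_cst; apply: le_arc; [cont2_tac..|].
  move=> x y xy y0; rewrite /G; have := sqr_ge0 (f x y); have : y <= 1 by nra.
  by move=> y1 fxy; have := mulr_ge0 y0 fxy; nra.
have cE : cont2 (fun x y => f1 x y ^+ 2 + f2 x y ^+ 2) by cont2_tac.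
have : II (fun x y => f x y ^+ 2 + (- 4) * (f1 x y ^+ 2 + f2 x y ^+ 2)) <=
    II (fun x y => 2 * g x y).
  apply: le_II; [cont2_tac..|move=> x y [/= xy y0]; rewrite /g].
  have y1 : y <= 1 by nra.
  have := sqr_ge0 (f1 x y); have := sqr_ge0 (f x y + 2 * (y - 1) * f2 x y).
  have : (y - 1) ^+ 2 * f2 x y ^+ 2 <= 1 * f2 x y ^+ 2.
    by apply: ler_wpM2r; [exact: sqr_ge0|nra].
  nra.
rewrite IID ?IIZ//; [|cont2_tac..]; rewrite -/(energy f1 f2); lra.
Qed.

(** Equals 1 on the arc and, inside the disk, vanishes where 1 - r^2 >= tau: the profile of a
    boundary layer. *)
Definition lay tau x y := pospart (1 - (1 - (x ^+ 2 + y ^+ 2)) / tau).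

Lemma cont2_lay tau : cont2 (lay tau).
Proof. by apply: (cont2_comp continuous_pospart); cont2_tac. Qed.

Lemma lay_le1 tau x y : 0 < tau -> x ^+ 2 + y ^+ 2 <= 1 -> 0 <= lay tau x y <= 1.
Proof.
move=> t0 xy; rewrite /lay pospart_ge0 /=.
have : 0 <= (1 - (x ^+ 2 + y ^+ 2)) / tau by apply: divr_ge0; lra.
by case: (pospartP (1 - (1 - (x ^+ 2 + y ^+ 2)) / tau)) => -[? ->]; lra.
Qed.

Lemma C1w_sqr_lay tau : C1w (fun x y => lay tau x y ^+ 2)
  (fun x y => 4 * x * lay tau x y / tau) (fun x y => 4 * y * lay tau x y / tau).
Proof.
have csq : continuous (fun x : R => 2 * pospart x).
  by move=> x; apply: cvgMl_tmp; exact: continuous_pospart.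
have e x y : 1 - tau^-1 + tau^-1 * (x ^+ 2 + y ^+ 2) =
  1 - (1 - (x ^+ 2 + y ^+ 2)) / tau by ring.
have := C1w_comp is_derive_sqp csq
  (C1wD (C1w_cst (1 - tau^-1)) (C1wZ tau^-1 C1w_sumsq)).
rewrite (_ : (fun x y => sqp _) = (fun x y => lay tau x y ^+ 2)); last first.
  by apply/funext => x; apply/funext => y; rewrite e.
by move=> h; apply: C1w_eq h _ _ => x y; rewrite e /lay; ring.
Qed.

Definition chi tau x y := cutf ((1 - (x ^+ 2 + y ^+ 2)) / tau).
Definition chi' tau x y := cutf' ((1 - (x ^+ 2 + y ^+ 2)) / tau) * (- 2 / tau).

Lemma C1w_chi tau :
  C1w (chi tau) (fun x y => chi' tau x y * x) (fun x y => chi' tau x y * y).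
Proof.
have e x y : tau^-1 + (- tau^-1) * (x ^+ 2 + y ^+ 2) =
  (1 - (x ^+ 2 + y ^+ 2)) / tau by ring.
have := C1w_comp is_derive_cutf continuous_cutf'
  (C1wD (C1w_cst tau^-1) (C1wZ (- tau^-1) C1w_sumsq)).
rewrite (_ : (fun x y => cutf _) = chi tau); last first.
  by apply/funext => x; apply/funext => y; rewrite e.
by move=> h; apply: C1w_eq h _ _ => x y; rewrite e /chi'; ring.
Qed.

Lemma chi_itv tau x y : 0 <= chi tau x y <= 1.
Proof. exact: cutf_itv. Qed.

Lemma chi'_sqr tau x y : 0 < tau -> x ^+ 2 + y ^+ 2 <= 1 ->
  chi' tau x y ^+ 2 <= 64 * lay tau x y / tau ^+ 2.
Proof.
move=> t0 xy; rewrite /chi' exprMn.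
have z0 : 0 <= (1 - (x ^+ 2 + y ^+ 2)) / tau by apply: divr_ge0; lra.
have -> : 64 * lay tau x y / tau ^+ 2 = 16 * lay tau x y * (- 2 / tau) ^+ 2.
  by field; rewrite gt_eqF.
by apply: ler_wpM2r; [exact: sqr_ge0|exact: cutf'_sqr].
Qed.

Lemma chi_outside tau x y : 0 < tau -> 1 <= x ^+ 2 + y ^+ 2 -> chi tau x y = 0.
Proof.
move=> t0 xy; apply: cutf_le0; rewrite -oppr_ge0 -mulNr; apply: divr_ge0; lra.
Qed.

Lemma chi_near1 tau x y : 0 < tau -> x ^+ 2 + y ^+ 2 <= 1 ->
  0 <= 1 - chi tau x y <= 2 * lay tau x y.
Proof.
move=> t0 xy; have /andP[c0 c1] := chi_itv tau x y.
rewrite subr_ge0 c1 /= /chi /lay /cutf /sqp.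
set z := _ / tau.
have z0 : 0 <= z by apply: divr_ge0; lra.
case: (pospartP z) => -[? ->]; case: (pospartP (z - 1 / 2)) => -[? ->];
case: (pospartP (z - 1)) => -[? ->]; case: (pospartP (1 - z)) => -[? ->]; nra.
Qed.

(* Integrates the divergence of [V^2 (lay tau)^2 (x, y) / tau]. *)
Lemma layer_energy V V1 V2 tau : C1w V V1 V2 -> 0 < tau ->
  3 * II (fun x y => V x y ^+ 2 * (x ^+ 2 + y ^+ 2) * lay tau x y / tau ^+ 2) <=
  arc (fun x y => V x y ^+ 2) / tau +
  II (fun x y => lay tau x y ^+ 2 * (V1 x y ^+ 2 + V2 x y ^+ 2)).
Proof.
move=> h t0; have [cV cV1 cV2 _ _] := h; have cl := @cont2_lay tau.
have hF := C1wZ tau^-1 (C1wM (C1wM (C1wM h h) (C1w_sqr_lay tau)) C1w_x).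
have hG := C1wZ tau^-1 (C1wM (C1wM (C1wM h h) (C1w_sqr_lay tau)) C1w_y).
have := divergence_halfdisk (C1w_cont hF) (C1w_cont hG) (C1w_cont1 hF) (C1w_cont2 hG)
  (fun x y _ => C1w_d1 hF x y) (fun x y _ => C1w_d2 hG x y).
rewrite (_ : flat _ = 0); last first.
  rewrite -[RHS](mul0r (fine (@lebesgue_measure R (@oI11 R)))) -Rintegral_cst.
    by apply: eq_Rintegral => x _; rewrite !mulr0.
  exact: measurable_itv.
rewrite subr0; set D := II _; set A := arc _ => DA.
have AE : A = arc (fun x y => V x y ^+ 2) / tau.
  rewrite [RHS]mulrC -arcZ; last by cont2_tac.
  apply: eq_arc => x y xy; rewrite /lay xy subrr mul0r subr0 pospart_id//.
  transitivity (tau^-1 * V x y ^+ 2 * (x ^+ 2 + y ^+ 2)); last by rewrite xy mulr1.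
  by ring.
rewrite -AE -DA /D.
rewrite -IID; [|by case: hF => ? ? ? _ _; case: hG => ? ? ? _ _; cont2_tac|by cont2_tac].
rewrite -IIZ; last by cont2_tac.
apply: le_II; [cont2_tac|by case: hF => ? ? ? _ _; case: hG => ? ? ? _ _; cont2_tac|].
move=> x y /HD_disk xy; have /andP[l0 l1] := lay_le1 t0 xy.
rewrite -subr_ge0.
set v := V x y; set v1 := V1 x y; set v2 := V2 x y; set l := lay tau x y in l0 l1 *.
(* Two completed squares; the remaining terms are nonnegative because 0 <= l <= 1 in the disk. *)
rewrite [X in 0 <= X](_ : _ = (l * (v1 + v * x / tau)) ^+ 2 + (l * (v2 + v * y / tau)) ^+ 2
  + 2 * v ^+ 2 * l ^+ 2 / tau + (v ^+ 2 * (x ^+ 2 + y ^+ 2) / tau ^+ 2) * (l * (1 - l))); last by field; rewrite gt_eqF.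
have l3 : 0 <= l * (1 - l) by rewrite mulr_ge0// subr_ge0.
apply: addr_ge0; last first.
  apply: mulr_ge0 => //; apply: divr_ge0; last exact: sqr_ge0.
  by apply: mulr_ge0; [exact: sqr_ge0|apply: addr_ge0; exact: sqr_ge0].
apply: addr_ge0; first by apply: addr_ge0; exact: sqr_ge0.
by apply: divr_ge0; [apply: mulr_ge0; [apply: mulr_ge0 => //|]; exact: sqr_ge0|exact: ltW].
Qed.

Lemma energy_ge0 (f1 f2 : R -> R -> R) : 0 <= energy f1 f2.
Proof. by apply: II_ge0 => x y _; apply: addr_ge0; exact: sqr_ge0. Qed.

(** The case V = 1 of [layer_energy]. As tau <= 1/2, the layer lies in r^2 >= 1/2, so the weight r^2
    there costs only a factor 2. *)
Lemma layer_area tau : 0 < tau -> tau <= 1 / 2 ->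
  II (fun x y => lay tau x y ^+ 2) <= pi * tau.
Proof.
move=> t0 t2; have cl := @cont2_lay tau.
have := layer_energy (C1w_cst 1) t0.
rewrite (_ : arc _ = pi); last first.
  by rewrite -[RHS]mul1r -arc_cst; apply: eq_arc => x y _; rewrite expr1n.
rewrite (_ : II (fun x y => lay tau x y ^+ 2 * _) = 0); last first.
  rewrite -[RHS](mul0r (II (fun _ _ => 0))) -IIZ; last by cont2_tac.
  by apply: eq_II => x y _; ring.
rewrite addr0 -ler_pdivlMl// => H.
have : II (fun x y => lay tau x y ^+ 2) <= II (fun x y => (2 * tau ^+ 2) *
    (1 ^+ 2 * (x ^+ 2 + y ^+ 2) * lay tau x y / tau ^+ 2)).
  apply: le_II; [cont2_tac..|move=> x y /HD_disk xy].
  rewrite expr1n mul1r [leRHS](_ : _ = 2 * (x ^+ 2 + y ^+ 2) * lay tau x y); last first.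
    by field; rewrite gt_eqF.
  have /andP[l0 l1] := lay_le1 t0 xy; case: (leP (x ^+ 2 + y ^+ 2) (1 / 2)) => r2; last nra.
  have -> : lay tau x y = 0.
    rewrite /lay pospart_le0// subr_le0 ler_pdivlMr//; lra.
  by rewrite expr0n mulr0.
rewrite IIZ; last by cont2_tac.
move=> /le_trans; apply; rewrite -ler_pdivlMl; last by rewrite mulr_gt0 ?exprn_gt0.
apply: le_trans H _.
rewrite [leRHS](_ : _ = 2^-1 * (pi / tau)); last by field; rewrite gt_eqF.
by apply: ler_wpM2r; [rewrite divr_ge0 ?pi_ge0 ?ltW|lra].
Qed.

End C1w.

(** * Cutting a function off near the arc *)

Section cutoff.
Context {R : realType}.
Implicit Types (V : R -> R -> R) (b tau x y : R).

Lemma cont2_energy (f f1 f2 : R -> R -> R) : C1w f f1 f2 ->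
  cont2 (fun x y => f1 x y ^+ 2 + f2 x y ^+ 2).
Proof. by move=> [_ cf1 cf2 _ _]; cont2_tac. Qed.

Lemma chi'_outside tau x y : 0 < tau -> 1 <= x ^+ 2 + y ^+ 2 -> chi' tau x y = 0.
Proof.
move=> t0 xy; rewrite /chi' /cutf'.
have z0 : (1 - (x ^+ 2 + y ^+ 2)) / tau <= 0.
  by rewrite -oppr_ge0 -mulNr; apply: divr_ge0; lra.
by rewrite !pospart_le0 ?mulr0 ?subr0 ?addr0 ?mul0r//; lra.
Qed.

(** Young's inequality with parameter b splits the gradient of chi V. The part V grad chi is bounded
    by [chi'_sqr] and [layer_energy], and 22 exceeds 64 / 3. Apart from (1 + b) times the energy,
    the cost is the arc trace over tau and the energy inside the layer, both of which can be made
    small. *)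
Lemma cutoff_energy V V1 V2 b tau : C1w V V1 V2 -> 0 < b -> 0 < tau ->
  exists Y1 Y2, [/\ C1w (fun x y => chi tau x y * V x y) Y1 Y2,
    energy Y1 Y2 <= (1 + b) * energy V1 V2 + (1 + b^-1) * 22 *
      (arc (fun x y => V x y ^+ 2) / tau +
       II (fun x y => lay tau x y ^+ 2 * (V1 x y ^+ 2 + V2 x y ^+ 2))) &
    forall x y, 1 <= x ^+ 2 + y ^+ 2 -> Y1 x y = 0 /\ Y2 x y = 0].
Proof.
move=> h b0 t0; have [cV cV1 cV2 _ _] := h; have cl := @cont2_lay _ tau.
have hc := C1w_chi tau; have [cc cc1 cc2 _ _] := hc.
have hY := C1wM hc h; do 2 eexists; split; [exact: hY| |]; last first.
  by move=> x y xy /=; rewrite chi'_outside// chi_outside// !mul0r addr0.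
have LE := layer_energy h t0.
have bi : 0 < b^-1 by rewrite invr_gt0.
set S := _ / tau + _ in LE *.
apply: (@le_trans _ _ ((1 + b) * energy V1 V2 + (1 + b^-1) * 64 *
  II (fun x y => V x y ^+ 2 * (x ^+ 2 + y ^+ 2) * lay tau x y / tau ^+ 2))).
  rewrite /energy -!IIZ; [|cont2_tac..].
  rewrite -IID; [|cont2_tac..].
  apply: le_II; [exact: cont2_energy hY|cont2_tac|].
  move=> x y /HD_disk xy; have /andP[c0 c1] := chi_itv tau x y.
  have := chi'_sqr t0 xy; set q := chi' tau x y => qle.
  set v := V x y; set v1 := V1 x y; set v2 := V2 x y; set c := chi tau x y in c0 c1 *.
  have r0 : 0 <= x ^+ 2 + y ^+ 2 by apply: addr_ge0; exact: sqr_ge0.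
  have c2 : c ^+ 2 * (v1 ^+ 2 + v2 ^+ 2) <= v1 ^+ 2 + v2 ^+ 2.
    rewrite ler_piMl//; first by apply: addr_ge0; exact: sqr_ge0.
    by rewrite exprn_ile1.
  have q2 : q ^+ 2 * (v ^+ 2 * (x ^+ 2 + y ^+ 2)) <=
      64 * lay tau x y / tau ^+ 2 * (v ^+ 2 * (x ^+ 2 + y ^+ 2)).
    by apply: ler_wpM2r => //; rewrite mulr_ge0 ?sqr_ge0.
  have bb : b * b^-1 = 1 by rewrite divff// gt_eqF.
  have young s t : (s + t) ^+ 2 <= (1 + b) * t ^+ 2 + (1 + b^-1) * s ^+ 2.
    rewrite -subr_ge0 [X in 0 <= X](_ : _ = b^-1 * (b * t - s) ^+ 2).
      by rewrite mulr_ge0 ?sqr_ge0// ltW.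
    by field; rewrite gt_eqF.
  have y1 := young (q * x * v) (c * v1).
  have y2 := young (q * y * v) (c * v2).
  apply: le_trans (lerD y1 y2) _.
  rewrite [leLHS](_ : _ = (1 + b) * (c ^+ 2 * (v1 ^+ 2 + v2 ^+ 2)) +
    (1 + b^-1) * (q ^+ 2 * (v ^+ 2 * (x ^+ 2 + y ^+ 2)))); last by ring.
  apply: lerD; first by apply: ler_wpM2l => //; lra.
  rewrite -[leRHS]mulrA; apply: ler_wpM2l; first by lra.
  by apply: le_trans q2 _; rewrite le_eqVlt; apply/orP; left; apply/eqP; ring.
rewrite lerD2l -[leLHS]mulrA -[leRHS]mulrA; apply: ler_wpM2l; first by lra.
have : 0 <= II (fun x y => V x y ^+ 2 * (x ^+ 2 + y ^+ 2) * lay tau x y / tau ^+ 2).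
  apply: II_ge0 => x y /HD_disk xy; have /andP[l0 _] := lay_le1 t0 xy.
  apply: divr_ge0; last exact: sqr_ge0.
  apply: mulr_ge0 => //; apply: mulr_ge0; first exact: sqr_ge0.
  by apply: addr_ge0; exact: sqr_ge0.
lra.
Qed.

End cutoff.

(** * Bounded measurable data on the base *)

Section bounded_measurable.
Context {R : realType}.
Local Notation mu := (@lebesgue_measure R).
Implicit Types (g h : R -> R).

(** A function of class [W12_1d] is controlled on [-1, 1] only and need not be continuous on the
    line; this is the regularity that it shares with the base traces of C^1 functions. *)
Definition bdm g := measurable_fun (@oI11 R) g /\
  exists M, forall x, oI11 x -> `|g x| <= M.

Lemma measurable_oI11 : measurable (@oI11 R).
Proof. exact: measurable_itv. Qed.

Lemma integrable_bdm g : bdm g -> mu.-integrable (@oI11 R) (EFin \o g).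
Proof.
move=> [mg [M gM]]; apply: measurable_bounded_integrable => //.
- exact: measurable_oI11.
- by rewrite [ltLHS]lebesgue_measure_itv /= lte_fin; case: ifP => _; rewrite -?EFinD ltry.
- exists M; split; first exact: num_real.
  by move=> N MN x /gM /le_trans; apply; exact: ltW.
Qed.

Lemma bdm_continuous g : continuous g -> bdm g.
Proof.
move=> cg; split; first exact: measurable_continuous.
have := @continuous_compact _ _ g `[-1, 1]%classic (continuous_subspaceT cg)
  (@segment_compact R (-1) 1).
move=> /compact_bounded[M [_ MP]]; exists (`|M| + 1) => x xI.
apply: (MP (`|M| + 1)).
  by rewrite (le_lt_trans (ler_norm M))// ltrDl.
by exists x => //; move: xI; rewrite /oI11 /= !in_itv /= => /andP[/ltW -> /ltW ->].
Qed.

Lemma bdm_cst (c : R) : bdm (fun=> c).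
Proof. by apply: bdm_continuous => x; exact: cvg_cst. Qed.

Lemma bdmD g h : bdm g -> bdm h -> bdm (fun x => g x + h x).
Proof.
move=> [mg [M gM]] [mh [N hN]]; split; first exact: measurable_funD.
by exists (M + N) => x xI; rewrite (le_trans (ler_normD _ _))// lerD ?gM ?hN.
Qed.

Lemma bdmM g h : bdm g -> bdm h -> bdm (fun x => g x * h x).
Proof.
move=> [mg [M gM]] [mh [N hN]]; split; first exact: measurable_funM.
by exists (M * N) => x xI; rewrite normrM ler_pM ?gM ?hN.
Qed.

Lemma bdmZ (c : R) g : bdm g -> bdm (fun x => c * g x).
Proof. by move=> bg; apply: bdmM => //; exact: bdm_cst. Qed.

Lemma bdmB g h : bdm g -> bdm h -> bdm (fun x => g x - h x).
Proof.
move=> bg bh; have := bdmD bg (bdmZ (-1) bh).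
by rewrite (_ : (fun x => g x + -1 * h x) = (fun x => g x - h x))//;
  apply/funext => x; rewrite mulN1r.
Qed.

Lemma bdm_sqr g : bdm g -> bdm (fun x => g x ^+ 2).
Proof. by move=> bg; exact: bdmM. Qed.

Lemma bdm_comp (phi : R -> R) g : continuous phi -> bdm g -> bdm (fun x => phi (g x)).
Proof.
move=> cphi [mg [M gM]]; split.
  by apply: measurableT_comp => //; exact: continuous_measurable_fun.
have := @continuous_compact _ _ phi `[- M, M]%classic (continuous_subspaceT cphi)
  (@segment_compact R (- M) M).
move=> /compact_bounded[N [_ NP]]; exists (`|N| + 1) => x xI.
apply: (NP (`|N| + 1)).
  by rewrite (le_lt_trans (ler_norm N))// ltrDl.
by exists (g x) => //=; rewrite in_itv /= -ler_norml gM.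
Qed.

Lemma bdm_flat (f : R -> R -> R) : cont2 f -> bdm (fun x => f x 0).
Proof.
move=> cf; apply: bdm_continuous; apply: (cont2_curve cf) => x; first exact: cvg_id.
exact: cvg_cst.
Qed.

Lemma flatD g h : bdm g -> bdm h -> flat (fun x => g x + h x) = flat g + flat h.
Proof.
by move=> bg bh; apply: RintegralD; [exact: measurable_oI11|exact: integrable_bdm..].
Qed.

Lemma flatZ (c : R) g : bdm g -> flat (fun x => c * g x) = c * flat g.
Proof.
by move=> bg; apply: RintegralZl; [exact: measurable_oI11|exact: integrable_bdm].
Qed.

Lemma le_flat g h : bdm g -> bdm h -> (forall x, -1 < x < 1 -> g x <= h x) ->
  flat g <= flat h.
Proof.
move=> bg bh gh; apply: le_Rintegral;
  [exact: measurable_oI11|exact: integrable_bdm..|].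
by move=> x; rewrite /oI11 /= in_itv /=; exact: gh.
Qed.

Lemma eq_flat g h : (forall x, -1 < x < 1 -> g x = h x) -> flat g = flat h.
Proof.
move=> gh; apply: eq_Rintegral => x /set_mem.
by rewrite /oI11 /= in_itv /=; exact: gh.
Qed.

Lemma flat_ge0 g : (forall x, 0 <= g x) -> 0 <= flat g.
Proof. by move=> g0; apply: Rintegral_ge0. Qed.

Lemma flat_cst (c : R) : flat (fun=> c) = 2 * c.
Proof.
rewrite /flat Rintegral_cst; last exact: measurable_oI11.
rewrite mulrC; congr (_ * _); rewrite -[RHS]/(fine (2%:E)); apply: (congr1 fine).
by rewrite [LHS]lebesgue_measure_itv /= lte_fin ifT; [congr EFin; ring|lra].
Qed.

Lemma EFin_flat g : bdm g -> (flat g)%:E = (\int[mu]_(x in @oI11 R) (g x)%:E)%E.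
Proof.
move=> bg; rewrite /flat /Rintegral fineK//; apply: integrable_fin_num.
  exact: measurable_oI11.
exact: integrable_bdm.
Qed.

(** The derivative of x lay^2 has integral 2 over (-1, 1). Where [lay] is nonzero, x^2 > 1/2, so tau
    times this derivative dominates [lay]. *)
Lemma flat_lay (tau : R) : 0 < tau -> tau <= 1 / 2 -> flat (fun x => lay tau x 0) <= 2 * tau.
Proof.
move=> t0 t2; pose F x := x * lay tau x 0 ^+ 2.
pose f x := lay tau x 0 ^+ 2 + x * (4 * x * lay tau x 0 / tau).
have cl : continuous (fun x => lay tau x 0).
  apply: (cont2_curve (@cont2_lay _ tau)) => x; [exact: cvg_id|exact: cvg_cst].
have dF (x : R) : is_derive x 1 F (f x).
  have := C1w_d1 (C1wM C1w_x (C1w_sqr_lay tau)) x 0.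
  by rewrite /F /f mul1r.
have cf : continuous f.
  move=> x; apply: cvgD; first by apply: cvgM; exact: cl.
  apply: cvgM; first exact: cvg_id.
  apply: cvgMr_tmp; apply: cvgM; last exact: cl.
  by apply: cvgMl_tmp; exact: cvg_id.
have bf := bdm_continuous cf.
have -> : 2 * tau = tau * flat f.
  rewrite mulrC; congr (_ * _); apply: EFin_inj; rewrite EFin_flat// (@FTC2_oo _ F)//.
  - rewrite /F /lay !sqrrN expr0n /= addr0 expr1n subrr mul0r subr0 pospart_id//.
    by congr EFin; ring.
  - by move=> x _; exact: is_derive_continuous (dF x).
rewrite -flatZ//; apply: le_flat; [exact: bdm_continuous|exact: bdmZ|].
move=> x /andP[x1 x2]; rewrite /f.
have xx : x ^+ 2 + 0 ^+ 2 <= 1 by nra.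
have /andP[l0 l1] := lay_le1 t0 xx.
rewrite mulrDr [X in _ + X](_ : _ = 4 * x ^+ 2 * lay tau x 0); last first.
  by field; rewrite gt_eqF.
apply: (@le_trans _ _ (4 * x ^+ 2 * lay tau x 0)); last first.
  by rewrite lerDr mulr_ge0 ?sqr_ge0// ltW.
case: (leP (x ^+ 2) (1 / 2)) => r2; last nra.
have -> : lay tau x 0 = 0; last by rewrite mulr0.
by rewrite /lay pospart_le0// subr_le0 ler_pdivlMr//; nra.
Qed.

End bounded_measurable.

(** * Admissible sequences of the Dirichlet problem *)

Section admissible.
Context {R : realType}.
Local Notation mu := (@lebesgue_measure R).
Implicit Types (gamma a : R) (u m : R -> R).

Lemma cvg_EFin_near (f : nat -> R) (l : R) :
  (forall e, 0 < e -> exists N, forall n, (N <= n)%N -> `|f n - l| <= e) ->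
  (fun n => (f n)%:E) @ \oo --> l%:E.
Proof.
move=> fl; apply/cvg_EFin; first by near=> n.
apply/cvgrPdist_le => e e0; have [N NP] := fl e e0.
by near=> n; rewrite distrC; apply: NP; near: n; exact: nbhs_infty_ge.
Unshelve. all: by end_near. Qed.

Lemma near_cvg_EFin (f : nat -> R) (l : R) :
  (fun n => (f n)%:E) @ \oo --> l%:E ->
  forall e, 0 < e -> exists N, forall n, (N <= n)%N -> `|f n - l| <= e.
Proof.
move=> /fine_cvg /cvgrPdist_le fl e e0; have [N _ NP] := fl e e0.
by exists N => n Nn; rewrite distrC; exact: NP.
Qed.

(* U stands for 1 - w, so that the arc constraint w <= 1 - gamma reads U >= gamma. *)
Record adm gamma u (U U1 U2 : nat -> R -> R -> R) : Prop := Adm {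
  adm_C1 : forall n, C1w (U n) (U1 n) (U2 n);
  adm_cauchy : forall e, 0 < e -> exists N, forall n k, (N <= n)%N -> (N <= k)%N ->
    energy (fun x y => U1 n x y - U1 k x y) (fun x y => U2 n x y - U2 k x y) <= e;
  adm_flat : forall e, 0 < e -> exists N, forall n, (N <= n)%N ->
    flat (fun x => (U n x 0 - u x) ^+ 2) <= e;
  adm_arc : forall e, 0 < e -> exists N, forall n, (N <= n)%N ->
    arc (fun x y => sqp (gamma - U n x y)) <= e }.

Lemma energy_le_diff f1 f2 g1 g2 : cont2 f1 -> cont2 f2 -> cont2 g1 -> cont2 g2 ->
  energy f1 f2 <= 2 * energy g1 g2 +
    2 * energy (fun x y => f1 x y - g1 x y) (fun x y => f2 x y - g2 x y) :> R.
Proof.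
move=> cf1 cf2 cg1 cg2; rewrite /energy -!IIZ; [|cont2_tac..].
rewrite -IID; [|cont2_tac..].
apply: le_II; [cont2_tac..|move=> x y _].
have := sqr_ge0 (f1 x y - 2 * g1 x y); have := sqr_ge0 (f2 x y - 2 * g2 x y); nra.
Qed.

(** The limit energy is finite because the gradients are Cauchy: from some index N on, the energies
    stay below 2 E N + 2. *)
Lemma dir_valsP gamma m (a : \bar R) : bdm m -> dir_vals gamma m a -> exists U U1 U2,
  adm gamma (fun x => 1 - m x) U U1 U2 /\ exists b : R, a = b%:E /\
  forall e, 0 < e -> exists N, forall n, (N <= n)%N ->
    `|energy (U1 n) (U2 n) - b| <= e.
Proof.
move=> bm [w [[C1 [Cau [flt ar]]] en]].
have C n : C1w (w n) (pd1 (w n)) (pd2 (w n)) by exact: C1R2_C1w.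
have cw n := C1w_cont (C n); have c1 n := C1w_cont1 (C n); have c2 n := C1w_cont2 (C n).
have CU n : C1w (fun x y => 1 - w n x y) (fun x y => - pd1 (w n) x y)
    (fun x y => - pd2 (w n) x y).
  have := C1wD (C1w_cst 1) (C1wZ (-1) (C n)).
  rewrite (_ : (fun x y => _ + _) = (fun x y => 1 - w n x y)); last first.
    by apply/funext => x; apply/funext => y; rewrite mulN1r.
  by move=> h; apply: (C1w_eq h) => x y; ring.
have A : adm gamma (fun x => 1 - m x) (fun n x y => 1 - w n x y)
    (fun n x y => - pd1 (w n) x y) (fun n x y => - pd2 (w n) x y).
  split => //.
  - move=> e /Cau[N NP]; exists N => n k Nn Nk; have := NP _ _ Nn Nk.
    rewrite -II_hd_int; last first.
      by have := cw n; have := cw k; have := c1 n; have := c1 k; have := c2 n;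
        have := c2 k => *; cont2_tac.
    rewrite lte_fin => /ltW; apply: le_trans.
    have := cw n; have := cw k; have := c1 n; have := c1 k; have := c2 n;
      have := c2 k => *.
    apply: le_II; [cont2_tac..|move=> x y _].
    have := sqr_ge0 (w n x y - w k x y); nra.
  - have b n : bdm (fun x => (w n x 0 - m x) ^+ 2).
      by apply: bdm_sqr; apply: bdmB => //; exact: bdm_flat.
    have e n : (\int[mu]_(x in @oI11 R) ((w n x 0 - m x) ^+ 2)%:E)%E =
       (flat (fun x => (w n x 0 - m x) ^+ 2))%:E by rewrite EFin_flat.
    rewrite (funext e) in flt.
    move=> d d0; have [N NP] := near_cvg_EFin flt d0; exists N => n /NP.
    rewrite subr0 => /(le_trans (ler_norm _)); apply: le_trans.
    by rewrite le_eqVlt; apply/orP; left; apply/eqP; apply: eq_flat => x _; ring.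
  - have c n : cont2 (fun x y => sqp (gamma - (1 - w n x y))).
      apply: cont2_comp; first by move=> x; exact: is_derive_continuous (is_derive_sqp x).
      by have := cw n => ?; cont2_tac.
    have e n : (\int[mu]_(t in @oIpi R)
      ((Num.max (w n (cos t) (sin t) - (1 - gamma)) 0) ^+ 2)%:E)%E =
      (arc (fun x y => sqp (gamma - (1 - w n x y))))%:E.
      rewrite (arcE (c n)); apply: eq_integral => t _; congr EFin.
      by rewrite /sqp /pospart; congr (Num.max _ _ ^+ 2); ring.
    rewrite (funext e) in ar.
    move=> d d0; have [N NP] := near_cvg_EFin ar d0; exists N => n /NP.
    by rewrite subr0 => /(le_trans (ler_norm _)).
do 3 eexists; split; first exact: A.
have e n : hd_int (fun x y => pd1 (w n) x y ^+ 2 + pd2 (w n) x y ^+ 2) =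
    (energy (fun x y => - pd1 (w n) x y) (fun x y => - pd2 (w n) x y))%:E.
  rewrite II_hd_int; last by have := c1 n; have := c2 n => *; cont2_tac.
  by congr hd_int; apply/funext => x; apply/funext => y; rewrite !sqrrN.
rewrite (funext e) in en.
have [N NP] := adm_cauchy A ltr01.
pose E n := energy (fun x y => - pd1 (w n) x y) (fun x y => - pd2 (w n) x y).
rewrite -/(EFin \o E) in en.
have Eb n : (N <= n)%N -> E n <= 2 * E N + 2.
  move=> Nn; rewrite -[X in _ <= _ + X]mulr1.
  apply: le_trans (energy_le_diff (C1w_cont1 (CU n)) (C1w_cont2 (CU n))
    (C1w_cont1 (CU N)) (C1w_cont2 (CU N))) _.
  by rewrite lerD2l ler_wpM2l//; exact: NP.
have a0 : (0%:E <= a)%E.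
  rewrite -(cvg_lim _ en)//; apply: lime_ge; first by apply/cvg_ex; exists a.
  by near=> n; rewrite lee_fin energy_ge0.
have aM : (a <= (2 * E N + 2)%:E)%E.
  rewrite -(cvg_lim _ en)//; apply: lime_le; first by apply/cvg_ex; exists a.
  by near=> n; rewrite lee_fin Eb//; near: n; exact: nbhs_infty_ge.
have afin : a \is a fin_num.
  by rewrite ge0_fin_numE//; apply: le_lt_trans aM _; exact: ltry.
exists (fine a); rewrite fineK//; split => //.
by apply: near_cvg_EFin; rewrite fineK.
Unshelve. all: by end_near. Qed.

Lemma parallelogram f1 f2 g1 g2 : cont2 f1 -> cont2 f2 -> cont2 g1 -> cont2 g2 ->
  energy (fun x y => f1 x y - g1 x y) (fun x y => f2 x y - g2 x y) =
  2 * energy f1 f2 + 2 * energy g1 g2 -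
  4 * energy (fun x y => 2^-1 * f1 x y + 2^-1 * g1 x y)
    (fun x y => 2^-1 * f2 x y + 2^-1 * g2 x y) :> R.
Proof.
move=> cf1 cf2 cg1 cg2; rewrite /energy -mulNr -!IIZ; [|cont2_tac..].
rewrite -!IID; [|cont2_tac..].
by apply: eq_II => x y _; field.
Qed.

Lemma sqp_mid s t : sqp (2^-1 * s + 2^-1 * t) <= 2^-1 * sqp s + 2^-1 * sqp t :> R.
Proof.
have := sqr_ge0 (pospart s - pospart t); rewrite /sqp.
case: (pospartP s) => -[? ->]; case: (pospartP t) => -[? ->];
case: (pospartP (2^-1 * s + 2^-1 * t)) => -[? ->]; nra.
Qed.

End admissible.

(** * Relaxed boundary conditions for the Dirichlet infimum *)

Section relaxation.
Context {R : realType}.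
Local Notation mu := (@lebesgue_measure R).
Implicit Types (gamma a d e : R) (u m : R -> R).

(** Both traces are imposed up to an error d in squared L^2 size. The constraints are convex and
    shrink with d, the two facts that drive the construction of a Cauchy sequence. *)
Definition near_energies gamma u d : set R := [set e | exists U U1 U2,
  [/\ C1w U U1 U2, flat (fun x => (U x 0 - u x) ^+ 2) <= d,
      arc (fun x y => sqp (gamma - U x y)) <= d & e = energy U1 U2]].

Lemma cont2_sqp (f : R -> R -> R) : cont2 f -> cont2 (fun x y => sqp (f x y)).
Proof.
by apply: cont2_comp => x; exact: is_derive_continuous (is_derive_sqp x).
Qed.

Lemma near_energies_mid gamma u d U U1 U2 V V1 V2 : bdm u ->
  C1w U U1 U2 -> C1w V V1 V2 ->
  flat (fun x => (U x 0 - u x) ^+ 2) <= d -> flat (fun x => (V x 0 - u x) ^+ 2) <= d ->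
  arc (fun x y => sqp (gamma - U x y)) <= d -> arc (fun x y => sqp (gamma - V x y)) <= d ->
  near_energies gamma u d (energy (fun x y => 2^-1 * U1 x y + 2^-1 * V1 x y)
    (fun x y => 2^-1 * U2 x y + 2^-1 * V2 x y)).
Proof.
move=> bu CU CV fU fV aU aV; do 3 eexists; split; last by [].
- exact: (C1wD (C1wZ 2^-1 CU) (C1wZ 2^-1 CV)).
- have bU : bdm (fun x => (U x 0 - u x) ^+ 2).
    by apply: bdm_sqr; apply: bdmB => //; exact: bdm_flat (C1w_cont CU).
  have bV : bdm (fun x => (V x 0 - u x) ^+ 2).
    by apply: bdm_sqr; apply: bdmB => //; exact: bdm_flat (C1w_cont CV).
  apply: (@le_trans _ _ (flat (fun x => 2^-1 * (U x 0 - u x) ^+ 2 +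
      2^-1 * (V x 0 - u x) ^+ 2))).
    apply: le_flat.
    - apply: bdm_sqr; apply: bdmB => //.
      exact: bdm_flat (C1w_cont (C1wD (C1wZ 2^-1 CU) (C1wZ 2^-1 CV))).
    - by apply: bdmD; apply: bdmZ.
    - by move=> x _; have := sqr_ge0 (U x 0 - V x 0); nra.
  rewrite flatD; [|exact: bdmZ..]; rewrite !flatZ//; lra.
- have cU := C1w_cont CU; have cV := C1w_cont CV.
  have sU : cont2 (fun x y => sqp (gamma - U x y)) by apply: cont2_sqp; cont2_tac.
  have sV : cont2 (fun x y => sqp (gamma - V x y)) by apply: cont2_sqp; cont2_tac.
  apply: (@le_trans _ _ (arc (fun x y => 2^-1 * sqp (gamma - U x y) +
      2^-1 * sqp (gamma - V x y)))).
    apply: le_arc.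
    - by apply: cont2_sqp; cont2_tac.
    - by apply: cont2D; apply: cont2M => //; exact: cont2_cst.
    - move=> x y _ _; apply: le_trans (sqp_mid _ _).
      by rewrite le_eqVlt; apply/orP; left; apply/eqP; congr sqp; field.
  rewrite arcD; [|by apply: cont2M => //; exact: cont2_cst..].
  by rewrite !arcZ//; lra.
Qed.

(* A minimising sequence for the nested convex constraints is Cauchy by the
   parallelogram identity, hence is an admissible sequence. *)
Lemma dir_inf_le_relaxed gamma m a : bdm m ->
  (forall d, 0 < d -> exists2 e, near_energies gamma (fun x => 1 - m x) d e & e <= a + d) ->
  (dir_inf gamma m <= a%:E)%E.
Proof.
move=> bm H; set u := fun x => 1 - m x in H.
have bu : bdm u by apply: bdmB => //; exact: bdm_cst.
pose dl n : R := n.+1%:R^-1.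
have dl0 n : 0 < dl n by rewrite invr_gt0.
have dl_small e : 0 < e -> exists N, forall n, (N <= n)%N -> dl n <= e.
  move=> e0; have [N _ NP] := near_infty_natSinv_lt (PosNum e0).
  by exists N => n /NP /ltW.
pose D n := inf (near_energies gamma u (dl n)).
have lb n : has_lbound (near_energies gamma u (dl n)).
  by exists 0 => _ [U [U1 [U2 [_ _ _ ->]]]]; exact: energy_ge0.
have ne n : near_energies gamma u (dl n) !=set0.
  by have [e] := H _ (dl0 n); exists e.
have sub n k : (n <= k)%N ->
    near_energies gamma u (dl k) `<=` near_energies gamma u (dl n).
  move=> nk _ [U [U1 [U2 [CU fU aU ->]]]]; exists U, U1, U2.
  have kn : dl k <= dl n by rewrite lef_pV2 ?posrE// ler_nat.
  by split=> //; [apply: le_trans fU _|apply: le_trans aU _].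
have Dle n k e : (n <= k)%N -> near_energies gamma u (dl k) e -> D n <= e.
  by move=> nk /(sub _ _ nk) he; exact: ge_inf.
have Da n : D n <= a.
  apply/ler_addgt0Pr => e e0; have [N NP] := dl_small _ e0.
  have [b hb ba] := H _ (dl0 (maxn n N)).
  apply: le_trans (Dle _ _ _ (leq_maxl n N) hb) _; apply: le_trans ba _.
  by rewrite lerD2l NP// leq_maxr.
pose S := sup (range D).
have hS : has_ubound (range D) by exists a => _ [n _ <-].
have DS n : D n <= S by apply: ub_le_sup => //; exists n.
have SD e : 0 < e -> exists N, forall n, (N <= n)%N -> S - e <= D n.
  move=> e0; have [_ [N _ <-] SN] := sup_adherent e0 (conj (ex_intro _ (D 0%N) (ex_intro2 _ _ 0%N I erefl)) hS : has_sup (range D)).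
  exists N => n Nn; apply: le_trans (ltW SN) _.
  by apply: lb_le_inf => // e' he'; exact: (Dle _ n).
have /choice[U3 U3P] n : exists U : (R -> R -> R) * (R -> R -> R) * (R -> R -> R),
  [/\ C1w U.1.1 U.1.2 U.2, flat (fun x => (U.1.1 x 0 - u x) ^+ 2) <= dl n,
      arc (fun x y => sqp (gamma - U.1.1 x y)) <= dl n &
      energy U.1.2 U.2 <= D n + dl n].
  have [_ [U [U1 [U2 [CU fU aU ->]]]] lt] := inf_adherent (dl0 n) (conj (ne n) (lb n)).
  by exists (U, U1, U2); split => //; exact: ltW.
pose U n := (U3 n).1.1; pose U1 n := (U3 n).1.2; pose U2 n := (U3 n).2.
have CU n : C1w (U n) (U1 n) (U2 n) by case: (U3P n).
have fU n : flat (fun x => (U n x 0 - u x) ^+ 2) <= dl n by case: (U3P n).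
have aU n : arc (fun x y => sqp (gamma - U n x y)) <= dl n by case: (U3P n).
have eU n : energy (U1 n) (U2 n) <= D n + dl n by case: (U3P n).
have cU n := C1w_cont (CU n).
have cU1 n := C1w_cont1 (CU n).
have cU2 n := C1w_cont2 (CU n).
have mono N n : (N <= n)%N -> dl n <= dl N by move=> Nn; rewrite lef_pV2 ?posrE// ler_nat.
(* The midpoint of two members beyond N satisfies the constraints of level N, so its energy is at
   least D N; the parallelogram identity then bounds the energy of the difference. *)
have cau N n k : (N <= n)%N -> (N <= k)%N ->
    energy (fun x y => U1 n x y - U1 k x y) (fun x y => U2 n x y - U2 k x y) <=
    4 * (S - D N + dl N).
  move=> Nn Nk; rewrite parallelogram//.
  have hm : D N <= energy (fun x y => 2^-1 * U1 n x y + 2^-1 * U1 k x y)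
      (fun x y => 2^-1 * U2 n x y + 2^-1 * U2 k x y).
    apply: (@Dle N N _ (leqnn N)).
    apply: (near_energies_mid bu (CU n) (CU k)).
    - exact: (le_trans (fU n) (mono _ _ Nn)).
    - exact: (le_trans (fU k) (mono _ _ Nk)).
    - exact: (le_trans (aU n) (mono _ _ Nn)).
    - exact: (le_trans (aU k) (mono _ _ Nk)).
  have := eU n; have := eU k; have := DS n; have := DS k.
  have := mono _ _ Nn; have := mono _ _ Nk; lra.
have fl N n k : (N <= n)%N -> (N <= k)%N ->
    flat (fun x => (U n x 0 - U k x 0) ^+ 2) <= 4 * dl N.
  move=> Nn Nk.
  have b j : bdm (fun x => (U j x 0 - u x) ^+ 2).
    by apply: bdm_sqr; apply: bdmB => //; exact: bdm_flat.
  apply: (@le_trans _ _ (flat (fun x => 2 * (U n x 0 - u x) ^+ 2 + 2 * (U k x 0 - u x) ^+ 2))).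
    apply: le_flat.
    - by apply: bdm_sqr; apply: bdmB; exact: bdm_flat.
    - by apply: bdmD; exact: bdmZ.
    - by move=> x _; have := sqr_ge0 (U n x 0 - u x + (U k x 0 - u x)); nra.
  rewrite flatD; [|exact: bdmZ..]; rewrite !flatZ//.
  have := le_trans (fU n) (mono _ _ Nn); have := le_trans (fU k) (mono _ _ Nk); lra.
apply: (@le_trans _ _ S%:E); last first.
  by rewrite lee_fin; apply: ge_sup => [|_ [n _ <-]//]; exists (D 0%N); exists 0%N.
apply: ereal_inf_lbound; exists (fun n x y => 1 - U n x y).
have Cw n : C1w (fun x y => 1 - U n x y) (fun x y => - U1 n x y) (fun x y => - U2 n x y).
  have := C1wD (C1w_cst 1) (C1wZ (-1) (CU n)).
  rewrite (_ : (fun x y => _ + _) = (fun x y => 1 - U n x y)); last first.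
    by apply/funext => x; apply/funext => y; rewrite mulN1r.
  by move=> h; apply: (C1w_eq h) => x y; ring.
have pw1 n : pd1 (fun x y => 1 - U n x y) = fun x y => - U1 n x y by exact: C1w_pd1 (Cw n).
have pw2 n : pd2 (fun x y => 1 - U n x y) = fun x y => - U2 n x y by exact: C1w_pd2 (Cw n).
split; last first.
  rewrite (_ : (fun n => _) = (fun n => (energy (U1 n) (U2 n))%:E)); last first.
    apply/funext => n; rewrite pw1 pw2 /energy II_hd_int; last first.
      by have := cU1 n; have := cU2 n => *; cont2_tac.
    by congr hd_int; apply/funext => x; apply/funext => y; rewrite !sqrrN.
  apply: cvg_EFin_near => e e0.
  have [N1 N1P] := dl_small _ e0; have [N2 N2P] := SD _ e0.
  exists (maxn N1 N2) => n; rewrite geq_max => /andP[n1 n2].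
  have := eU n; have := N1P _ n1; have := N2P _ n2; have := DS n.
  have : D n <= energy (U1 n) (U2 n).
    by apply: (Dle n n) => //; exists (U n), (U1 n), (U2 n).
  by rewrite ler_norml => *; apply/andP; split; lra.
split; first by move=> n; exact: C1w_C1R2 (Cw n).
split.
  (* [poincare] leads to at most 8 dl + 5 * 4 (S - D + dl), that is 48 hundredths of e. *)
  move=> e e0; have e1 : 0 < e / 100 by rewrite divr_gt0.
  have [N1 N1P] := dl_small _ e1; have [N2 N2P] := SD _ e1.
  exists (maxn N1 N2) => n k nn kk.
  have C := C1wD (CU n) (C1wZ (-1) (CU k)).
  have e12 : energy (fun x y => U1 n x y + -1 * U1 k x y) (fun x y => U2 n x y + -1 * U2 k x y)
     = energy (fun x y => U1 n x y - U1 k x y) (fun x y => U2 n x y - U2 k x y).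
    by apply: eq_II => x y _; rewrite !mulN1r.
  have P := poincare C.
  have := cU n; have := cU k; have := cU1 n; have := cU1 k; have := cU2 n;
    have := cU2 k => *.
  rewrite -II_hd_int; last by rewrite !pw1 !pw2; cont2_tac.
  rewrite lte_fin !pw1 !pw2.
  apply: (@le_lt_trans _ _ (II (fun x y => (U n x y + -1 * U k x y) ^+ 2 +
     ((U1 n x y + -1 * U1 k x y) ^+ 2 + (U2 n x y + -1 * U2 k x y) ^+ 2)))).
    apply: le_II; [cont2_tac..|move=> x y _].
    by rewrite le_eqVlt; apply/orP; left; apply/eqP; ring.
  rewrite IID; [|cont2_tac..]; rewrite -/(energy _ _).
  have := cau _ _ _ nn kk; rewrite -e12 => h1.
  have := fl _ _ _ nn kk.
  rewrite (_ : flat (fun x => (U n x 0 - U k x 0) ^+ 2) =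
    flat (fun x => (U n x 0 + -1 * U k x 0) ^+ 2)); last first.
    by apply: eq_flat => x _; rewrite mulN1r.
  have := N1P _ (leq_maxl N1 N2); have := N2P _ (leq_maxr N1 N2); lra.
split.
  rewrite (_ : (fun n => _) = (fun n => (flat (fun x => (U n x 0 - u x) ^+ 2))%:E)).
    apply: cvg_EFin_near => e e0; have [N NP] := dl_small _ e0; exists N => n /NP nN.
    rewrite subr0 ger0_norm; first exact: le_trans (fU n) nN.
    by apply: flat_ge0 => x; exact: sqr_ge0.
  apply/funext => n; rewrite EFin_flat; last first.
    by apply: bdm_sqr; apply: bdmB => //; exact: bdm_flat.
  by apply: eq_integral => x _; congr EFin; rewrite /u; ring.
rewrite (_ : (fun n => _) = (fun n => (arc (fun x y => sqp (gamma - U n x y)))%:E)).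
  apply: cvg_EFin_near => e e0; have [N NP] := dl_small _ e0; exists N => n /NP nN.
  rewrite subr0 ger0_norm; first exact: le_trans (aU n) nN.
  by apply: Rintegral_ge0 => t _; exact: sqr_ge0.
apply/funext => n; rewrite arcE; last first.
  by apply: cont2_sqp; have := cU n => ?; cont2_tac.
apply: eq_integral => t _; congr EFin.
by rewrite /sqp /pospart; congr (Num.max _ _ ^+ 2); ring.
Qed.

End relaxation.

(** * Harmonic fields above the base and Green's identity *)

Section upper.
Context {R : realType}.
Implicit Types (f g p q K U : R -> R -> R) (a s : R).

(** The fields below depend on y through [pospart y]: their formulas are continuous on the whole
    plane, but f2 is the y-derivative only above the base, which is all that [divergence_halfdisk]
    asks for. *)
Record C1u f f1 f2 : Prop := MkC1u {
  C1u_cont : cont2 f;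
  C1u_cont1 : cont2 f1;
  C1u_cont2 : cont2 f2;
  C1u_d1 : forall x y : R, 0 < y -> is_derive x 1 (fun t => f t y) (f1 x y);
  C1u_d2 : forall x y : R, 0 < y -> is_derive y 1 (f x) (f2 x y) }.

Lemma C1w_C1u f f1 f2 : C1w f f1 f2 -> C1u f f1 f2.
Proof. by move=> [c c1 c2 d1 d2]; apply: (MkC1u c c1 c2) => x y _. Qed.

Lemma C1uD f f1 f2 g g1 g2 : C1u f f1 f2 -> C1u g g1 g2 ->
  C1u (fun x y => f x y + g x y) (fun x y => f1 x y + g1 x y)
    (fun x y => f2 x y + g2 x y).
Proof.
move=> [? ? ? df1 df2] [? ? ? dg1 dg2]; apply: MkC1u; try by cont2_tac.
  by move=> x y y0; exact: (is_deriveD (df1 x y y0) (dg1 x y y0)).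
by move=> x y y0; exact: (is_deriveD (df2 x y y0) (dg2 x y y0)).
Qed.

Lemma C1uM f f1 f2 g g1 g2 : C1u f f1 f2 -> C1u g g1 g2 ->
  C1u (fun x y => f x y * g x y) (fun x y => f1 x y * g x y + f x y * g1 x y)
    (fun x y => f2 x y * g x y + f x y * g2 x y).
Proof.
move=> [? ? ? df1 df2] [? ? ? dg1 dg2]; apply: MkC1u; try by cont2_tac.
  move=> x y y0; apply: is_derive_eq (is_deriveM (df1 x y y0) (dg1 x y y0)) _.
  by rewrite /GRing.scale /= addrC mulrC.
move=> x y y0; apply: is_derive_eq (is_deriveM (df2 x y y0) (dg2 x y y0)) _.
by rewrite /GRing.scale /= addrC mulrC.
Qed.

Lemma C1u_comp (phi phi' : R -> R) f f1 f2 :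
  (forall x y, is_derive (f x y) 1 phi (phi' (f x y))) ->
  cont2 (fun x y => phi' (f x y)) -> C1u f f1 f2 ->
  C1u (fun x y => phi (f x y)) (fun x y => phi' (f x y) * f1 x y)
    (fun x y => phi' (f x y) * f2 x y).
Proof.
move=> dphi cphi' [cf cf1 cf2 df1 df2]; apply: MkC1u.
- move=> z; apply: (@continuous_comp _ _ _ (fun z : R * R => f z.1 z.2) phi).
    exact: cf.
  exact: is_derive_continuous (dphi _ _).
- exact: cont2M.
- exact: cont2M.
- by move=> x y y0; exact: (is_derive1_comp (dphi _ _) (df1 x y y0)).
- by move=> x y y0; exact: (is_derive1_comp (dphi _ _) (df2 x y y0)).
Qed.

Lemma C1uZ (c : R) f f1 f2 : C1u f f1 f2 ->
  C1u (fun x y => c * f x y) (fun x y => c * f1 x y) (fun x y => c * f2 x y).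
Proof.
move=> h; apply: (@C1u_comp ( *%R c) (fun=> c)) => //; last exact: cont2_cst.
move=> x y; apply: is_derive_eq (is_deriveZ c (is_derive_id (f x y) 1)) _.
by rewrite /GRing.scale /= mulr1.
Qed.

Lemma C1u_eq f f1 f2 g1 g2 : C1u f f1 f2 -> (forall x y, f1 x y = g1 x y) ->
  (forall x y, f2 x y = g2 x y) -> C1u f g1 g2.
Proof.
move=> h e1 e2; have -> : g1 = f1 by apply/funext => x; apply/funext.
by have -> : g2 = f2 by apply/funext => x; apply/funext.
Qed.

Lemma C1u_pospart : C1u (fun _ y => pospart y) (fun _ _ => 0) (fun _ _ => 1).
Proof.
apply: MkC1u; try by cont2_tac.
- exact: cont2_comp continuous_pospart cont2_y.
- by move=> x y _; exact: is_derive_cst.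
- move=> _ y y0; apply: (@is_derive_quad _ _ _ _ y^-1) => z.
  rewrite (pospart_id (ltW y0)) mul1r; case: (pospartP z) => -[z0 ->].
    rewrite (_ : z - y - (z - y) = 0) ?normr0; last by ring.
    by rewrite mulr_ge0 ?sqr_ge0// invr_ge0 ltW.
  rewrite (_ : 0 - y - (z - y) = - z) ?ger0_norm; [|lra|ring].
  by rewrite ler_pdivlMl//; nra.
Qed.

(* A conservative, divergence-free field (p, q) with potential K. *)
Definition harm K p q := C1u K p q /\ exists r t, C1u p r t /\ C1u q t (fun x y => - r x y).

Lemma harm_lin (b c : R) K p q K' p' q' : harm K p q -> harm K' p' q' ->
  harm (fun x y => b * K x y + c * K' x y) (fun x y => b * p x y + c * p' x y)
    (fun x y => b * q x y + c * q' x y).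
Proof.
move=> [hK [r [t [hp hq]]]] [hK' [r' [t' [hp' hq']]]]; split.
  exact: (C1uD (C1uZ b hK) (C1uZ c hK')).
exists (fun x y => b * r x y + c * r' x y), (fun x y => b * t x y + c * t' x y).
split; first exact: (C1uD (C1uZ b hp) (C1uZ c hp')).
by apply: C1u_eq (C1uD (C1uZ b hq) (C1uZ c hq')) _ _ => x y; ring.
Qed.

(** The divergence of f (p, q) is grad f . (p, q) since (p, q) is divergence-free; the outer normal
    is (x, y) on the arc and (0, -1) on the base. *)
Lemma green f f1 f2 K p q : harm K p q -> C1u f f1 f2 ->
  II (fun x y => f1 x y * p x y + f2 x y * q x y) =
  arc (fun x y => f x y * (p x y * x + q x y * y)) - flat (fun x => f x 0 * q x 0).
Proof.
move=> [hK [r [t [hp hq]]]] hf.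
have hF := C1uM hf hp; have hG := C1uM hf hq.
have := divergence_halfdisk (C1u_cont hF) (C1u_cont hG) (C1u_cont1 hF)
  (C1u_cont2 hG) (C1u_d1 hF) (C1u_d2 hG).
rewrite (_ : arc _ = arc (fun x y => f x y * (p x y * x + q x y * y))); last first.
  by apply: eq_arc => x y _; ring.
by move=> <-; apply: eq_II => x y _; ring.
Qed.

(* The logarithmic source at (0, -a), frozen below y = 0. *)
Definition den a x y := x ^+ 2 + (pospart y + a) ^+ 2.
Definition src a x y := 2^-1 * ln (den a x y).
Definition srcx a x y := x / den a x y.
Definition srcy a x y := (pospart y + a) / den a x y.

Lemma den_gt0 a x y : 0 < a -> 0 < den a x y.
Proof.
move=> a0; have p0 := pospart_ge0 y; rewrite /den.
by rewrite ltr_wpDl ?sqr_ge0// exprn_gt0// ltr_wpDl.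
Qed.

Lemma C1u_den a : C1u (den a) (fun x y => 2 * x) (fun x y => 2 * (pospart y + a)).
Proof.
have hp := C1uD C1u_pospart (C1w_C1u (C1w_cst a)).
apply: C1u_eq (C1uD (C1uM (C1w_C1u C1w_x) (C1w_C1u C1w_x)) (C1uM hp hp)) _ _ => x y.
  by ring.
by ring.
Qed.

Lemma harm_src a : 0 < a -> harm (src a) (srcx a) (srcy a).
Proof.
move=> a0; have hd := C1u_den a; have d0 x y := @den_gt0 a x y a0.
have dn0 x y : den a x y != 0 by rewrite gt_eqF.
have cd := C1u_cont hd.
have cV : cont2 (fun x y => (den a x y)^-1) by exact: cont2V.
have hV : C1u (fun x y => (den a x y)^-1) (fun x y => - (den a x y) ^- 2 * (2 * x))
    (fun x y => - (den a x y) ^- 2 * (2 * (pospart y + a))).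
  apply: (@C1u_comp (fun x => x^-1) (fun x => - x ^- 2)) => //.
  - move=> x y; apply: is_derive_eq (@is_deriveV _ id (den a x y) 1 1 (dn0 x y) (is_derive_id _ _)) _.
    by rewrite /GRing.scale /= mulr1.
  - rewrite (_ : (fun x y => _) = (fun x y => - (den a x y)^-1 ^+ 2)); first by cont2_tac.
    by apply/funext => x; apply/funext => y; rewrite exprVn.
have hp := C1uD C1u_pospart (C1w_C1u (C1w_cst a)).
split.
  have := C1uZ 2^-1 (@C1u_comp (@ln R) (fun x => x^-1) _ _ _
    (fun x y => is_derive1_ln (d0 x y)) cV hd).
  by move=> h; apply: C1u_eq h _ _ => x y; rewrite /srcx /srcy; field.
exists (fun x y => ((pospart y + a) ^+ 2 - x ^+ 2) * (den a x y) ^- 2),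
  (fun x y => - 2 * x * (pospart y + a) * (den a x y) ^- 2); split.
- apply: C1u_eq (C1uM (C1w_C1u C1w_x) hV) _ _ => x y; have := dn0 x y;
    rewrite /den => ?; field => //.
- apply: C1u_eq (C1uM hp hV) _ _ => x y; have := dn0 x y; rewrite /den => ?; field => //.
Qed.

End upper.

(** * The dipole field: flux, potential and energy *)

Section dipole.
Context {R : realType}.
Implicit Types (a s x y : R).

(* The weights 2 and -1 make the flux through y = 0 decay like s^3 / x^4. *)
Definition dip s x y := 2 * src s x y + (- 1) * src (2 * s) x y.
Definition dipx s x y := 2 * srcx s x y + (- 1) * srcx (2 * s) x y.
Definition dipy s x y := 2 * srcy s x y + (- 1) * srcy (2 * s) x y.
Definition diparc s x y := dipx s x y * x + dipy s x y * y.

Lemma harm_dip s : 0 < s -> harm (dip s) (dipx s) (dipy s).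
Proof. by move=> s0; apply: harm_lin; apply: harm_src => //; rewrite mulr_gt0. Qed.

Lemma ln_le_subr1 x : 0 < x -> ln x <= x - 1.
Proof. by move=> x0; have := @le_ln1Dx R (x - 1); rewrite [1 + _]addrC subrK; apply; lra. Qed.

Lemma src_arc a x y : 0 < a -> x ^+ 2 + y ^+ 2 = 1 -> 0 <= y ->
  0 <= src a x y <= a + a ^+ 2 / 2.
Proof.
move=> a0 xy y0; rewrite /src /den (pospart_id y0).
have y1 : y <= 1 by nra.
have -> : x ^+ 2 + (y + a) ^+ 2 = 1 + (2 * a * y + a ^+ 2) by lra.
have h : 0 <= 2 * a * y + a ^+ 2 by nra.
rewrite mulr_ge0 ?ln_ge0//=; last by rewrite lerDl.
have := @ln_le_subr1 (1 + (2 * a * y + a ^+ 2)).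
have -> : 0 < 1 + (2 * a * y + a ^+ 2) by rewrite ltr_pwDl.
by move=> /(_ isT); nra.
Qed.

Lemma src_flux_arc a x y : 0 < a -> x ^+ 2 + y ^+ 2 = 1 -> 0 <= y ->
  1 - a - a ^+ 2 <= srcx a x y * x + srcy a x y * y <= 1.
Proof.
move=> a0 xy y0; rewrite /srcx /srcy.
have d0 := @den_gt0 R a x y a0.
have -> : x / den a x y * x + (pospart y + a) / den a x y * y = (1 + a * y) / den a x y.
  by rewrite -xy (pospart_id y0); field; rewrite gt_eqF.
have y1 : y <= 1 by nra.
have e : den a x y = 1 + 2 * a * y + a ^+ 2 by rewrite /den (pospart_id y0); lra.
rewrite ler_pdivlMr// ler_pdivrMr// e; apply/andP; split; last by nra.
have ay : 0 <= a * y <= a by nra.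
have : 0 <= a * a by nra.
move: ay => /andP[ay ay']; have := mulr_ge0 (ltW a0) ay.
have : 0 <= (a * a) * (a * y) by rewrite !mulr_ge0 ?(ltW a0).
have : 0 <= a * (a * a) by rewrite !mulr_ge0 ?(ltW a0).
have : 0 <= (a * a) * (a * a) by rewrite !mulr_ge0 ?(ltW a0).
nra.
Qed.

Lemma diparc_bounds s x y : 0 < s -> s <= 1 / 8 -> x ^+ 2 + y ^+ 2 = 1 -> 0 <= y ->
  1 - 4 * s <= diparc s x y <= 1 + 4 * s.
Proof.
move=> s0 s8 xy y0; have /andP[A1 A2] := src_flux_arc s0 xy y0.
have s20 : 0 < 2 * s by rewrite mulr_gt0.
have /andP[B1 B2] := src_flux_arc s20 xy y0.
have -> : diparc s x y = 2 * (srcx s x y * x + srcy s x y * y) -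
  (srcx (2 * s) x y * x + srcy (2 * s) x y * y) by rewrite /diparc /dipx /dipy; ring.
by apply/andP; split; nra.
Qed.

Lemma dip_arc_bounds s x y : 0 < s -> s <= 1 / 8 -> x ^+ 2 + y ^+ 2 = 1 -> 0 <= y ->
  `|dip s x y| <= 4 * s.
Proof.
move=> s0 s8 xy y0; have /andP[A1 A2] := src_arc s0 xy y0.
have s20 : 0 < 2 * s by rewrite mulr_gt0.
have /andP[B1 B2] := src_arc s20 xy y0.
rewrite /dip ler_norml; apply/andP; split; nra.
Qed.

Lemma cont2_diparc s : 0 < s -> cont2 (diparc s).
Proof.
move=> s0; have [hK [r [t [hp hq]]]] := harm_dip s0.
by rewrite /diparc; apply: cont2D; apply: cont2M;
  [exact: C1u_cont hp|exact: cont2_x|exact: C1u_cont hq|exact: cont2_y].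
Qed.

Lemma dipy_flat s x : 0 < s ->
  dipy s x 0 = 6 * s ^+ 3 / ((x ^+ 2 + s ^+ 2) * (x ^+ 2 + 4 * s ^+ 2)).
Proof.
move=> s0; rewrite /dipy /srcy /den pospart_id// !add0r.
have d1 : x ^+ 2 + s ^+ 2 != 0 by rewrite gt_eqF// ltr_wpDl ?sqr_ge0// exprn_gt0.
have d2 : x ^+ 2 + (2 * s) ^+ 2 != 0.
  by rewrite gt_eqF// ltr_wpDl ?sqr_ge0// exprn_gt0// mulr_gt0.
have d3 : x ^+ 2 + 4 * s ^+ 2 != 0 by rewrite (_ : 4 * s ^+ 2 = (2 * s) ^+ 2)//; ring.
by field; rewrite ?d1 ?d2 ?d3.
Qed.

Lemma dipy_ge0 s x : 0 < s -> 0 <= dipy s x 0.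
Proof.
move=> s0; rewrite dipy_flat//; apply: divr_ge0.
  by rewrite mulr_ge0// exprn_ge0// ltW.
apply: mulr_ge0; first by apply: addr_ge0; exact: sqr_ge0.
by apply: addr_ge0; [|apply: mulr_ge0 => //]; exact: sqr_ge0.
Qed.

(** Follows from 2 s |x| <= x^2 + 4 s^2. A factor |x| is traded for s, so that a trace growing
    linearly away from 0 costs only O(s) in the pairing. *)
Lemma absx_dipy s x : 0 < s -> `|x| * dipy s x 0 <= 3 * s * srcy s x 0.
Proof.
move=> s0; rewrite dipy_flat// /srcy /den pospart_id// add0r.
have p1 : 0 < x ^+ 2 + s ^+ 2 by rewrite ltr_wpDl ?sqr_ge0// exprn_gt0.
have p2 : 0 < x ^+ 2 + 4 * s ^+ 2 by rewrite ltr_wpDl ?sqr_ge0// mulr_gt0// exprn_gt0.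
rewrite -subr_ge0 [X in 0 <= X](_ : _ = 3 * s ^+ 2 * (x ^+ 2 + 4 * s ^+ 2 - 2 * s * `|x|) /
  ((x ^+ 2 + s ^+ 2) * (x ^+ 2 + 4 * s ^+ 2))); last by field; rewrite !gt_eqF.
apply: divr_ge0; last by rewrite mulr_ge0// ltW.
apply: mulr_ge0; first by apply: mulr_ge0 => //; exact: sqr_ge0.
have := real_normK (num_real x); have := sqr_ge0 (`|x| - s); have := sqr_ge0 s; nra.
Qed.

(** Green's identity for the constant 1: the base flux equals the arc flux, whose density in the
    angle is at most 1. *)
Lemma flat_srcy s : 0 < s -> flat (fun x => srcy s x 0) <= pi.
Proof.
move=> s0; have h := harm_src s0.
have := green h (C1w_C1u (C1w_cst 1)).
rewrite (_ : II _ = 0); last first.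
  rewrite -[RHS](mul0r (II (fun _ _ => 0))) -IIZ; last exact: cont2_cst.
  by apply: eq_II => x y _; ring.
move/esym/eqP; rewrite subr_eq0 => /eqP e.
rewrite (_ : flat _ = flat (fun x => 1 * srcy s x 0)); last first.
  by apply: eq_flat => x _; rewrite mul1r.
have [_ [r [t [hp hq]]]] := h; have cp := C1u_cont hp; have cq := C1u_cont hq.
rewrite -e -[leRHS]mul1r -arc_cst; apply: le_arc; [cont2_tac..|].
by move=> x y xy y0; rewrite mul1r; have /andP[] := src_flux_arc s0 xy y0.
Qed.

Lemma dip_mass s : 0 < s -> s <= 1 / 8 ->
  flat (fun x => dipy s x 0) = arc (diparc s) /\
  pi * (1 - 4 * s) <= arc (diparc s) <= pi * (1 + 4 * s).
Proof.
move=> s0 s8; have h := harm_dip s0; have ca := cont2_diparc s0.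
split; last first.
  rewrite ![pi * _]mulrC -!arc_cst; apply/andP; split; apply: le_arc; try exact: cont2_cst;
  by [|move=> x y xy y0; have /andP[] := diparc_bounds s0 s8 xy y0].
have := green h (C1w_C1u (C1w_cst 1)).
rewrite (_ : II _ = 0); last first.
  rewrite -[RHS](mul0r (II (fun _ _ => 0))) -IIZ; last exact: cont2_cst.
  by apply: eq_II => x y _; ring.
move/esym/eqP; rewrite subr_eq0 => /eqP e.
transitivity (flat (fun x => 1 * dipy s x 0)).
  by apply: eq_flat => x _; rewrite mul1r.
by rewrite -e; apply: eq_arc => x y _; rewrite mul1r.
Qed.

(** On the base the potential is ln (x^2 + s^2) - ln (x^2 + 4 s^2) / 2, smallest at x = 0, where
    equality holds. *)
Lemma dip_flat_ge s x : 0 < s -> ln s - ln 2 <= dip s x 0.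
Proof.
move=> s0; rewrite /dip /src /den pospart_id// !add0r.
have p1 : 0 < x ^+ 2 + s ^+ 2 by rewrite ltr_wpDl ?sqr_ge0// exprn_gt0.
have p2 : 0 < x ^+ 2 + (2 * s) ^+ 2.
  by rewrite ltr_wpDl ?sqr_ge0// exprn_gt0// mulr_gt0.
have : ln ((s / 2) ^+ 2 * (x ^+ 2 + (2 * s) ^+ 2)) <= ln ((x ^+ 2 + s ^+ 2) ^+ 2).
  rewrite ler_ln ?posrE ?exprn_gt0//; last by rewrite mulr_gt0// exprn_gt0// divr_gt0.
  have := sqr_ge0 x; have := sqr_ge0 (x ^+ 2); have := sqr_ge0 (s * x); nra.
have ln2 (z : R) : 0 < z -> ln (z ^+ 2) = 2 * ln z by move=> z0; rewrite lnXn// mulr_natl.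
rewrite lnM ?posrE// ?exprn_gt0 ?divr_gt0// !ln2 ?divr_gt0// ln_div ?posrE//.
by move: (ln s) (@ln R 2) (ln (x ^+ 2 + (2 * s) ^+ 2)) (ln (x ^+ 2 + s ^+ 2)) => *; lra.
Qed.

(** Green's identity for the potential itself. The arc term is at most pi; the base term is
    controlled by the minimum of the potential there times the total flux. The flux error 4 s meets
    only - ln s, and s * (- ln s) <= 1 puts it into the constant 7. *)
Lemma dip_energy s : 0 < s -> s <= 1 / 8 ->
  energy (dipx s) (dipy s) <= pi * (- ln s + 7).
Proof.
move=> s0 s8; have h := harm_dip s0; have [hK [r [t [hp hq]]]] := h.
have cK := C1u_cont hK; have cp := C1u_cont hp; have cq := C1u_cont hq.
have ca := cont2_diparc s0.
have := green h hK.
have [M /andP[Mlo Mhi]] := dip_mass s0 s8.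
have p0 := pi_gt0 R.
rewrite (_ : II _ = energy (dipx s) (dipy s)); last by apply: eq_II => x y _; rewrite !expr2.
have A : arc (fun x y => dip s x y * (dipx s x y * x + dipy s x y * y)) <= 1 * pi.
  rewrite -arc_cst; apply: le_arc; [|exact: cont2_cst|move=> x y xy y0].
    by cont2_tac.
  have := dip_arc_bounds s0 s8 xy y0; have := diparc_bounds s0 s8 xy y0.
  rewrite -/(diparc s x y) ler_norml => /andP[? ?] /andP[? ?].
  by nra.
have s1 : s < 1 by lra.
have lns : ln s <= 0 by rewrite ln_le0// ltW.
have ln2 : 0 <= ln (2 : R) <= 1.
  rewrite ln_ge0 ?ler1n//=; have := @ln_le_subr1 2 (ltr0Sn R 1).
  by move: (ln (2 : R)) => l; lra.
have B : (ln s - ln 2) * flat (fun x => dipy s x 0) <= flat (fun x => dip s x 0 * dipy s x 0).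
  have bq : bdm (fun x => dipy s x 0) by exact: bdm_flat.
  rewrite -flatZ//; apply: le_flat; first exact: bdmZ.
    by apply: bdmM => //; exact: bdm_flat.
  by move=> x _; apply: ler_wpM2r; [exact: dipy_ge0|exact: dip_flat_ge].
have sl : s * - ln s <= 1.
  rewrite -lnV ?posrE// -ler_pdivlMl//.
  by have := @ln_le_subr1 s^-1; rewrite invr_gt0 => /(_ s0); lra.
move=> ->; rewrite M in B.
have : (ln 2 - ln s) * arc (diparc s) <= (ln 2 - ln s) * (pi * (1 + 4 * s)).
  by apply: ler_wpM2l => //; lra.
have : (ln 2 - ln s) * (1 + 4 * s) <= - ln s + 6.
  have : s * ln 2 <= 1 / 8 * 1 by case/andP: ln2 => ? ?; nra.
  lra.
move=> H1 H2.
have := ler_wpM2l (ltW p0) H1; move: A B H2; clear.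
by move: (ln s) (@ln R 2) (pi) => *; lra.
Qed.

End dipole.

(** * Lower bound for the Dirichlet infimum *)

Section dirichlet_lower_bound.
Context {R : realType}.
Implicit Types (gamma b c s e : R) (u m : R -> R).

Lemma energy_pairing f1 f2 p q c : cont2 f1 -> cont2 f2 -> cont2 p -> cont2 q ->
  2 * c * II (fun x y => f1 x y * p x y + f2 x y * q x y) - c ^+ 2 * energy p q
  <= energy f1 f2 :> R.
Proof.
move=> cf1 cf2 cp cq; rewrite /energy -mulNr -!IIZ; [|cont2_tac..].
rewrite -IID; [|cont2_tac..].
apply: le_II; [cont2_tac..|move=> x y _].
have := sqr_ge0 (f1 x y - c * p x y); have := sqr_ge0 (f2 x y - c * q x y); nra.
Qed.

(* Pairs the gradient with [c] times the dipole field and completes the square. *)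
Lemma dir_inf_lower gamma m s c : 0 < s -> s <= 1 / 8 -> 0 < gamma -> 0 <= c -> bdm m ->
  ((2 * c * (gamma * (pi * (1 - 4 * s)) - flat (fun x => (1 - m x) * dipy s x 0)) -
   c ^+ 2 * (pi * (- ln s + 7)))%:E <= dir_inf gamma m)%E.
Proof.
move=> s0 s8 g0 c0 bm; apply: le_ereal_inf_tmp => a /(dir_valsP bm) [U [U1 [U2 [[CU _ fU aU] [b [-> Ub]]]]]]; rewrite lee_fin.
set u := fun x => 1 - m x in fU *.
have bu : bdm u by apply: bdmB => //; exact: bdm_cst.
have h := harm_dip s0; have [hK [r [t [hp hq]]]] := h.
have cp := C1u_cont hp; have cq := C1u_cont hq; have ca := cont2_diparc s0.
have bq : bdm (fun x => dipy s x 0) by exact: bdm_flat.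
have [J J0 qJ] := cont2_bounded cq.
have [_ /andP[Mlo Mhi]] := dip_mass s0 s8.
have p0 := pi_ge0 R; have De := dip_energy s0 s8.
suff S e : 0 < e -> 2 * c * (gamma * (pi * (1 - 4 * s)) -
    flat (fun x => u x * dipy s x 0)) - c ^+ 2 * (pi * (- ln s + 7)) <=
    b + (1 + 2 * c * (pi + 4)) * e.
  apply/ler_addgt0Pr => e e0; pose k : R := 1 + 2 * c * (pi + 4).
  have k0 : 0 < k by rewrite /k ltr_pwDl// !mulr_ge0// addr_ge0.
  have ek : 0 < e / k by rewrite divr_gt0.
  by apply: le_trans (S _ ek) _; rewrite -/k mulrC divfK// gt_eqF.
move=> e0.
have J1 : 0 < J ^+ 2 + 1 by rewrite ltr_wpDl ?sqr_ge0.
(* J bounds the base flux; the trace error will be multiplied by J^2 / e in Young's inequality and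
   must still be at most e. *)
have eJ : 0 < e ^+ 2 / (J ^+ 2 + 1) by rewrite divr_gt0// exprn_gt0.
have [N1 N1P] := Ub _ e0; have [N2 N2P] := fU _ eJ.
have [N3 N3P] := aU _ (exprn_gt0 2 e0).
pose n := maxn N1 (maxn N2 N3).
have n1 : (N1 <= n)%N by rewrite leq_maxl.
have n2 : (N2 <= n)%N by rewrite (leq_trans (leq_maxl N2 N3))// leq_maxr.
have n3 : (N3 <= n)%N by rewrite (leq_trans (leq_maxr N2 N3))// leq_maxr.
have H1 := N1P _ n1; have H2 := N2P _ n2; have H3 := N3P _ n3.
have CUn := CU n; have cU := C1w_cont CUn.
have cU1 := C1w_cont1 CUn; have cU2 := C1w_cont2 CUn.
have EP := energy_pairing c cU1 cU2 cp cq.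
have G := green h (C1w_C1u CUn).
(* U >= gamma holds on the arc only in the limit. The defect is the positive part of gamma - U,
   weighted by at most 2; Young's inequality bounds it by e + [sqp] / e, and the arc integral of
   [sqp] is at most e^2. *)
have arcG : gamma * arc (diparc s) - e * (pi + 1) <=
    arc (fun x y => U n x y * (dipx s x y * x + dipy s x y * y)).
  have cs : cont2 (fun x y => sqp (gamma - U n x y)) by apply: cont2_sqp; cont2_tac.
  apply: (@le_trans _ _ (arc (fun x y => gamma * diparc s x y +
      (- e + - e^-1 * sqp (gamma - U n x y))))).
    rewrite (@arcD _ (fun x y => gamma * diparc s x y)); [|by cont2_tac..].
    rewrite (@arcD _ (fun _ _ => - e)); [|by cont2_tac..].
    rewrite !arcZ// arc_cst lerD2l mulrDr mulr1 opprD mulNr lerD2l.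
    rewrite mulNr lerN2 ler_pdivrMl//.
  apply: le_arc; [by cont2_tac|by cont2_tac|move=> x y xy y0].
  rewrite -/(diparc s x y).
  have /andP[d1 d2] := diparc_bounds s0 s8 xy y0.
  set v := U n x y; set al := diparc s x y in d1 d2 *.
  have pv : gamma - v <= pospart (gamma - v).
    by case: (pospartP (gamma - v)) => -[? ->].
  have pv0 := pospart_ge0 (gamma - v).
  have yg : 2 * pospart (gamma - v) <= e + e^-1 * sqp (gamma - v).
    rewrite -subr_ge0 [X in 0 <= X](_ : _ = e^-1 * (e - pospart (gamma - v)) ^+ 2).
      by rewrite mulr_ge0 ?sqr_ge0// invr_ge0 ltW.
    by rewrite /sqp; field; rewrite gt_eqF.
  have : (gamma - v) * al <= pospart (gamma - v) * 2.
    apply: (@le_trans _ _ (pospart (gamma - v) * al)).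
      by apply: ler_wpM2r => //; lra.
    by apply: ler_wpM2l => //; lra.
  by rewrite mulNr => pa; move: yg pa; move: (e^-1 * sqp _) => *; lra.
have flatG : flat (fun x => U n x 0 * dipy s x 0) <=
    flat (fun x => u x * dipy s x 0) + 3 * e.
  have bU : bdm (fun x => (U n x 0 - u x) ^+ 2).
    by apply: bdm_sqr; apply: bdmB => //; exact: bdm_flat.
  apply: (@le_trans _ _ (flat (fun x => u x * dipy s x 0 +
      (e + e^-1 * J ^+ 2 * (U n x 0 - u x) ^+ 2)))).
    apply: le_flat.
    - by apply: bdmM => //; exact: bdm_flat.
    - by apply: bdmD; [exact: bdmM|apply: bdmD; [exact: bdm_cst|exact: bdmZ]].
    - move=> x /andP[x1 x2]; rewrite -lerBlDl -mulrBl.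
      have q0 := dipy_ge0 x s0.
      have : `|dipy s x 0| <= J by apply: qJ; nra.
      rewrite (ger0_norm q0); set v := U n x 0 - u x => qJ'.
      apply: (@le_trans _ _ (`|v| * J)).
        by apply: (le_trans (ler_wpM2r q0 (ler_norm v))); exact: ler_wpM2l.
      have : 2 * (`|v| * J) <= e + e^-1 * J ^+ 2 * v ^+ 2.
        rewrite -(real_normK (num_real v)) -subr_ge0
          [X in 0 <= X](_ : _ = e^-1 * (e - `|v| * J) ^+ 2).
          by rewrite mulr_ge0 ?sqr_ge0// invr_ge0 ltW.
        by field; rewrite gt_eqF.
      by have := mulr_ge0 (normr_ge0 v) J0; lra.
  rewrite flatD; [|exact: bdmM|by apply: bdmD; [exact: bdm_cst|exact: bdmZ]].
  rewrite flatD; [|exact: bdm_cst|exact: bdmZ]; rewrite flatZ// flat_cst lerD2l.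
  suff : e^-1 * J ^+ 2 * flat (fun x => (U n x 0 - u x) ^+ 2) <= e by lra.
  rewrite -mulrA ler_pdivrMl//; apply: (@le_trans _ _ (J ^+ 2 * (e ^+ 2 / (J ^+ 2 + 1)))).
    by apply: ler_wpM2l => //; exact: sqr_ge0.
  rewrite mulrCA -expr2 ler_piMr ?sqr_ge0// ler_pdivrMr// mul1r lerDl//.
move: H1; rewrite ler_norml => /andP[_ H1].
have gM := ler_wpM2l (ltW g0) Mlo.
have cG := ler_wpM2l (c0) (lerB (le_trans (lerB gM (lexx (e * (pi + 1)))) arcG) flatG).
have cD := ler_wpM2l (sqr_ge0 c) De.
rewrite G in EP.
set A := arc (fun x y => U n x y * _) in EP cG.
set F := flat (fun x => U n x 0 * dipy s x 0) in EP cG.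
set F0 := flat (fun x => u x * dipy s x 0) in cG *.
set E := energy (U1 n) (U2 n) in EP H1; set D := energy _ _ in EP cD.
move: EP H1 cG cD; clearbody A F F0 E D; clear.
by move: (ln s) (pi) => *; lra.
Qed.

End dirichlet_lower_bound.

(** * One-dimensional Sobolev functions and growth of 1 - m *)

Section W12.
Context {R : realType}.
Local Notation mu := (@lebesgue_measure R).
Implicit Types (m g : R -> R) (p q x y K M : R).

Lemma W12_increment m g p q : W12_1d m g -> -1 <= p -> p <= q -> q <= 1 ->
  m q - m p = \int[mu]_(x in `]p, q]) g x.
Proof.
move=> [_ [ig [_ mE]]] p1 pq q1; rewrite (mE q) ?(mE p); last 2 first.
- by rewrite p1 (le_trans pq).
- by rewrite (le_trans p1 pq).
rewrite opprD addrACA subrr add0r; apply: Rintegral_itvB; rewrite ?bnd_simp//.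
apply: integrableS ig => //; first exact: measurable_itv.
by apply: subset_itvl; rewrite bnd_simp.
Qed.

Lemma W12_continuous m g : W12_1d m g -> {within `[-1, 1], continuous m}.
Proof.
move=> [_ [ig [_ mE]]].
have : {within `[-1, 1], continuous (fun x => m (-1) + \int[mu]_(t in `[-1, x]) g t)}.
  move=> x; apply: cvgD; first exact: cvg_cst.
  have := @parameterized_integral_continuous R (-1) 1 g _ ig.
  by move=> /(_ ltac:(lra)); exact.
apply: subspace_eq_continuous => x /set_mem /=; rewrite in_itv /= => x1.
exact: esym (mE x x1).
Qed.

Lemma W12_bdm m g : W12_1d m g -> bdm m.
Proof.
move=> h; have cm := W12_continuous h; split.
  have mc : measurable_fun (@cI11 R) m.
    by apply: subspace_continuous_measurable_fun => //; exact: measurable_itv.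
  by apply: measurable_funS mc; [exact: measurable_itv|exact: subset_itv_oo_cc].
have := continuous_compact cm (@segment_compact R (-1) 1).
move=> /compact_bounded[M [_ MP]]; exists (`|M| + 1) => x xI.
apply: (MP (`|M| + 1)).
  by rewrite (le_lt_trans (ler_norm M))// ltrDl.
by exists x => //; move: xI; rewrite /oI11 /= !in_itv /= => /andP[/ltW -> /ltW ->].
Qed.

Lemma ratio_ge0 m g x : (0 <= ratio m g x)%E.
Proof.
rewrite /ratio; case: ifP => [mx|_]; last by case: ifP.
rewrite lee_fin divr_ge0 ?sqr_ge0// subr_ge0 -(real_normK (num_real (m x))).
by rewrite exprn_ile1// ltW.
Qed.

Lemma measurable_invr : measurable_fun setT (fun x : R => x^-1).
Proof.
have o : open [set x : R | x != 0] by exact: open_neq.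
rewrite (_ : setT = [set x : R | x != 0] `|` [set 0]); last first.
  by apply/esym/seteqP; split => // x _ /=; case: (eqVneq x 0); [right|left].
apply/measurable_funU => //; first exact: open_measurable.
split; last exact: measurable_fun_set1.
apply: open_continuous_measurable_fun => // x /set_mem /= x0; exact: inv_continuous.
Qed.

Lemma measurable_ratio m g : W12_1d m g -> measurable_fun (@oI11 R) (ratio m g).
Proof.
move=> h; have [mm _] := W12_bdm h; have [mg _] := h.
have sub : @oI11 R `<=` @cI11 R by exact: subset_itv_oo_cc.
have {}mg : measurable_fun (@oI11 R) g by apply: measurable_funS mg => //; exact: measurable_itv.
have mo := @measurable_oI11 R.
have mlt : measurable_fun (@oI11 R) (fun x => `|m x| < 1).
  by apply: measurable_fun_ltr => //; exact: measurableT_comp.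
rewrite /ratio; apply: measurable_fun_if => //.
- apply/measurable_EFinP; apply: (measurable_funS mo (@subIsetl _ _ _)).
  apply: measurable_funM; first exact: measurable_funM.
  apply: (measurableT_comp measurable_invr).
  by apply: measurable_funB => //; exact: measurable_funM.
- apply: (measurable_funS mo (@subIsetl _ _ _)).
  apply: measurable_fun_if => //.
  exact: (measurable_fun_eqr mg (measurable_cst _)).
Qed.

(** Young's inequality with weight 1 - m^2 = (1 - m) (1 + m) <= 2 M where |m| < 1; elsewhere g
    vanishes or the right side is +oo. *)
Lemma abs_le_ratio m g x (a M : R) : 0 < a -> `|1 - m x| <= M ->
  (`|g x|%:E <= (a / 2)%:E * ratio m g x + (M / a)%:E)%E.
Proof.
move=> a0 uM; have M0 : 0 <= M := le_trans (normr_ge0 _) uM.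
have Ma : 0 <= M / a by rewrite divr_ge0// ltW.
rewrite /ratio; case: ifP => [mx|_]; last first.
  case: eqP => [-> |_]; first by rewrite normr0 mule0 add0e lee_fin.
  by rewrite gt0_muley ?lte_fin ?divr_gt0// addye ?leey.
rewrite -EFinM -EFinD lee_fin.
move: mx; rewrite ltr_norml => /andP[m1 m2].
rewrite ger0_norm in uM; last by lra.
have d0 : 0 < 1 - m x ^+ 2 by nra.
have dM : 1 - m x ^+ 2 <= 2 * M by nra.
apply: (@le_trans _ _ (a / 2 * (g x ^+ 2 / (1 - m x ^+ 2)) + (1 - m x ^+ 2) / (2 * a))).
  rewrite -(real_normK (num_real (g x))) -subr_ge0
   [X in 0 <= X](_ : _ = (a * `|g x| - (1 - m x ^+ 2)) ^+ 2 / (2 * a * (1 - m x ^+ 2))).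
    by rewrite divr_ge0 ?sqr_ge0// mulr_ge0// ?mulr_ge0// ltW.
  by field; rewrite !gt_eqF.
rewrite lerD2l ler_pdivrMr ?mulr_gt0// [leRHS](_ : _ = 2 * M)//.
by field; rewrite gt_eqF.
Qed.

(* AM-GM bounds |m'| by the exchange density plus the size of 1 - m itself. *)
Lemma W12_osc m g p q K M : W12_1d m g ->
  (\int[mu]_(x in @oI11 R) ratio m g x <= K%:E)%E ->
  -1 <= p -> p < q -> q <= 1 -> (forall x, p <= x <= q -> `|1 - m x| <= M) ->
  `|m q - m p| <= (q - p) * K + M / 2.
Proof.
move=> h hK p1 pq q1 uM.
have [mg [ig _]] := h; have mr := measurable_ratio h.
have M0 : 0 <= M by apply: le_trans (uM p _); rewrite // lexx ltW.
rewrite (W12_increment h p1 (ltW pq) q1).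
have sub : `]p, q[%classic `<=` @oI11 R.
  by move=> x; rewrite /oI11 /= !in_itv /= => /andP[px xq]; apply/andP; split; lra.
have sub' : `]p, q]%classic `<=` @cI11 R.
  by move=> x; rewrite /cI11 /= !in_itv /= => /andP[px xq]; apply/andP; split; lra.
have ig' : mu.-integrable `]p, q] (EFin \o g).
  by apply: integrableS ig => //; exact: measurable_itv.
apply: le_trans (le_normr_Rintegral _ ig') _ => //.
have mag : measurable_fun `]p, q[%classic (fun x => `|g x|%:E).
  apply/measurable_EFinP/measurableT_comp => //.
  apply: measurable_funS mg => //; first exact: measurable_itv.
  by apply: subset_trans sub _; exact: subset_itv_oo_cc.
have mr' : measurable_fun `]p, q[%classic (ratio m g).
  by apply: measurable_funS mr => //; exact: measurable_oI11.
(* The Young parameter 2 (q - p) makes the constant term integrate to M / 2, small enough to be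
   absorbed in [W12_growth]. *)
have a0 : 0 < 2 * (q - p) by lra.
have Ma : 0 <= M / (2 * (q - p)) by rewrite divr_ge0// ltW.
rewrite -lee_fin /Rintegral fineK; last first.
  apply: integrable_fin_num => //.
  exact: (integrable_norm ig').
rewrite -integral_itv_bndo_bndc//.
apply: (@le_trans _ _ (\int[mu]_(x in `]p, q[)
    ((2 * (q - p) / 2)%:E * ratio m g x + (M / (2 * (q - p)))%:E))%E).
  apply: ge0_le_integral => //.
  - by apply: emeasurable_funD => //; exact: measurable_funeM.
  - move=> x /=; rewrite in_itv /= => /andP[px xq].
    by apply: abs_le_ratio => //; apply: uM; rewrite !ltW.
rewrite ge0_integralD//; last 2 first.
- by move=> x _; rewrite mule_ge0 ?ratio_ge0// lee_fin; lra.
- exact: measurable_funeM.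
rewrite ge0_integralZl_EFin//; [|by move=> x _; exact: ratio_ge0|lra].
rewrite integral_cst//= lebesgue_measure_itv /= lte_fin pq -EFinB -EFinM.
rewrite [X in (X%:E * _)%E](_ : _ = q - p); last by lra.
rewrite [X in (_ + X%:E)%E](_ : _ = M / 2); last by field; rewrite gt_eqF// subr_gt0.
rewrite [leRHS]EFinD (EFinM (q - p) K); apply: leeD => //; apply: lee_wpmul2l; first by rewrite lee_fin; lra.
apply: le_trans hK; apply: ge0_subset_integral => //; first exact: measurable_oI11.
by move=> x _; exact: ratio_ge0.
Qed.

(** The supremum M of |1 - m| between 0 and x is finite by continuity, and [W12_osc] from the point
    0 gives M <= K |x| + M / 2. *)
Lemma W12_growth m g K x : W12_1d m g -> m 0 = 1 ->
  (\int[mu]_(x in @oI11 R) ratio m g x <= K%:E)%E -> -1 <= x <= 1 ->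
  `|1 - m x| <= 2 * K * `|x|.
Proof.
move=> h m0 hK /andP[x1 x2].
have K0 : 0 <= K.
  by rewrite -lee_fin; apply: le_trans hK; apply: integral_ge0 => y _; exact: ratio_ge0.
pose p := Num.min x 0; pose q := Num.max x 0.
have pP : p = x /\ x <= 0 \/ p = 0 /\ 0 <= x.
  by rewrite /p; case: (leP x 0) => ?; [left|right; rewrite ltW].
have qP : q = 0 /\ x <= 0 \/ q = x /\ 0 <= x.
  by rewrite /q; case: (leP x 0) => ?; [left|right; rewrite ltW].
have pq : q - p = `|x|.
  by case: pP => -[-> ?]; case: qP => -[-> ?]; case: (ger0P x) => ?; lra.
have p0 : p <= 0 by case: pP => -[-> ?].
have q0 : 0 <= q by case: qP => -[-> ?].
have p1 : -1 <= p by case: pP => -[-> ?]; lra.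
have q1 : q <= 1 by case: qP => -[-> ?]; lra.
pose S := [set `|1 - m y| | y in `[p, q]%classic].
have inS y : p <= y <= q -> S `|1 - m y| by move=> py; exists y => //=; rewrite in_itv.
have hS : has_ubound S.
  have cm := W12_continuous h.
  have := continuous_compact cm (@segment_compact R (-1) 1).
  move=> /compact_bounded[M [_ MP]]; exists (1 + (`|M| + 1)) => _ [y /= + <-].
  rewrite in_itv /= => /andP[py yq]; apply: le_trans (ler_normB _ _) _.
  rewrite normr1 lerD2l; apply: (MP (`|M| + 1)).
    by rewrite (le_lt_trans (ler_norm M))// ltrDl.
  by exists y => //=; rewrite in_itv /=; apply/andP; split; lra.
have le_sup y : p <= y <= q -> `|1 - m y| <= sup S.
  by move=> /inS; exact: ub_le_sup.
have S0 : 0 <= sup S by apply: le_trans (le_sup 0 _); rewrite ?p0 ?q0.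
have b y : p <= y <= q -> `|1 - m y| <= `|x| * K + sup S / 2.
  move=> /andP[py yq]; rewrite -[in leLHS]m0.
  have ab (a b : R) : p <= a -> a <= b -> b <= q -> `|m b - m a| <= `|x| * K + sup S / 2.
    move=> pa; rewrite le_eqVlt => /predU1P[-> _|ab bq].
      by rewrite subrr normr0 addr_ge0 ?mulr_ge0// divr_ge0.
    apply: le_trans (W12_osc h hK _ ab _ _) _; [lra|lra| |].
      by move=> z /andP[az zb]; apply: le_sup; apply/andP; split; lra.
    by rewrite lerD2r ler_wpM2r//; lra.
  case: (leP y 0) => y0; first by apply: ab.
  by rewrite distrC; apply: ab => //; exact: ltW.
have : sup S <= `|x| * K + sup S / 2.
  by apply: ge_sup; [exists `|1 - m 0|; apply: inS; rewrite p0|move=> _ [y /= + <-]; rewrite in_itv; exact: b].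
have : `|1 - m x| <= sup S.
  by apply: le_sup; case: pP => -[-> ?]; case: qP => -[-> ?]; apply/andP; split; lra.
lra.
Qed.

End W12.

(** * Lower bound for the full energy *)

Section energy_lower_bound.
Context {R : realType}.
Local Notation mu := (@lebesgue_measure R).
Implicit Types (gamma L x : R) (m g : R -> R).

(* The value of epsilon with eps * L = exp (- L), for which log(1/delta) = L + o(1). *)
Definition core L : R := expR (- L) / L.

Lemma core_gt0 L : 0 < L -> 0 < core L.
Proof. by move=> L0; rewrite divr_gt0// expR_gt0. Qed.

Lemma mulL_expRN_le1 L : 0 < L -> L * expR (- L) <= 1.
Proof.
move=> L0; rewrite expRN ler_pdivrMr ?expR_gt0// mul1r.
by apply: le_trans (expR_ge1Dx L); lra.
Qed.

Lemma dir_inf_ge0 gamma m : bdm m -> (0 <= dir_inf gamma m)%E.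
Proof.
move=> bm; apply: le_ereal_inf_tmp => a /(dir_valsP bm).
move=> [U [U1 [U2 [_ [b [-> Ub]]]]]]; rewrite lee_fin.
apply/ler_addgt0Pr => e e0; have [N /(_ N (leqnn N))] := Ub e e0.
by rewrite ler_norml; have := @energy_ge0 R (U1 N) (U2 N) => ? /andP[_ ?]; lra.
Qed.

Lemma E_gamma_ge0 gamma L m g : 0 < L -> W12_1d m g -> (0 <= E_gamma gamma L m g)%E.
Proof.
move=> L0 h; apply: adde_ge0; apply: mule_ge0.
- by rewrite lee_fin divr_ge0// ltW.
- by apply: integral_ge0 => x _; exact: ratio_ge0.
- by rewrite lee_fin divr_ge0.
- exact: dir_inf_ge0 (W12_bdm h).
Qed.

Lemma inf_E_ge0 gamma L : 0 < L -> (0 <= inf_E gamma L)%E.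
Proof.
move=> L0; apply: le_ereal_inf_tmp => _ [m [g [_ [h ->]]]]; exact: E_gamma_ge0.
Qed.

Lemma flat_growth_dipy m g (K s : R) : 0 < s -> W12_1d m g -> m 0 = 1 ->
  (\int[mu]_(x in @oI11 R) ratio m g x <= K%:E)%E ->
  flat (fun x => (1 - m x) * dipy s x 0) <= 6 * K * s * pi.
Proof.
move=> s0 h m0 hK; have [_ [r [t [hp hq]]]] := harm_dip s0.
have cq := C1u_cont hq.
have [_ [r' [t' [_ hq']]]] := @harm_src R _ s0; have cq' := C1u_cont hq'.
have K0 : 0 <= K.
  by rewrite -lee_fin; apply: le_trans hK; apply: integral_ge0 => y _; exact: ratio_ge0.
apply: (@le_trans _ _ (flat (fun x => 6 * K * s * srcy s x 0))).
  apply: le_flat.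
  - by apply: bdmM; [apply: bdmB; [exact: bdm_cst|exact: W12_bdm h]|exact: bdm_flat].
  - by apply: bdmZ; exact: bdm_flat.
  move=> x /andP[x1 x2]; have q0 := dipy_ge0 x s0.
  apply: (@le_trans _ _ (2 * K * `|x| * dipy s x 0)).
    apply: ler_wpM2r => //; apply: le_trans (ler_norm _) _.
    by apply: W12_growth h m0 hK _; rewrite !ltW.
  have K2 : 0 <= 2 * K by exact: mulr_ge0.
  have := ler_wpM2l K2 (absx_dipy x s0).
  lra.
rewrite flatZ; last exact: bdm_flat.
by apply: ler_wpM2l; [rewrite !mulr_ge0// ltW|exact: flat_srcy].
Qed.

(** The amplitude gamma / L maximises 2 c gamma pi - c^2 pi L, the leading part of [dir_inf_lower];
    half of the maximum is the leading term here. *)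
Lemma inf_E_lower gamma : 0 < gamma -> exists C L0 : R, 1 <= L0 /\
  forall L, L0 <= L ->
    ((pi * gamma ^+ 2 / (2 * L) - C / L ^+ 2)%:E <= inf_E gamma (core L))%E.
Proof.
move=> g0; have p0 := pi_gt0 R.
(* With s = expR (- L) / A, the loss (gamma / L) * 6 K s pi equals core L / 2 * K, so the exchange
   energy cancels it exactly, whatever K is. *)
pose A := 12 * pi * gamma.
have A0 : 0 < A by rewrite !mulr_gt0.
exists (gamma ^+ 2 * pi * (4 / A + (ln A + 7) / 2)), (1 + 8 / A).
have A8 : 0 < 8 / A by rewrite divr_gt0.
split=> [|L L1]; first by rewrite lerDl ltW.
have L0 : 0 < L by lra.
apply: le_ereal_inf_tmp => _ [m [g [[m0 _] [h ->]]]].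
have e0 := core_gt0 L0.
have Kge0 : (0 <= \int[mu]_(x in @oI11 R) ratio m g x)%E.
  by apply: integral_ge0 => x _; exact: ratio_ge0.
rewrite /E_gamma; have D0 := dir_inf_ge0 gamma (W12_bdm h).
(* With infinite exchange energy the total is +oo, and the bound is trivial. *)
case hK : (\int[mu]_(x in @oI11 R) ratio m g x)%E Kge0 => [K| |//] Kge0; last first.
  have -> : ((core L / 2)%:E * +oo = +oo)%E.
    by apply: gt0_muley; rewrite lte_fin divr_gt0.
  rewrite addye ?leey// gt_eqF//; apply: (@lt_le_trans _ _ 0%E) => //.
  by apply: mule_ge0; rewrite ?lee_fin.
rewrite lee_fin in Kge0.
pose s := expR (- L) / A.
have s0 : 0 < s by rewrite divr_gt0// expR_gt0.
have LE := mulL_expRN_le1 L0.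
have E0 := expR_gt0 (- L).
have sL : s * L <= 1 / A.
  by rewrite /s mulrAC ler_pM2r ?invr_gt0// mulrC.
have s8 : s <= 1 / 8.
  rewrite -(ler_pM2r L0); apply: le_trans sL _; lra.
have c0 : 0 <= gamma / L by rewrite divr_ge0// ltW.
have := dir_inf_lower s0 s8 g0 c0 (W12_bdm h).
have fl : flat (fun x => (1 - m x) * dipy s x 0) <= 6 * K * s * pi.
  by apply: (flat_growth_dipy s0 h m0); rewrite hK.
move=> dl.
have lns : - ln s = L + ln A.
  by rewrite /s ln_div ?posrE// expRK; ring.
apply: (@le_trans _ _ (core L / 2 * K + 1 / 2 * (2 * (gamma / L) * (gamma * (pi * (1 - 4 * s)) -
   flat (fun x => (1 - m x) * dipy s x 0)) - (gamma / L) ^+ 2 * (pi * (- ln s + 7))))%:E).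
  rewrite lee_fin lns.
  have cK : core L / 2 * K = gamma / L * (6 * K * s * pi).
    rewrite /core /s /A; move: (expR _) => E; clear -p0 g0 L0; move: (pi) p0 => p p0.
    by field; rewrite !gt_eqF.
  rewrite cK.
  have := ler_wpM2l c0 fl; move: (flat _) (ln A) => F l Fle.
  suff : pi * gamma ^+ 2 / (2 * L) - gamma ^+ 2 * pi * (4 / A + (l + 7) / 2) / L ^+ 2 <=
    gamma / L * (gamma * (pi * (1 - 4 * s))) - 1 / 2 * ((gamma / L) ^+ 2 * (pi * (L + l + 7))).
    set X := _ - _ / L ^+ 2; move: Fle; clearbody X; clear.
    by move: (gamma / L) (pi * (1 - 4 * s)) (pi * (L + l + 7)) (6 * K * s * pi) => *; lra.
  have gp : 0 <= 4 * gamma ^+ 2 * pi / L ^+ 2.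
    by rewrite divr_ge0 ?sqr_ge0// mulr_ge0 ?ltW// mulr_gt0// exprn_gt0.
  have := ler_wpM2l gp sL; rewrite -subr_ge0 => H; rewrite -subr_ge0.
  apply: le_trans H _; rewrite le_eqVlt; apply/orP; left; apply/eqP.
  move: (pi) => p; field; rewrite !gt_eqF//.
rewrite EFinD !EFinM; apply: leeD => //.
by apply: lee_wpmul2l => //; rewrite lee_fin.
Qed.

End energy_lower_bound.

(** * Dilations of the line *)

Section dilation.
Context {R : realType}.
Local Notation mu := (@lebesgue_measure R).
Local Open Scope ereal_scope.
Implicit Types (k : R).

Let dil k : measurableTypeR R -> measurableTypeR R := fun x => (k * x)%R.

Let measurable_dil k : measurable_fun setT (dil k).
Proof. exact: (@measurable_funM _ _ _ _ (cst k) id). Qed.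

Let push k : {measure set (measurableTypeR R) -> \bar R} :=
  measure_function_pushforward__canonical__measure_function_Measure mu (measurable_dil k).

(** Uniqueness of the Lebesgue measure reduces the claim to half-open intervals. *)
Let lebesgue_measure_dilation k (k0 : (0 < k)%R) (A : set R) : measurable A ->
  mu A = mscale (NngNum (ltW k0)) (push k) A.
Proof.
move=> mA; apply: lebesgue_measure_unique => //.
move=> _ [[a b]] _ <-.
transitivity (k%:E * mu (dil k @^-1` `]a, b]%classic)); last by [].
rewrite (_ : dil k @^-1` _ = `](a / k)%R, (b / k)%R]%classic); last first.
  by apply/seteqP; split => x /=; rewrite !in_itv /= /dil ltr_pdivrMr// ler_pdivlMr// mulrC.
rewrite !lebesgue_measure_itv /= !lte_fin ltr_pM2r ?invr_gt0//.
case: ifP => _; last by rewrite mule0.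
by rewrite -!EFinB -EFinM; congr EFin; field; rewrite gt_eqF.
Qed.

Lemma ge0_integral_dilation k (f : R -> \bar R) : (0 < k)%R ->
  measurable_fun setT f -> (forall x, 0 <= f x) ->
  \int[mu]_x f x = k%:E * \int[mu]_x f (k * x)%R.
Proof.
move=> k0 mf f0.
rewrite (@eq_measure_integral _ _ _ _ (mscale (NngNum (ltW k0)) (push k))); last first.
  by move=> A mA _; exact: lebesgue_measure_dilation.
rewrite ge0_integral_mscale//; congr (_ * _).
by rewrite (ge0_integral_pushforward (measurable_dil k)).
Qed.

Lemma integrable_dilation k (f : R -> \bar R) : (0 < k)%R ->
  mu.-integrable setT f -> mu.-integrable setT (fun x => f (k * x)%R).
Proof.
move=> k0 /integrableP[mf foo]; apply/integrableP; split.
  exact: (measurableT_comp mf (measurable_dil k)).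
move: foo; rewrite (@ge0_integral_dilation k)//; last exact: measurableT_comp.
rewrite !ltey; apply: contra => /eqP ->.
by rewrite gt0_muley// lte_fin.
Qed.

Lemma integral_dilation k (f : R -> \bar R) : (0 < k)%R ->
  mu.-integrable setT f -> \int[mu]_x f x = k%:E * \int[mu]_x f (k * x)%R.
Proof.
move=> k0 intf; have mf := measurable_int _ intf.
have intfk := integrable_dilation k0 intf.
have p : \int[mu]_x f^\+ x = k%:E * \int[mu]_x ((fun x => f (k * x)%R)^\+ x).
  rewrite [LHS](@ge0_integral_dilation k _ k0)//; last exact: measurable_funepos.
  by congr (_ * _); apply: eq_integral => x _; rewrite !funeposE.
have n : \int[mu]_x f^\- x = k%:E * \int[mu]_x ((fun x => f (k * x)%R)^\- x).
  rewrite [LHS](@ge0_integral_dilation k _ k0)//; last exact: measurable_funeneg.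
  by congr (_ * _); apply: eq_integral => x _; rewrite !funenegE.
rewrite (integralE mu setT f) (integralE mu setT (fun x => f (k * x)%R)) p n.
apply/esym/muleBr => //; apply: fin_num_adde_defr.
by apply: integrable_fin_num => //; exact: integrable_funepos.
Qed.

End dilation.

(** * Dilations of the half-disk *)

Section II_dilation.
Context {R : realType}.
Local Notation mu := (@lebesgue_measure R).
Implicit Types (f : R -> R -> R) (k : R).

Let up f : measurableTypeR R * measurableTypeR R -> \bar R :=
  fun p => if 0 < p.2 then (f p.1 p.2)%:E else 0%E.

Let measurable_up f : cont2 f -> measurable_fun setT (up f).
Proof.
move=> cf; apply: measurable_fun_ifT.
- by apply: measurable_fun_ltr; [exact: measurable_cst|exact: measurable_snd].
- by apply/measurable_EFinP; exact: cont2_measurable.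
- exact: measurable_cst.
Qed.

Let II_up f : cont2 f -> (forall x y, 1 <= x ^+ 2 + y ^+ 2 -> f x y = 0) ->
  (II f)%:E = (\int[mu]_x \int[mu]_y up f (x, y))%E.
Proof.
move=> cf f1; rewrite (II_hd_int cf) /hd_int integral_mkcond; apply: eq_integral => x _.
rewrite patchE; case: ifPn => [/set_mem|/negP xI].
  rewrite /oI11 /= in_itv /= => xI.
  rewrite [LHS]integral_mkcond; apply: eq_integral => y _.
  rewrite patchE /up /=; case: ifPn => [/set_mem|/negP yI].
    by rewrite /oIsq /= in_itv /= => /andP[-> _].
  case: ifPn => // y0; rewrite f1//; rewrite leNgt; apply/negP => xy; apply: yI.
  apply/mem_set; rewrite /oIsq /= in_itv /= y0 /=.
  rewrite -(ger0_norm (ltW y0)) -sqrtr_sqr ltr_sqrt; nra.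
apply/esym/integral0_eq => y _; rewrite /up /=; case: ifPn => // y0.
rewrite f1// leNgt; apply/negP => xy; apply: xI; apply/mem_set.
by rewrite /oI11 /= in_itv /=; apply/andP; split; nra.
Qed.

(** As f vanishes off the disk, the half-disk can be replaced by the half-plane, which dilations
    preserve; each coordinate then contributes a factor k. *)
Lemma II_dilation f k : 1 <= k -> cont2 f -> (forall x y, 0 <= f x y) ->
  (forall x y, 1 <= x ^+ 2 + y ^+ 2 -> f x y = 0) ->
  k ^+ 2 * II (fun x y => f (k * x) (k * y)) = II f.
Proof.
move=> k1 cf f0 f1; have k0 : 0 < k by lra.
have cfk : cont2 (fun x y => f (k * x) (k * y)) by apply: (cont2_subst cf); cont2_tac.
have mf := measurable_up cf.
have up0 p : (0 <= up f p)%E by rewrite /up; case: ifP => _ //; rewrite lee_fin.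
have fk1 x y : 1 <= x ^+ 2 + y ^+ 2 -> f (k * x) (k * y) = 0.
  move=> xy; apply: f1; rewrite !exprMn -mulrDr.
  by apply: (le_trans xy); rewrite ler_peMl ?exprn_ege1// addr_ge0 ?sqr_ge0.
apply: EFin_inj; rewrite EFinM !II_up//.
have mfy x : measurable_fun setT (fun y => up f (x, y)).
  exact: measurableT_comp mf (measurable_pair1 x).
rewrite [RHS](ge0_integral_dilation k0); last 2 first.
- exact: (measurable_fun_fubini_tonelli_F (up f)).
- by move=> x; exact: integral_ge0.
rewrite expr2 EFinM -muleA; congr (_ * _)%E.
rewrite -ge0_integralZl_EFin//; last 3 first.
- by move=> x _; apply: integral_ge0 => y _; rewrite /up /=; case: ifP => // _; rewrite lee_fin.
- apply: (measurable_fun_fubini_tonelli_F (up (fun x y => f (k * x) (k * y)))).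
    exact: measurable_up.
  by move=> p; rewrite /up; case: ifP => // _; rewrite lee_fin.
- exact: ltW.
apply: eq_integral => x _; rewrite [RHS](@ge0_integral_dilation _ k)//; last exact: mfy.
congr (_ * _)%E; apply: eq_integral => y _.
by rewrite /up /= pmulr_rgt0.
Qed.

End II_dilation.

(** * Chain rule for C^{1,1} functions of a Sobolev function *)

Section W12_chain.
Context {R : realType}.
Local Notation mu := (@lebesgue_measure R).
Implicit Types (f m g : R -> R) (a b x C : R).

Lemma measurable_cI11 : measurable (@cI11 R : set (measurableTypeR R)).
Proof. exact: measurable_itv. Qed.

Lemma W12_measurable m g : W12_1d m g -> measurable_fun (@cI11 R) m.
Proof.
move=> h; apply: subspace_continuous_measurable_fun; first exact: measurable_cI11.
exact: W12_continuous h.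
Qed.

Lemma W12_bounded m g : W12_1d m g -> exists M, forall x, cI11 x -> `|m x| <= M.
Proof.
move=> h; have := continuous_compact (W12_continuous h) (@segment_compact R (-1) 1).
move=> /compact_bounded[M [_ MP]]; exists (`|M| + 1) => x xI.
apply: (MP (`|M| + 1)); last by exists x.
by rewrite (le_lt_trans (ler_norm M))// ltrDl.
Qed.

Lemma integrable_scale (D : set (measurableTypeR R)) f (k : R) : measurable D ->
  mu.-integrable D (EFin \o f) -> mu.-integrable D (EFin \o (fun x => k * f x)).
Proof.
move=> mD i; apply: eq_integrable (integrableZl mD k i) => // x _ /=.
Qed.

Lemma integrable_bdM (u g : R -> R) (M : R) : measurable_fun (@cI11 R) u ->
  (forall x, cI11 x -> `|u x| <= M) -> mu.-integrable (@cI11 R) (EFin \o g) ->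
  mu.-integrable (@cI11 R) (EFin \o (fun x => u x * g x)).
Proof.
move=> mu' uM ig; have := integrableMr measurable_cI11 mu' _ ig; apply.
exists M; split; first exact: num_real.
by move=> N MN x /uM /le_trans; apply; exact: ltW.
Qed.

Definition cum f x : R := \int[mu]_(t in `[-1, x]) f t.

Lemma cumB f a b : mu.-integrable (@cI11 R) (EFin \o f) -> -1 <= a -> a <= b -> b <= 1 ->
  cum f b - cum f a = \int[mu]_(x in `]a, b]) f x.
Proof.
move=> ig a1 ab b1; apply: Rintegral_itvB; rewrite ?bnd_simp//.
apply: integrableS ig => //; first exact: measurable_itv.
by apply: subset_itvl; rewrite bnd_simp.
Qed.

Lemma integrable_sub f a b : mu.-integrable (@cI11 R) (EFin \o f) -> -1 <= a -> b <= 1 ->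
  mu.-integrable `]a, b] (EFin \o f).
Proof.
move=> ig a1 b1; apply: integrableS ig => //; first exact: measurable_itv.
by move=> x; rewrite /cI11 /= !in_itv /= => /andP[ax xb]; apply/andP; split; lra.
Qed.

Lemma cum_abs f a b : mu.-integrable (@cI11 R) (EFin \o f) -> -1 <= a -> a <= b -> b <= 1 ->
  `|\int[mu]_(x in `]a, b]) f x| <= cum (fun x => `|f x|) b - cum (fun x => `|f x|) a.
Proof.
move=> ig a1 ab b1; rewrite cumB//; last exact: (integrable_norm ig).
by apply: le_normr_Rintegral => //; exact: integrable_sub.
Qed.

Lemma cum_mono f a b : mu.-integrable (@cI11 R) (EFin \o f) -> -1 <= a -> a <= b -> b <= 1 ->
  cum (fun x => `|f x|) a <= cum (fun x => `|f x|) b.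
Proof.
by move=> ig a1 ab b1; rewrite -subr_ge0; apply: le_trans (cum_abs ig a1 ab b1).
Qed.

Lemma cum_continuous f a b : mu.-integrable (@cI11 R) (EFin \o f) -> -1 <= a -> b <= 1 ->
  {within `[a, b], continuous (cum f)}.
Proof.
move=> ig a1 b1; have := @parameterized_integral_continuous R (-1) 1 f _ ig.
move=> /(_ ltac:(lra)); apply: continuous_subspaceW => x.
by rewrite /= !in_itv /= => /andP[ax xb]; apply/andP; split; lra.
Qed.

Variables (phi phi' : R -> R) (C : R).
Hypothesis C0 : 0 <= C.
Hypothesis phi_taylor : forall a b, `|phi b - phi a - phi' a * (b - a)| <= C * (b - a) ^+ 2.
Hypothesis phi'_lip : forall a b, `|phi' a - phi' b| <= C * `|a - b|.
Hypothesis cphi' : continuous phi'.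

Let chain_bounded m g : W12_1d m g ->
  measurable_fun (@cI11 R) (fun x => phi' (m x)) /\
  exists M, forall x, cI11 x -> `|phi' (m x)| <= M.
Proof.
move=> h; split.
  by apply: (measurableT_comp (continuous_measurable_fun cphi')); exact: W12_measurable h.
have [M mM] := W12_bounded h; exists (`|phi' 0| + C * M) => x /mM xM.
rewrite -[phi' (m x)](subrK (phi' 0)) addrC; apply: le_trans (ler_normD _ _) _.
rewrite lerD2l; apply: le_trans (phi'_lip _ _) _; rewrite subr0; exact: ler_wpM2l.
Qed.

Let chain_integrable m g : W12_1d m g ->
  mu.-integrable (@cI11 R) (EFin \o (fun x => phi' (m x) * g x)).
Proof.
move=> h; have [mc [M cM]] := chain_bounded h; have [_ [ig _]] := h.
exact: integrable_bdM cM ig.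
Qed.

(* Halving the mass of |g| halves the sum of the quadratic errors. *)
Let chain_error m g n : W12_1d m g -> forall a b, -1 <= a -> a <= b -> b <= 1 ->
  `|phi (m b) - phi (m a) - \int[mu]_(x in `]a, b]) (phi' (m x) * g x)| <=
  2 * C * 2^-1 ^+ n * (cum (fun x => `|g x|) b - cum (fun x => `|g x|) a) ^+ 2.
Proof.
move=> h; have [_ [ig _]] := h; have ich := chain_integrable h.
elim: n => [|n IH] a b a1 ab b1; last first.
  set Q := cum (fun x => `|g x|) in IH *.
  have Qab : Q a <= Q b by exact: cum_mono.
  have [||c] := @IVT R Q a b ((Q a + Q b) / 2) ab.
  - by apply: cum_continuous => //; exact: (integrable_norm ig).
  - by rewrite ge_min le_max; apply/andP; split; apply/orP; [left|right]; lra.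
  rewrite in_itv /= => /andP[ac cb] Qc.
  have c1 : -1 <= c by lra.
  have c2 : c <= 1 by lra.
  have := IH _ _ a1 ac c2; have := IH _ _ c1 cb b1; rewrite Qc.
  rewrite -!cumB//.
  set P := cum _; set K := 2 * C * 2^-1 ^+ n.
  have -> : 2 * C * 2^-1 ^+ n.+1 * (Q b - Q a) ^+ 2 = K / 2 * (Q b - Q a) ^+ 2.
    by rewrite /K exprSr; ring.
  have -> : K * (Q b - (Q a + Q b) / 2) ^+ 2 = K / 4 * (Q b - Q a) ^+ 2 by field.
  have -> : K * ((Q a + Q b) / 2 - Q a) ^+ 2 = K / 4 * (Q b - Q a) ^+ 2 by field.
  have -> : phi (m b) - phi (m a) - (P b - P a) = (phi (m b) - phi (m c) - (P b - P c)) +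
    (phi (m c) - phi (m a) - (P c - P a)) by ring.
  move=> e1 e2; apply: le_trans (ler_normD _ _) _; apply: le_trans (lerD e1 e2) _.
  by rewrite le_eqVlt; apply/orP; left; apply/eqP; field.
(* Base case: the Taylor error and the freezing of phi' at m a each cost C times the squared mass of
   |g|, which bounds the oscillation of m. *)
set Q := cum (fun x => `|g x|).
have osc x : a <= x -> x <= b -> `|m x - m a| <= Q b - Q a.
  move=> ax xb; have x1 : x <= 1 by lra.
  rewrite (W12_increment h a1 ax x1); apply: le_trans (cum_abs ig a1 ax x1) _.
  rewrite lerD2r; apply: cum_mono => //; lra.
have iab := integrable_sub ig a1 b1.
have ica := integrable_sub ich a1 b1.
have icst : mu.-integrable `]a, b] (EFin \o (fun x => phi' (m a) * g x)).
  by apply: integrable_scale => //; exact: measurable_itv.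
have -> : phi (m b) - phi (m a) - \int[mu]_(x in `]a, b]) (phi' (m x) * g x) =
  (phi (m b) - phi (m a) - phi' (m a) * (m b - m a)) -
  \int[mu]_(x in `]a, b]) (phi' (m x) * g x - phi' (m a) * g x).
  rewrite RintegralB// RintegralZl// -(W12_increment h a1 ab b1); ring.
rewrite expr0 mulr1; apply: le_trans (ler_normB _ _) _.
have -> : 2 * C * (Q b - Q a) ^+ 2 = C * (Q b - Q a) ^+ 2 + C * (Q b - Q a) * (Q b - Q a).
  by ring.
apply: lerD.
  apply: le_trans (phi_taylor _ _) _; apply: ler_wpM2l => //.
  rewrite -(real_normK (num_real (m b - m a))); apply: lerXn2r; rewrite ?nnegrE//.
    by apply: le_trans (osc b _ _); rewrite ?lexx.
  by apply: osc; rewrite ?lexx.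
have idiff : mu.-integrable `]a, b] (EFin \o (fun x => phi' (m x) * g x - phi' (m a) * g x)).
  by apply: (integrableB _ ica icst); exact: measurable_itv.
apply: le_trans (le_normr_Rintegral _ idiff) _ => //.
have iabs := integrable_norm iab.
have -> : C * (Q b - Q a) * (Q b - Q a) =
    \int[mu]_(x in `]a, b]) (C * (Q b - Q a) * `|g x|).
  rewrite RintegralZl//; congr (_ * _); rewrite /Q cumB//; exact: (integrable_norm ig).
apply: le_Rintegral => //.
- exact: (integrable_norm idiff).
- by apply: integrable_scale => //; exact: measurable_itv.
- move=> x /=; rewrite in_itv /= => /andP[/ltW ax xb].
  rewrite -mulrBl normrM; apply: ler_wpM2r => //.
  by apply: le_trans (phi'_lip _ _) _; apply: ler_wpM2l => //; exact: osc.
Qed.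

(** The integral formula for phi (m) is exact because [chain_error] holds for all n and its right
    side tends to 0. Only the integral representation of m enters, no pointwise derivative. *)
Lemma W12_chain m g : W12_1d m g -> W12_1d (fun x => phi (m x)) (fun x => phi' (m x) * g x).
Proof.
move=> h; have [mc [M cM]] := chain_bounded h; have [mg [ig [g2 _]]] := h.
have ich := chain_integrable h.
split; first exact: measurable_funM.
split=> //; split.
  have M0 : 0 <= M ^+ 2 by exact: sqr_ge0.
  apply: (@le_lt_trans _ _ (\int[mu]_(x in @cI11 R) ((M ^+ 2)%:E * (g x ^+ 2)%:E))%E).
    apply: ge0_le_integral; first exact: measurable_cI11.
    - by move=> x _; rewrite lee_fin sqr_ge0.
    - by apply/measurable_EFinP; apply: measurable_funM; exact: measurable_funM.
    - by apply: measurable_funeM; apply/measurable_EFinP; exact: measurable_funM.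
    - move=> x xI; rewrite -EFinM lee_fin exprMn; apply: ler_wpM2r; first exact: sqr_ge0.
      rewrite -(real_normK (num_real (phi' (m x)))); apply: lerXn2r; rewrite ?nnegrE ?cM//.
      exact: le_trans (cM x xI).
  rewrite ge0_integralZl_EFin//; last 3 first.
  - exact: measurable_cI11.
  - by move=> x _; rewrite lee_fin sqr_ge0.
  - by apply/measurable_EFinP; exact: measurable_funM.
  by rewrite lte_mul_pinfty// lee_fin.
move=> x /andP[x1 x2]; apply/eqP; rewrite -subr_eq0 -normr_le0; apply/ler_addgt0Pr => e e0.
rewrite add0r.
have c1 : cum (fun x => phi' (m x) * g x) (-1) = 0.
  by rewrite /cum set_itv1 Rintegral_set1.
rewrite -[Rintegral _ _ _]/(cum (fun x => phi' (m x) * g x) x).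
rewrite opprD addrA.
have cx := cumB ich (lexx (-1)) x1 x2; rewrite c1 subr0 in cx; rewrite cx.
set K := 2 * C * (cum (fun x => `|g x|) x - cum (fun x => `|g x|) (-1)) ^+ 2.
have [N NP] : exists n, K * 2^-1 ^+ n <= e.
  have : (K \*: (fun n => 2^-1 ^+ n)) @ \oo --> K * 0.
    apply: cvgMl_tmp; apply: cvg_expr.
    by rewrite ger0_norm ?invr_ge0// invf_lt1// ltr1n.
  rewrite mulr0 => /cvgrPdist_le /(_ _ e0) [N _ /(_ N (leqnn N))].
  rewrite /= sub0r normrN => H; exists N; exact: le_trans (ler_norm _) H.
apply: le_trans (chain_error N h (lexx _) x1 x2) _; apply: (le_trans _ NP).
by rewrite /K le_eqVlt; apply/orP; left; apply/eqP; ring.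
Qed.

End W12_chain.

(** * Linear combinations and dilations of Sobolev functions *)

Section W12_closure.
Context {R : realType}.
Local Notation mu := (@lebesgue_measure R).
Implicit Types (m g v h : R -> R) (a b c k x : R).

Let mD := @measurable_cI11 R.

Lemma W12_C1 h h' : continuous h' -> (forall x : R, is_derive x 1 h (h' x)) -> W12_1d h h'.
Proof.
move=> ch dh; have mh D : measurable_fun D h' by exact: measurable_continuous.
split; first exact: mh.
split; first exact: integrable_continuous_cc.
split.
  have i2 : mu.-integrable `[-1, 1] (EFin \o (fun x => h' x ^+ 2)).
    by apply: integrable_continuous_cc => x; apply: cvgM; exact: ch.
  exact: integrable_lty i2.
move=> x /andP[x1 x2]; rewrite /Rintegral.
rewrite -[X in fine X](_ : (\int[mu]_(t in `](-1)%R, x[) (h' t)%:E)%E = _); last first.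
  by apply: integral_oo_cc.
rewrite (@FTC2_oo _ h)//=; first by rewrite addrC subrK.
by move=> y _; exact: is_derive_continuous (dh y).
Qed.

Lemma W12_lin a b c m g m' g' : W12_1d m g -> W12_1d m' g' ->
  W12_1d (fun x => a + (b * m x + c * m' x)) (fun x => b * g x + c * g' x).
Proof.
move=> [mg [ig [g2 mE]]] [mg' [ig' [g2' mE']]].
have ib := integrable_scale b mD ig; have ic := integrable_scale c mD ig'.
have mb : measurable_fun (@cI11 R) (fun x => b * g x) by exact: measurable_funM.
have mc : measurable_fun (@cI11 R) (fun x => c * g' x) by exact: measurable_funM.
split; first exact: measurable_funD.
split; first exact: (integrableD mD ib ic).
split.
  apply: (@le_lt_trans _ _ (\int[mu]_(x in @cI11 R)
    ((2 * b ^+ 2)%:E * (g x ^+ 2)%:E + (2 * c ^+ 2)%:E * (g' x ^+ 2)%:E))%E).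
    apply: ge0_le_integral; first exact: mD.
    - by move=> x _; rewrite lee_fin sqr_ge0.
    - by apply/measurable_EFinP; apply: measurable_funM; exact: measurable_funD.
    - by apply: emeasurable_funD; apply: measurable_funeM; apply/measurable_EFinP;
        exact: measurable_funM.
    - move=> x _; rewrite -!EFinM -EFinD lee_fin.
      by have := sqr_ge0 (b * g x - c * g' x); nra.
  have q s : (0 <= (2 * s ^+ 2)%:E :> \bar R)%E by rewrite lee_fin mulr_ge0// sqr_ge0.
  rewrite ge0_integralD; first last.
  - by apply: measurable_funeM; apply/measurable_EFinP; exact: measurable_funM.
  - by move=> x _; apply: mule_ge0 => //; rewrite lee_fin sqr_ge0.
  - by apply: measurable_funeM; apply/measurable_EFinP; exact: measurable_funM.
  - by move=> x _; apply: mule_ge0 => //; rewrite lee_fin sqr_ge0.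
  - exact: mD.
  rewrite !ge0_integralZl_EFin; first last.
  all: try exact: mD.
  all: try by move=> x _; rewrite lee_fin sqr_ge0.
  all: try by apply/measurable_EFinP; exact: measurable_funM.
  all: try by rewrite mulr_ge0// sqr_ge0.
  by apply: lte_add_pinfty; apply: lte_mul_pinfty.
move=> x x1; rewrite (mE x x1) (mE' x x1) RintegralD.
- rewrite !RintegralZl//.
  + ring.
  + exact: measurable_itv.
  + apply: integrableS ig' => //; first exact: measurable_itv.
    by move: x1 => /andP[_ ?]; apply: subset_itvl; rewrite bnd_simp.
  + exact: measurable_itv.
  + apply: integrableS ig => //; first exact: measurable_itv.
    by move: x1 => /andP[_ ?]; apply: subset_itvl; rewrite bnd_simp.
- exact: measurable_itv.
- apply: integrableS ib => //; first exact: measurable_itv.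
  by move: x1 => /andP[_ ?]; apply: subset_itvl; rewrite bnd_simp.
- apply: integrableS ic => //; first exact: measurable_itv.
  by move: x1 => /andP[_ ?]; apply: subset_itvl; rewrite bnd_simp.
Qed.

(** A dilated argument leaves [-1, 1], so functions are continued there by their endpoint values.
    [cutoff] is the matching derivative, half-open like the intervals ]p, q] carrying the
    increments. *)
Definition clamp x : R := Num.max (-1) (Num.min x 1).
Definition cutoff g x : R := if (-1 < x) && (x <= 1) then g x else 0.

Lemma cutoffE g : EFin \o cutoff g = (EFin \o g) \_ `]-1, 1].
Proof.
apply/funext => x; rewrite patchE /cutoff /=.
have -> : (x \in `]-1, 1]%classic) = (-1 < x) && (x <= 1).
  by apply/idP/idP => [/set_mem|h]; rewrite ?inE /= in_itv.
by case: ifP.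
Qed.

Lemma W12_dilate v g k : W12_1d v g -> v (-1) = 0 -> v 1 = 0 -> 1 <= k ->
  W12_1d (fun x => v (clamp (k * x))) (fun x => k * cutoff g (k * x)).
Proof.
move=> h v0 v1 k1; have k0 : 0 < k by lra.
have [mg [ig [g2 vE]]] := h.
have sub : `]-1, 1]%classic `<=` @cI11 R by apply: subset_itv => //; rewrite bnd_simp.
have mI : measurable (`]-1, 1]%classic : set (measurableTypeR R)) by exact: measurable_itv.
have icut : mu.-integrable setT (EFin \o cutoff g).
  rewrite cutoffE -integrable_mkcond//; apply: integrableS ig => //; exact: mD.
have mcut : measurable_fun setT (cutoff g).
  by have /measurable_EFinP := measurable_int _ icut.
have mdil : measurable_fun setT (fun x : R => k * x).
  by apply: measurable_funM.
have mcutk : measurable_fun setT (fun x => k * cutoff g (k * x)).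
  by apply: measurable_funM => //; exact: measurableT_comp mcut mdil.
split; first exact: measurable_funTS.
split.
  have := integrable_dilation k0 icut => /(integrable_scale k measurableT).
  by apply: integrableS => //; exact: mD.
split.
  apply: (@le_lt_trans _ _ (\int[mu]_x ((k * cutoff g (k * x)) ^+ 2)%:E)%E).
    apply: ge0_subset_integral; [exact: mD|exact: measurableT|..|by []].
    - by apply/measurable_EFinP; exact: measurable_funM.
    - by move=> x _; rewrite lee_fin sqr_ge0.
  have mc2 : measurable_fun setT (fun x => (cutoff g x ^+ 2)%:E).
    by apply/measurable_EFinP; exact: measurable_funM.
  have -> : (\int[mu]_x ((k * cutoff g (k * x)) ^+ 2)%:E =
      k%:E * \int[mu]_x (cutoff g x ^+ 2)%:E)%E.
    rewrite (@ge0_integral_dilation _ k (fun x => (cutoff g x ^+ 2)%:E))//; last first.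
      by move=> x; rewrite lee_fin sqr_ge0.
    rewrite muleA -EFinM -ge0_integralZl_EFin//.
    - by apply: eq_integral => x _; rewrite -EFinM exprMn expr2.
    - by move=> x _; rewrite lee_fin sqr_ge0.
    - by apply: (measurableT_comp mc2 mdil).
    - by rewrite mulr_ge0// ltW.
  apply: lte_mul_pinfty; rewrite ?lee_fin ?(ltW k0)//.
  apply: le_lt_trans g2; rewrite [leRHS]integral_mkcond.
  apply: ge0_le_integral; first exact: measurableT.
  - by move=> x _; rewrite lee_fin sqr_ge0.
  - exact: mc2.
  - have mg2 : measurable_fun (@cI11 R) (fun x => (g x ^+ 2)%:E).
      by apply/measurable_EFinP; exact: measurable_funM.
    exact: (measurable_restrictT _ mD).1 mg2.
  - move=> x _; rewrite patchE /cutoff; case: ifP => [/andP[a1 a2]|_].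
      by rewrite ifT// inE /cI11 /= in_itv /= (ltW a1).
    by case: ifP => _; rewrite lee_fin ?expr0n//= sqr_ge0.
move=> x /andP[x1 x2]; set c := clamp (k * x).
have c1 : -1 <= c <= 1.
  by rewrite /c /clamp le_max lexx /= ge_max ge_min lexx orbT andbT; lra.
have -> : clamp (k * -1) = -1.
  rewrite /clamp mulrN1; apply/max_idPl; rewrite ge_min; apply/orP; left; lra.
rewrite v0 add0r (vE c c1) v0 add0r.
move/andP: c1 => [c1 c2].
have -> : Rintegral mu (cIm1 c) g = \int[mu]_(t in `]-1, c]) g t.
  have e : cum g (-1) = 0 by rewrite /cum set_itv1 Rintegral_set1.
  by have := cumB ig (lexx (-1)) c1 c2; rewrite e subr0.
rewrite Rintegral_mkcond [RHS]Rintegral_mkcond.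
have ic : mu.-integrable setT (EFin \o (g \_ `]-1, c])).
  rewrite -restrict_EFin -integrable_mkcond; last exact: measurable_itv.
  exact: integrable_sub ig (lexx _) c2.
rewrite /Rintegral (integral_dilation k0 ic) -integralZl//; last exact: integrable_dilation k0 ic.
congr fine; apply: eq_integral => t _ /=; rewrite -EFinM; congr EFin.
rewrite !patchE /cutoff.
have -> : (k * t \in `]-1, c]%classic) = (-1 < k * t) && (k * t <= c).
  by apply/idP/idP => [/set_mem|H]; rewrite ?inE /= in_itv.
have -> : (t \in cIm1 x) = (-1 <= t) && (t <= x).
  by apply/idP/idP => [/set_mem|H]; rewrite ?inE /cIm1 /= in_itv.
(* As k >= 1, the condition -1 < k t already forces -1 <= t, so no mass is lost at the left end. *)
have -> : (-1 < k * t) && (k * t <= c) =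
    ((-1 <= t) && (t <= x)) && ((-1 < k * t) && (k * t <= 1)).
  apply/idP/idP => [/andP[t1 tc]|/andP[/andP[t1 tx] /andP[kt kt1]]].
    have t2 : k * t <= Num.min (k * x) 1.
      by move: tc; rewrite /c /clamp le_max => /orP[|//]; lra.
    move: t2; rewrite le_min => /andP[t2 t3]; rewrite t1 t3 !andbT.
    by move: t2; rewrite ler_pM2l// => ->; rewrite andbT; nra.
  by rewrite kt /= /c /clamp le_max le_min kt1 andbT ler_pM2l// tx orbT.
case: ((-1 <= t) && (t <= x)); case: ((-1 < k * t) && (k * t <= 1)) => /=; by rewrite ?mulr0.
Qed.

End W12_closure.

(** * Approximants that vanish on the arc *)

Section compact_approximation.
Context {R : realType}.
Implicit Types (gamma k b d e x y : R) (u : R -> R).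

(** [ramp'] lies in [0, 1], so truncation does not raise the energy. It turns the one-sided
    constraint U >= gamma on the arc into vanishing there. *)
Lemma truncation_C1 gamma k U U1 U2 : 0 < k -> C1w U U1 U2 -> exists V1 V2,
  C1w (fun x y => ramp k (gamma - U x y)) V1 V2 /\
  forall x y : R, V1 x y ^+ 2 + V2 x y ^+ 2 <= U1 x y ^+ 2 + U2 x y ^+ 2.
Proof.
move=> k0 CU; have h := C1wD (C1w_cst gamma) (C1wZ (-1) CU).
have hV := C1w_comp (fun x => is_derive_ramp x k0) (@continuous_ramp' R k) h.
do 2 eexists; split.
  rewrite (_ : (fun x y => _) = (fun x y => ramp k (gamma + -1 * U x y))); first exact: hV.
  by apply/funext => x; apply/funext => y; rewrite mulN1r.
move=> x y /=; have /andP[r0 r1] := ramp'_itv (gamma + -1 * U x y) k0.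
set r := ramp' _ _ in r0 r1 *.
have r2 : r ^+ 2 <= 1 by rewrite exprn_ile1.
rewrite [leLHS](_ : _ = r ^+ 2 * (U1 x y ^+ 2 + U2 x y ^+ 2)); last by ring.
by rewrite ler_piMl// addr_ge0 ?sqr_ge0.
Qed.

(** Makes the layer energy small uniformly along a Cauchy sequence: a late gradient f is compared
    with one fixed bounded gradient g, for which only the area of the layer matters. *)
Lemma layer_diff_energy f1 f2 g1 g2 (tau M : R) : 0 < tau -> tau <= 1 / 2 ->
  cont2 f1 -> cont2 f2 -> cont2 g1 -> cont2 g2 ->
  (forall x y, x ^+ 2 + y ^+ 2 <= 1 -> g1 x y ^+ 2 + g2 x y ^+ 2 <= M) ->
  II (fun x y => lay tau x y ^+ 2 * (f1 x y ^+ 2 + f2 x y ^+ 2)) <=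
  2 * energy (fun x y => f1 x y - g1 x y) (fun x y => f2 x y - g2 x y) +
  2 * M * (pi * tau).
Proof.
move=> t0 t2 cf1 cf2 cg1 cg2 gM; have cl := @cont2_lay R tau.
have M0 : 0 <= M.
  by apply: le_trans (gM 0 0 _); rewrite ?addr_ge0 ?sqr_ge0// expr0n addr0.
apply: (@le_trans _ _ (2 * energy (fun x y => f1 x y - g1 x y) (fun x y => f2 x y - g2 x y)
    + 2 * M * II (fun x y => lay tau x y ^+ 2))); last first.
  by rewrite lerD2l; apply: ler_wpM2l; [exact: mulr_ge0|exact: layer_area].
rewrite /energy -!IIZ; [|cont2_tac..]; rewrite -IID; [|cont2_tac..].
apply: le_II; [cont2_tac..|move=> x y /HD_disk xy].
have /andP[l0 l1] := lay_le1 t0 xy; set l := lay tau x y in l0 l1 *.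
have l2 : l ^+ 2 <= 1 by rewrite exprn_ile1.
have l20 := sqr_ge0 l.
have gxy := gM _ _ xy.
set a := f1 x y; set b := f2 x y; set c := g1 x y in gxy *; set e := g2 x y in gxy *.
have H1 : l ^+ 2 * (c ^+ 2 + e ^+ 2) <= l ^+ 2 * M by exact: ler_wpM2l.
have H2 : l ^+ 2 * ((a - c) ^+ 2 + (b - e) ^+ 2) <= (a - c) ^+ 2 + (b - e) ^+ 2.
  by rewrite ler_piMl// addr_ge0 ?sqr_ge0.
have H3 : l ^+ 2 * (a ^+ 2 + b ^+ 2) <= l ^+ 2 * (2 * ((a - c) ^+ 2 + (b - e) ^+ 2) +
   2 * (c ^+ 2 + e ^+ 2)).
  apply: ler_wpM2l => //; have := sqr_ge0 (a - 2 * c); have := sqr_ge0 (b - 2 * e); nra.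
lra.
Qed.

(** The candidate is a truncated late member of the sequence, cut off near the arc. The order of
    choices avoids circularity: N from the Cauchy property, M bounding the gradient of U N, tau from
    M, and n last, since the arc error of U n gets divided by tau. *)
Lemma compact_approx gamma u U U1 U2 b k d : bdm u -> 0 < k -> 0 < d ->
  adm gamma u U U1 U2 ->
  (forall e, 0 < e -> exists N, forall n, (N <= n)%N -> `|energy (U1 n) (U2 n) - b| <= e) ->
  exists Y Y1 Y2, [/\ C1w Y Y1 Y2, energy Y1 Y2 <= b + d,
    forall x y, 1 <= x ^+ 2 + y ^+ 2 -> [/\ Y x y = 0, Y1 x y = 0 & Y2 x y = 0] &
    flat (fun x => (Y x 0 - ramp k (gamma - u x)) ^+ 2) <= d].
Proof.
move=> bu k0 d0 [CU cau fU aU] Ub.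
have b0 : 0 <= b.
  apply/ler_addgt0Pr => e e0; have [N /(_ N (leqnn N))] := Ub e e0.
  by rewrite ler_norml; have := @energy_ge0 R (U1 N) (U2 N) => ? /andP[_ ?]; lra.
have p0 := pi_gt0 R.
(* Chosen so that beta * b <= d / 4; W is then the factor of the layer terms in [cutoff_energy], and
   e1 is scaled to the total weight of the sequence errors. *)
pose beta := d / (4 * (b + 1)).
have beta0 : 0 < beta by rewrite divr_gt0// mulr_gt0// ltr_pwDr.
pose W := (1 + beta^-1) * 22.
have W0 : 0 < W by rewrite mulr_gt0// addr_gt0// invr_gt0.
pose e1 := d / (4 * (1 + beta + 2 * W)).
have q0 : 0 < 1 + beta + 2 * W by rewrite !addr_gt0// mulr_gt0.
have e10 : 0 < e1 by rewrite divr_gt0// mulr_gt0.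
have [N1 N1P] := cau _ e10; have [N2 N2P] := Ub _ e10.
pose N := maxn N1 N2.
have cU n := C1w_cont (CU n); have cU1 n := C1w_cont1 (CU n); have cU2 n := C1w_cont2 (CU n).
have [M M0 NM] : exists2 M, 0 <= M &
    forall x y, x ^+ 2 + y ^+ 2 <= 1 -> U1 N x y ^+ 2 + U2 N x y ^+ 2 <= M.
  have c : cont2 (fun x y => U1 N x y ^+ 2 + U2 N x y ^+ 2).
    by have := cU1 N; have := cU2 N => *; cont2_tac.
  have [M M0 H] := cont2_bounded c; exists M => // x y /H; exact: le_trans (ler_norm _).
pose v x := ramp k (gamma - u x).
have bv : bdm v.
  apply: (@bdm_comp _ (ramp k)); first exact: continuous_ramp.
  by apply: bdmB => //; exact: bdm_cst.
have [vM [vM0 vMP]] : exists vM, 0 <= vM /\ forall x, -1 < x < 1 -> v x ^+ 2 <= vM.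
  have [_ [K KP]] := bdm_sqr bv; exists `|K|; split => // x x1.
  apply: le_trans (ler_norm _) _; apply: le_trans (ler_norm K).
  by apply: KP; rewrite /oI11 /= in_itv.
pose tau := Num.min (1 / 2) (Num.min (d / (16 * M * pi * W + 1)) (d / (16 * vM + 1))).
have h1 : 0 < 16 * M * pi * W + 1.
  apply: ltr_wpDl => //; apply: mulr_ge0; last exact: ltW.
  by apply: mulr_ge0; [exact: mulr_ge0|exact: ltW].
have h2 : 0 < 16 * vM + 1 by rewrite ltr_wpDl// mulr_ge0.
have t0 : 0 < tau by rewrite !lt_min !divr_gt0.
have [t1 t2 t3] : [/\ tau <= 1 / 2, tau * (16 * M * pi * W) <= d & tau * (16 * vM) <= d].
  split; first by rewrite /tau ge_min lexx.
    have : tau <= d / (16 * M * pi * W + 1) by rewrite /tau !ge_min lexx /= orbT.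
    by rewrite ler_pdivlMr// mulrDr mulr1; lra.
  have : tau <= d / (16 * vM + 1) by rewrite /tau !ge_min lexx !orbT.
  by rewrite ler_pdivlMr// mulrDr mulr1; lra.
have a0 : 0 < tau * d / (8 * W) by apply: divr_gt0; exact: mulr_gt0.
have d4 : 0 < d / 4 by rewrite divr_gt0.
have [N3 N3P] := aU _ a0; have [N4 N4P] := fU _ d4.
pose n := maxn N (maxn N3 N4).
have nN : (N <= n)%N by rewrite leq_maxl.
have n1 : (N1 <= n)%N by rewrite (leq_trans _ nN)// leq_maxl.
have n2 : (N2 <= n)%N by rewrite (leq_trans _ nN)// leq_maxr.
have n3 : (N3 <= n)%N by exact: leq_trans (leq_maxl N3 N4) (leq_maxr _ _).
have n4 : (N4 <= n)%N by exact: leq_trans (leq_maxr N3 N4) (leq_maxr _ _).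
have [V1 [V2 [CV VU]]] := truncation_C1 gamma k0 (CU n).
have [Y1 [Y2 [CY YE Y0]]] := cutoff_energy CV beta0 t0.
exists (fun x y => chi tau x y * ramp k (gamma - U n x y)), Y1, Y2; split => //.
- have cV1 := C1w_cont1 CV; have cV2 := C1w_cont2 CV; have cV := C1w_cont CV.
  have c1 := cU1 n; have c2 := cU2 n; have c1N := cU1 N; have c2N := cU2 N.
  have cl := @cont2_lay R tau.
  have EV : energy V1 V2 <= b + e1.
    apply: (@le_trans _ _ (energy (U1 n) (U2 n))).
      by apply: le_II; [cont2_tac..|move=> x y _; exact: VU].
    by have := N2P _ n2; rewrite ler_norml => /andP[_ ?]; lra.
  have A : arc (fun x y => ramp k (gamma - U n x y) ^+ 2) / tau <= d / (8 * W).
    rewrite ler_pdivrMr// [leRHS](_ : _ = tau * d / (8 * W)); last by field; rewrite gt_eqF.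
    apply: le_trans (N3P _ n3); apply: le_arc.
    - exact: cont2X.
    - by apply: cont2_sqp; have := cU n => ?; cont2_tac.
    - move=> x y _ _; have [_ /andP[r0 r1]] := ramp_itv (gamma - U n x y) k0.
      by rewrite /sqp; apply: lerXn2r; rewrite ?nnegrE// pospart_ge0.
  have B : II (fun x y => lay tau x y ^+ 2 * (V1 x y ^+ 2 + V2 x y ^+ 2)) <=
      2 * e1 + 2 * M * (pi * tau).
    apply: (@le_trans _ _ (II (fun x y => lay tau x y ^+ 2 *
        (U1 n x y ^+ 2 + U2 n x y ^+ 2)))).
      apply: le_II; [cont2_tac..|move=> x y _].
      by apply: ler_wpM2l; [exact: sqr_ge0|exact: VU].
    apply: le_trans (layer_diff_energy t0 t1 c1 c2 c1N c2N NM) _.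
    rewrite lerD2r; apply: ler_wpM2l => //; apply: N1P => //.
    by rewrite /N leq_maxl.
  apply: le_trans YE _; rewrite -/W.
  set S := arc _ / tau + _.
  have S1 : S <= d / (8 * W) + (2 * e1 + 2 * M * (pi * tau)) by exact: lerD.
  have E1 : (1 + beta) * energy V1 V2 <= (1 + beta) * (b + e1).
    by apply: ler_wpM2l => //; lra.
  have E2 := ler_wpM2l (ltW W0) S1.
  apply: le_trans (lerD E1 E2) _.
  have I1 : e1 * (1 + beta + 2 * W) = d / 4 by rewrite /e1; field; rewrite gt_eqF.
  have I2 : beta * b <= d / 4.
    rewrite /beta mulrAC ler_pdivrMr ?mulr_gt0 ?ltr_pwDr//.
    rewrite [leRHS](_ : _ = d * (b + 1)); last by field.
    by apply: ler_wpM2l; [exact: ltW|lra].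
  have I3 : W * (d / (8 * W)) = d / 8 by field; rewrite gt_eqF.
  have I4 : W * (2 * M * (pi * tau)) <= d / 8.
    by rewrite [leLHS](_ : _ = (tau * (16 * M * pi * W)) / 8); [lra|field].
  rewrite [leLHS](_ : _ = b + (beta * b + e1 * (1 + beta + 2 * W) + W * (d / (8 * W)) +
    W * (2 * M * (pi * tau)))); last by ring.
  by rewrite I1 I3 lerD2l; lra.
- move=> x y xy; have [-> ->] := Y0 _ _ xy; split => //.
  by rewrite chi_outside// mul0r.
- have bU : bdm (fun x => (U n x 0 - u x) ^+ 2).
    by apply: bdm_sqr; apply: bdmB => //; exact: bdm_flat.
  have bl : bdm (fun x => lay tau x 0) by apply: bdm_flat; exact: cont2_lay.
  apply: (@le_trans _ _ (flat (fun x => 2 * (U n x 0 - u x) ^+ 2 + (4 * vM) * lay tau x 0))).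
    apply: le_flat.
    - by apply: bdm_sqr; apply: bdmB => //; exact: bdm_flat (C1w_cont CY).
    - by apply: bdmD; exact: bdmZ.
    move=> x x1; rewrite -/(v x).
    have xx : x ^+ 2 + 0 ^+ 2 <= 1 by case/andP: x1 => ? ?; nra.
    have /andP[c0 c1] := chi_near1 t0 xx; have /andP[c2 c3] := chi_itv tau x 0.
    have := vMP _ x1; have := ramp_lip (gamma - U n x 0) (gamma - u x) k0.
    rewrite -/(v x); set V := ramp k (gamma - U n x 0); set w := v x.
    rewrite [X in _ <= `|X|](_ : _ = - (U n x 0 - u x)); last by ring.
    rewrite normrN => lip wM.
    have l2 : (V - w) ^+ 2 <= (U n x 0 - u x) ^+ 2.
      rewrite -(real_normK (num_real (V - w))) -[leRHS](real_normK (num_real _)).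
      by apply: lerXn2r; rewrite ?nnegrE.
    set c := chi tau x 0 in c0 c1 c2 c3 *.
    have cc : c ^+ 2 * (V - w) ^+ 2 <= (V - w) ^+ 2.
      by rewrite ler_piMl ?sqr_ge0// exprn_ile1.
    have c1s : (1 - c) ^+ 2 <= 1 - c by nra.
    have cw : (1 - c) ^+ 2 * w ^+ 2 <= (2 * lay tau x 0) * vM.
      by apply: ler_pM; rewrite ?sqr_ge0//; apply: le_trans c1s c1.
    have : (c * V - w) ^+ 2 <= 2 * (c ^+ 2 * (V - w) ^+ 2) + 2 * ((1 - c) ^+ 2 * w ^+ 2).
      by have := sqr_ge0 (c * (V - w) + (1 - c) * w); nra.
    lra.
  rewrite flatD; [|exact: bdmZ..]; rewrite !flatZ//.
  have F1 := N4P _ n4.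
  have F2 : 4 * vM * flat (fun x => lay tau x 0) <= 4 * vM * (2 * tau).
    by apply: ler_wpM2l; [exact: mulr_ge0|exact: flat_lay].
  lra.
Qed.

End compact_approximation.

(** * The logarithmic barrier in the annulus *)

Section barrier.
Context {R : realType}.
Implicit Types (rho k t x y : R) (f h : R -> R -> R).

Lemma C1w_comp_at (phi phi' : R -> R) f f1 f2 :
  (forall x y, is_derive (f x y) 1 phi (phi' (f x y))) ->
  cont2 (fun x y => phi' (f x y)) -> C1w f f1 f2 ->
  C1w (fun x y => phi (f x y)) (fun x y => phi' (f x y) * f1 x y)
    (fun x y => phi' (f x y) * f2 x y).
Proof.
move=> dphi cphi' [cf cf1 cf2 df1 df2]; split.
- move=> z; apply: (@continuous_comp _ _ _ (fun z : R * R => f z.1 z.2) phi).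
    exact: cf.
  exact: is_derive_continuous (dphi _ _).
- exact: cont2M.
- exact: cont2M.
- by move=> x y; exact: (is_derive1_comp (dphi _ _) (df1 x y)).
- by move=> x y; exact: (is_derive1_comp (dphi _ _) (df2 x y)).
Qed.

(** A C^1 substitute for the positive part of log (r / rho), with energy no larger than the exact pi
    log (1 / rho) and height within 2 k of the exact one. The slope is compared with [srcy] because
    the base integral of the latter is at most pi. *)
Record barrier rho k h h1 h2 (H : R) : Prop := Barrier {
  barrier_C1 : C1w h h1 h2;
  barrier_energy : energy h1 h2 <= pi * - ln rho;
  barrier_core : forall x y, x ^+ 2 + y ^+ 2 <= rho ^+ 2 -> [/\ h x y = 0, h1 x y = 0 & h2 x y = 0];
  barrier_arc : forall x y, x ^+ 2 + y ^+ 2 = 1 -> h x y = H;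
  barrier_height : - ln rho - 2 * k <= H <= - ln rho;
  barrier_itv : forall x y, x ^+ 2 + y ^+ 2 <= 1 -> 0 <= h x y <= H;
  barrier_slope : forall x, h1 x 0 ^+ 2 <= 2 / rho * srcy rho x 0 }.

Lemma ramp'_sqr k s : 0 < k -> ramp' k s ^+ 2 <= ramp' k s :> R.
Proof. by move=> k0; have /andP[? ?] := ramp'_itv s k0; nra. Qed.

Let q t x y := x ^+ 2 + y ^+ 2 + t.

Let q_gt0 t x y : 0 < t -> 0 < q t x y.
Proof. by move=> t0; rewrite /q ltr_wpDl// addr_ge0 ?sqr_ge0. Qed.

Let C1w_q t : C1w (q t) (fun x _ => 2 * x) (fun _ y => 2 * y).
Proof. by apply: C1w_eq (C1wD C1w_sumsq (C1w_cst t)) _ _ => x y; rewrite addr0. Qed.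

Let cont2_invq t : 0 < t -> cont2 (fun x y => (q t x y)^-1).
Proof.
move=> t0; apply: cont2V; last exact: C1w_cont (C1w_q t).
by move=> x y; rewrite gt_eqF// q_gt0.
Qed.

Let C1w_invq t : 0 < t ->
  C1w (fun x y => (q t x y)^-1) (fun x y => - (q t x y) ^- 2 * (2 * x))
    (fun x y => - (q t x y) ^- 2 * (2 * y)).
Proof.
move=> t0; have d0 x y : q t x y != 0 by rewrite gt_eqF// q_gt0.
apply: (@C1w_comp_at (fun x => x^-1) (fun x => - x ^- 2)); last exact: C1w_q.
- move=> x y; apply: is_derive_eq (@is_deriveV _ id (q t x y) 1 1 (d0 x y) (is_derive_id _ _)) _.
  by rewrite /GRing.scale /= mulr1.
- have c := cont2_invq t0.
  rewrite (_ : (fun x y => _) = (fun x y => - (q t x y)^-1 ^+ 2)); first by cont2_tac.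
  by apply/funext => x; apply/funext => y; rewrite exprVn.
Qed.

(** A smoothing of log (r / rho): t > 0 removes the singularity at the origin and the zero stays at
    r = rho. *)
Let kap rho t x y := 2^-1 * (ln (q t x y) + - ln (rho ^+ 2 + t)).

Let C1w_kap rho t : 0 < t ->
  C1w (kap rho t) (fun x y => x / q t x y) (fun x y => y / q t x y).
Proof.
move=> t0; have d0 x y : q t x y != 0 by rewrite gt_eqF// q_gt0.
have hl := @C1w_comp_at (@ln R) (fun x => x^-1) _ _ _
  (fun x y => is_derive1_ln (q_gt0 x y t0)) (cont2_invq t0) (C1w_q t).
apply: C1w_eq (C1wZ 2^-1 (C1wD hl (C1w_cst (- ln (rho ^+ 2 + t))))) _ _ => x y; by field.
Qed.

(* For a nondecreasing profile h of a subharmonic radial potential kap, the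
   energy of h is at most the flux of h grad kap through the arc. *)
Let barrier_flux rho k t : 0 < k -> 0 < t ->
  energy (fun x y => ramp' k (kap rho t x y) * (x / q t x y))
    (fun x y => ramp' k (kap rho t x y) * (y / q t x y)) <=
  arc (fun x y => ramp k (kap rho t x y)).
Proof.
move=> k0 t0; have d0 x y : q t x y != 0 by rewrite gt_eqF// q_gt0.
have hk := C1w_kap rho t0.
have hh := C1w_comp (fun x => is_derive_ramp x k0) (@continuous_ramp' R k) hk.
have hx := C1wM C1w_x (C1w_invq t0); have hy := C1wM C1w_y (C1w_invq t0).
have hF := C1wM hh hx; have hG := C1wM hh hy.
have := divergence_halfdisk (C1w_cont hF) (C1w_cont hG) (C1w_cont1 hF) (C1w_cont2 hG)
  (fun x y _ => C1w_d1 hF x y) (fun x y _ => C1w_d2 hG x y).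
rewrite (_ : flat _ = 0); last first.
  rewrite -[RHS](mulr0 2) -flat_cst; apply: eq_flat => x _; by rewrite mul0r mulr0.
rewrite subr0 => DA.
have ch := C1w_cont hh.
have cr : cont2 (fun x y => ramp' k (kap rho t x y)).
  by apply: (cont2_comp (@continuous_ramp' R k)); exact: C1w_cont hk.
have ci := cont2_invq t0.
apply: (@le_trans _ _ (arc (fun x y => ramp k (kap rho t x y) * (x * (q t x y)^-1) * x +
    ramp k (kap rho t x y) * (y * (q t x y)^-1) * y))).
  rewrite -DA; apply: le_II; first by cont2_tac.
    by apply: cont2D; [exact: C1w_cont1 hF|exact: C1w_cont2 hG].
  move=> x y _.
  have [_ /andP[r0 _]] := ramp_itv (kap rho t x y) k0.
  have r2 := ramp'_sqr (kap rho t x y) k0.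
  set r := ramp k _ in r0 *; set r' := ramp' k _ in r2 *.
  (* The first term is nonnegative as 0 <= r' <= 1; in the second, 2 t / q^2 is the Laplacian of
     [kap]. *)
  rewrite -subr_ge0 [X in 0 <= X](_ : _ = (r' - r' ^+ 2) * ((x / q t x y) ^+ 2 + (y / q t x y) ^+ 2)
    + r * (2 * t / q t x y ^+ 2)); last first.
    by have := d0 x y; rewrite /q => ?; field.
  apply: addr_ge0; first by apply: mulr_ge0; [lra|apply: addr_ge0; exact: sqr_ge0].
  by apply: mulr_ge0 => //; apply: divr_ge0; [apply: mulr_ge0 => //; exact: ltW|exact: sqr_ge0].
apply: le_arc; [by cont2_tac|by cont2_tac|].
move=> x y xy _.
have [_ /andP[r0 _]] := ramp_itv (kap rho t x y) k0.
rewrite [leLHS](_ : _ = ramp k (kap rho t x y) * ((x ^+ 2 + y ^+ 2) / q t x y)); last first.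
  by field.
rewrite ler_piMr// ler_pdivrMr ?q_gt0// mul1r /q lerDl; exact: ltW.
Qed.

Lemma barrier_exists rho k : 0 < rho -> rho < 1 -> 0 < k ->
  exists h h1 h2 H, barrier rho k h h1 h2 H.
Proof.
(* With this t the smoothing lowers the height by at most k, since ln (1 + k) <= k; [ramp k] lowers
   it by at most another k. *)
move=> r0 r1 k0; pose t := k * rho ^+ 2.
have t0 : 0 < t by rewrite mulr_gt0// exprn_gt0.
have d0 x y : q t x y != 0 by rewrite gt_eqF// q_gt0.
have hk := C1w_kap rho t0.
have hh := C1w_comp (fun x => is_derive_ramp x k0) (@continuous_ramp' R k) hk.
pose K1 := 2^-1 * (ln (1 + t) + - ln (rho ^+ 2 + t)).
have karc x y : x ^+ 2 + y ^+ 2 = 1 -> kap rho t x y = K1 by move=> xy; rewrite /kap /q xy.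
have rt : 0 < rho ^+ 2 + t by rewrite addr_gt0 ?exprn_gt0.
have kmono x y a : x ^+ 2 + y ^+ 2 <= a -> 0 <= a ->
    kap rho t x y <= 2^-1 * (ln (a + t) + - ln (rho ^+ 2 + t)).
  move=> xy a0; rewrite /kap ler_pM2l// lerD2r ler_ln ?posrE ?q_gt0//.
    by rewrite /q lerD2r.
  by rewrite ltr_wpDl.
have kneg x y : x ^+ 2 + y ^+ 2 <= rho ^+ 2 -> kap rho t x y <= 0.
  by move=> /kmono /(_ (sqr_ge0 _)); rewrite subrr mulr0.
have ln2 (z : R) : 0 < z -> ln (z ^+ 2) = 2 * ln z by move=> z0; rewrite lnXn// mulr_natl.
have K1le : K1 <= - ln rho.
  have : ln (1 + t) + ln (rho ^+ 2) <= ln (rho ^+ 2 + t).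
    have p1 : 0 < 1 + t by rewrite addr_gt0.
    have p2 : 0 < rho ^+ 2 by rewrite exprn_gt0.
    rewrite -lnM ?posrE// ler_ln ?posrE ?mulr_gt0//.
    by rewrite mulrDl mul1r lerD2l ler_piMr ?(ltW t0)// exprn_ile1// ltW.
  by rewrite ln2// /K1; move: (ln _) (ln _) (ln _) => *; lra.
have K1ge : - ln rho - k <= K1.
  have : ln (rho ^+ 2 + t) <= ln (rho ^+ 2) + k.
    have -> : rho ^+ 2 + t = rho ^+ 2 * (1 + k) by rewrite /t; ring.
    have p1 : 0 < 1 + k by rewrite addr_gt0.
    have p2 : 0 < rho ^+ 2 by rewrite exprn_gt0.
    rewrite lnM ?posrE// lerD2l.
    by have := @le_ln1Dx R k; apply; lra.
  have : 0 <= ln (1 + t) by rewrite ln_ge0// lerDl ltW.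
  by rewrite ln2// /K1; move: (ln _) (ln _) (ln _) => *; lra.
pose H := ramp k K1.
have lr : 0 <= - ln rho by rewrite oppr_ge0 ln_le0// ltW.
have [H1 /andP[H2 H3]] := ramp_itv K1 k0.
have Hle : H <= - ln rho.
  apply: le_trans H3 _; case: (pospartP K1) => -[_ ->] //.
exists (fun x y => ramp k (kap rho t x y)),
  (fun x y => ramp' k (kap rho t x y) * (x / q t x y)),
  (fun x y => ramp' k (kap rho t x y) * (y / q t x y)), H.
split => //.
- apply: le_trans (barrier_flux rho k0 t0) _.
  rewrite mulrC -arc_cst; apply: le_arc; [exact: C1w_cont hh|exact: cont2_cst|].
  by move=> x y xy _; rewrite karc.
- by move=> x y /kneg kle; rewrite ramp_le0// ramp'_le0// !mul0r.
- by move=> x y xy; rewrite karc.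
- by rewrite Hle andbT /H; lra.
- move=> x y xy; have [_ /andP[-> _]] := ramp_itv (kap rho t x y) k0; rewrite /=.
  have /(ramp_mono k0) /andP[] : kap rho t x y <= K1 by apply: kmono.
  by rewrite subr_ge0.
move=> x; case: (leP (x ^+ 2) (rho ^+ 2)) => xr.
  rewrite ramp'_le0 ?mul0r//; last by apply: kneg; rewrite expr0n addr0.
  rewrite expr0n; apply: mulr_ge0; first by rewrite divr_ge0// ltW.
  by rewrite /srcy divr_ge0 ?(ltW (den_gt0 _ _ r0))// addr_ge0 ?pospart_ge0// ltW.
have x0 : 0 < x ^+ 2 by apply: le_lt_trans xr; exact: sqr_ge0.
have r2 : 0 < rho ^+ 2 by rewrite exprn_gt0.
(* The slope is at most 1 / |x|, and x^2 > rho^2 gives 1 / x^2 <= 2 / (x^2 + rho^2). *)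
apply: (@le_trans _ _ ((x ^+ 2)^-1)).
  have /andP[a0 a1] := ramp'_itv (kap rho t x 0) k0.
  rewrite exprMn; apply: (@le_trans _ _ ((x / q t x 0) ^+ 2)).
    by rewrite ler_piMl ?sqr_ge0// exprn_ile1.
  rewrite expr_div_n ler_pdivrMr ?exprn_gt0 ?q_gt0// ler_pdivlMl//.
  rewrite -expr2; apply: lerXn2r; rewrite ?nnegrE ?sqr_ge0 ?(ltW (q_gt0 _ _ t0))//.
  by rewrite /q expr0n addr0 lerDl ltW.
have -> : 2 / rho * srcy rho x 0 = 2 / (x ^+ 2 + rho ^+ 2).
  rewrite /srcy /den pospart_id// add0r; field.
  by rewrite !gt_eqF// addr_gt0.
rewrite -[X in X <= _]mul1r ler_pdivrMr// mulrAC ler_pdivlMr ?addr_gt0//; lra.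
Qed.

End barrier.

(** * The competitor at the larger scale *)

Section competitor.
Context {R : realType}.
Local Notation mu := (@lebesgue_measure R).
Implicit Types (gamma lam rho k c b x : R) (m g : R -> R).

Lemma ratio_eq0 m g x : g x = 0 -> ratio m g x = 0%E.
Proof.
by rewrite /ratio => ->; case: ifP => _; rewrite ?eqxx// expr0n mul0r.
Qed.

(** The density is quadratic in the slope, but its denominator is linear in 1 - m near m = 1:
    replacing 1 - m by lam psi gains lam^2 / lam = lam. The factor gamma / (gamma - 2 k) is the
    price of the truncation. *)
Lemma ratio_core gamma k lam rho m g m' g' x z :
  0 < k -> 2 * k < gamma -> gamma < 2 -> 0 < lam -> lam <= 1 -> 0 < rho ->
  m' z = 1 - lam * (gamma - k - ramp k (gamma - 1 + m x)) ->
  g' z = lam / rho * (ramp' k (gamma - 1 + m x) * g x) ->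
  (ratio m' g' z <= (gamma / (gamma - 2 * k) * lam / rho ^+ 2)%:E * ratio m g x)%E.
Proof.
move=> k0 kg g2 l0 l1 r0 mz gz.
set B := gamma / (gamma - 2 * k) * lam / rho ^+ 2.
have gk : 0 < gamma - 2 * k by lra.
have g0 : 0 < gamma by lra.
have B0 : 0 < B.
  by rewrite /B divr_gt0 ?exprn_gt0// mulr_gt0// divr_gt0.
have R0 : (0 <= B%:E * ratio m g x)%E by rewrite mule_ge0 ?ratio_ge0// lee_fin ltW.
have [gz0|gz0] := eqVneq (g' z) 0; first by rewrite ratio_eq0.
have gx0 : g x != 0 by apply: contra gz0 => /eqP gx; rewrite gz gx !mulr0.
have s0 : 0 < gamma - 1 + m x.
  rewrite ltNge; apply: contra gz0 => s0; rewrite gz ramp'_le0// mul0r mulr0//.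
case: (boolP (`|m x| < 1)) => mx; last first.
  have -> : ratio m g x = +oo%E by rewrite /ratio (negbTE mx) (negbTE gx0).
  by rewrite gt0_muley ?lte_fin// leey.
have -> : ratio m g x = (g x ^+ 2 / (1 - m x ^+ 2))%:E by rewrite /ratio mx.
rewrite /ratio mz gz.
set s := gamma - 1 + m x in s0 *; set r := ramp k s; set r' := ramp' k s.
move: mx; rewrite ltr_norml => /andP[m1 m2].
have [rs rr] := ramp_itv s k0; rewrite -/r in rs rr.
have /andP[r'0 r'1] := ramp'_itv s k0; rewrite -/r' in r'0 r'1.
have psi_le : gamma - k - r <= 1 - m x by rewrite /s in rs; lra.
(* Where [ramp] is affine, gamma - k - r equals 1 - m; below its threshold r <= k and 1 - m <
   gamma. *)
have psi_ge : (1 - m x) * (gamma - 2 * k) <= gamma * (gamma - k - r).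
  case: (leP (2 * k) s) => sk.
    rewrite /r ramp_affine// /s.
    by have := mulr_ge0 (ltW k0) (ltW (_ : 0 < 1 - m x)); rewrite subr_gt0 => /(_ m2); nra.
  have : r <= k.
    have /andP[_ h] := ramp_mono k0 (ltW sk); have /andP[h' _] := ramp_mono k0 (ltW sk).
    by move: h h'; rewrite (ramp_affine k0 (lexx _)) -/r; lra.
  move=> rk; apply: (@le_trans _ _ (gamma * (gamma - 2 * k))).
    by apply: ler_wpM2r; [exact: ltW|rewrite /s in s0; lra].
  by apply: ler_wpM2l; [exact: ltW|lra].
set psi := gamma - k - r in psi_le psi_ge *.
have u0 : 0 < 1 - m x by lra.
have psi0 : 0 < psi.
  rewrite -(pmulr_rgt0 _ g0); apply: lt_le_trans psi_ge; exact: mulr_gt0.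
have lp : 0 < lam * psi by exact: mulr_gt0.
have lp2 : lam * psi <= 1 - m x by apply: le_trans psi_le; rewrite ler_piMl// ltW.
rewrite ifT; last by rewrite ltr_norml; apply/andP; split; lra.
rewrite -EFinM lee_fin.
have e1 : 1 - (1 - lam * psi) ^+ 2 = lam * psi * (2 - lam * psi) by ring.
have e2 : 1 - m x ^+ 2 = (1 - m x) * (2 - (1 - m x)) by ring.
rewrite e1 e2; set u := 1 - m x in psi_le psi_ge u0 lp2 *.
have u2 : 0 < 2 - u by rewrite /u; lra.
have lp3 : 2 - u <= 2 - lam * psi by lra.
have lp4 : 0 < 2 - lam * psi by lra.
have d1 : 0 < lam * psi * (2 - lam * psi) by rewrite mulr_gt0.
have d2 : 0 < u * (2 - u) by rewrite mulr_gt0.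
rewrite ler_pdivrMr//.
apply: (@le_trans _ _ ((lam / rho) ^+ 2 * g x ^+ 2)).
  rewrite exprMn; apply: ler_wpM2l; first exact: sqr_ge0.
  by rewrite exprMn ler_piMl ?sqr_ge0// exprn_ile1.
have key : u * (2 - u) * (gamma - 2 * k) <= gamma * psi * (2 - lam * psi).
  apply: (@le_trans _ _ (gamma * psi * (2 - u))).
    by rewrite mulrAC; apply: ler_wpM2r; [exact: ltW|].
  by apply: ler_wpM2l => //; apply: mulr_ge0; exact: ltW.
have key2 : 1 <= gamma * psi * (2 - lam * psi) / (u * (2 - u) * (gamma - 2 * k)).
  by rewrite ler_pdivlMr ?mul1r// mulr_gt0.
have c0 : 0 <= (lam / rho) ^+ 2 * g x ^+ 2 by apply: mulr_ge0; exact: sqr_ge0.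
rewrite -[leLHS]mulr1; apply: le_trans (ler_wpM2l c0 key2) _; rewrite le_eqVlt; apply/orP; left; apply/eqP.
by rewrite /B; field; rewrite !gt_eqF.
Qed.

(** 1 - m'^2 = u (2 - u) >= a (2 - gamma): as gamma < 2, the competitor stays away from -1 as well
    as from 1 in the annulus. *)
Lemma ratio_outer gamma a u m' g' z : gamma < 2 -> 0 < a -> a <= u -> u <= gamma ->
  m' z = 1 - u -> (ratio m' g' z <= (g' z ^+ 2 / (a * (2 - gamma)))%:E)%E.
Proof.
move=> g2 a0 au ug mz; rewrite /ratio mz ifT; last first.
  by rewrite ltr_norml; apply/andP; split; lra.
rewrite lee_fin; apply: ler_wpM2l; first exact: sqr_ge0.
have d0 : 0 < a * (2 - gamma) by rewrite mulr_gt0// subr_gt0.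
have dl : a * (2 - gamma) <= 1 - (1 - u) ^+ 2.
  rewrite [leRHS](_ : _ = u * (2 - u)); last by ring.
  by apply: ler_pM; lra.
by rewrite lef_pV2 ?posrE//; apply: lt_le_trans dl.
Qed.

Section construction.
Variables (gamma k lam rho : R) (m g : R -> R) (h h1 h2 : R -> R -> R) (H : R).
Hypotheses (k0 : 0 < k) (kg : 2 * k < gamma) (g2 : gamma < 2).
Hypotheses (l0 : 0 < lam) (l1 : lam < 1) (r0 : 0 < rho) (r1 : rho < 1).
Hypotheses (Mm : M_gamma gamma m) (Wm : W12_1d m g).
Hypotheses (bar : barrier rho k h h1 h2 H) (H0 : 0 < H).

Ltac slra := generalize k0, kg, g2, l0, l1, r0, r1, H0; intros; lra.

Let prof x := ramp k (gamma - 1 + m x).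
Let prof' x := ramp' k (gamma - 1 + m x) * g x.
(* The slope with which the competitor reaches 1 - gamma on the arc, where h = H. *)
Definition glue := (gamma - lam * (gamma - k)) / H.
(** Within |x| <= rho the barrier vanishes and 1 - [comp] is lam times the truncated, shrunken 1 -
    m. Outside, the truncated part vanishes and 1 - [comp] climbs with h from lam (gamma - k) to
    gamma. *)
Definition comp x := 1 - lam * (gamma - k) +
  (lam * ramp k (gamma - 1 + m (clamp (rho^-1 * x))) + - glue * h x 0).
Definition comp' x := lam * (rho^-1 * cutoff prof' (rho^-1 * x)) + - glue * h1 x 0.

Let g0 : 0 < gamma. Proof. by slra. Qed.

Lemma glue_ge0 : 0 <= glue.
Proof.
rewrite /glue divr_ge0 ?(ltW H0)// subr_ge0.
apply: (@le_trans _ _ (lam * gamma)); first by rewrite ler_pM2l//; slra.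
by rewrite ler_piMl// ltW.
Qed.

Let glueH : glue * H = gamma - lam * (gamma - k).
Proof. by rewrite /glue divfK// gt_eqF. Qed.

Let W12_prof : W12_1d prof prof'.
Proof.
have C0 : 0 <= 1 / (2 * k) by rewrite divr_ge0// mulr_ge0// ltW.
apply: (@W12_chain _ (fun z => ramp k (gamma - 1 + z)) (fun z => ramp' k (gamma - 1 + z))
  (1 / (2 * k)) C0) => //.
- move=> a b; have := ramp_taylor (gamma - 1 + a) (gamma - 1 + b) k0.
  have -> : gamma - 1 + b - (gamma - 1 + a) = b - a by ring.
  move=> /le_trans; apply; rewrite mulrC; apply: ler_wpM2r; first exact: sqr_ge0.
  rewrite -[leLHS]mul1r; apply: ler_wpM2l => //.
  by rewrite lef_pV2 ?posrE ?mulr_gt0// ler_pM2r//; slra.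
- move=> a b; have := ramp'_lip (gamma - 1 + a) (gamma - 1 + b) k0.
  have -> : gamma - 1 + a - (gamma - 1 + b) = a - b by ring.
  by move=> /le_trans; apply; rewrite mul1r mulrC.
- move=> z; apply: (@continuous_comp _ _ _ (fun z => gamma - 1 + z)).
    by apply: cvgD; [exact: cvg_cst|exact: cvg_id].
  exact: continuous_ramp'.
Qed.

Let rinv1 : 1 <= rho^-1. Proof. by rewrite invf_ge1// ltW. Qed.

Let prof_end x : m x <= 1 - gamma -> prof x = 0 /\ prof' x = 0.
Proof. by move=> mx; rewrite /prof /prof' ramp_le0 ?ramp'_le0 ?mul0r//; slra. Qed.

Lemma W12_comp : W12_1d comp comp'.
Proof.
have [_ [m1 m2]] := Mm; have [p1 _] := prof_end m1; have [p2 _] := prof_end m2.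
have hC := barrier_C1 bar.
have Wh : W12_1d (fun x => h x 0) (fun x => h1 x 0).
  apply: W12_C1; last by move=> x; exact: C1w_d1 hC x 0.
  apply: (cont2_curve (C1w_cont1 hC)) => x; first exact: cvg_id.
  exact: cvg_cst.
exact: (W12_lin (1 - lam * (gamma - k)) lam (- glue)
  (W12_dilate W12_prof p2 p1 rinv1) Wh).
Qed.

Let clamp_id x : -1 <= x <= 1 -> clamp x = x.
Proof.
by move=> /andP[x1 x2]; rewrite /clamp (min_idPl x2); apply/max_idPr.
Qed.

Let clamp_out x : 1 <= `|x| -> clamp x = 1 \/ clamp x = -1.
Proof.
rewrite /clamp ler_normr => /orP[x1|x1]; [left|right].
  by rewrite (min_idPr x1); apply/max_idPr; slra.
apply/max_idPl; rewrite ge_min; apply/orP; left; slra.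
Qed.

Let prof_out x : rho <= `|x| -> ramp k (gamma - 1 + m (clamp (rho^-1 * x))) = 0.
Proof.
move=> xr; have [_ [m1 m2]] := Mm; have [p1 _] := prof_end m1; have [p2 _] := prof_end m2.
have : 1 <= `|rho^-1 * x|.
  by rewrite normrM gtr0_norm ?invr_gt0// ler_pdivlMl// mulr1.
by move=> /clamp_out[-> | ->].
Qed.

Lemma M_gamma_comp : M_gamma gamma comp.
Proof.
have [m0 _] := Mm; rewrite /comp; split; last split.
- have [-> _ _] : [/\ h 0 0 = 0, h1 0 0 = 0 & h2 0 0 = 0].
    by apply: (barrier_core bar); rewrite expr0n addr0 sqr_ge0.
  rewrite mulr0 clamp_id ?lerN10 ?ler01// m0 subrK ramp_affine//; last exact: ltW.
  ring.
- rewrite (barrier_arc bar); last by rewrite expr0n addr0 expr1n.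
  by rewrite prof_out ?normr1 ?(ltW r1)// mulNr glueH mulr0; slra.
- rewrite (barrier_arc bar); last by rewrite expr0n addr0 sqrrN expr1n.
  by rewrite prof_out ?normrN1 ?(ltW r1)// mulNr glueH mulr0; slra.
Qed.

Lemma ratio_comp x : -1 < x < 1 -> (ratio comp comp' x <=
  (gamma / (gamma - 2 * k) * lam / rho ^+ 2)%:E * (ratio m g \_ (@oI11 R)) (rho^-1 * x)%R +
  (2 * glue ^+ 2 / (rho * (lam * (gamma - k) * (2 - gamma))) * srcy rho x 0)%:E)%E.
Proof.
move=> /andP[x1 x2].
have gk : 0 < gamma - 2 * k by slra.
have a0 : 0 < lam * (gamma - k) by rewrite mulr_gt0// subr_gt0; slra.
have B0 : 0 < gamma / (gamma - 2 * k) * lam / rho ^+ 2.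
  by rewrite divr_gt0 ?exprn_gt0// mulr_gt0// divr_gt0.
have d0 : 0 < rho * (lam * (gamma - k) * (2 - gamma)).
  by rewrite mulr_gt0// mulr_gt0// subr_gt0.
have s0 : 0 <= srcy rho x 0.
  by rewrite /srcy divr_ge0 ?(ltW (den_gt0 _ _ r0))// addr_ge0 ?pospart_ge0// ltW.
have S0 : 0 <= 2 * glue ^+ 2 / (rho * (lam * (gamma - k) * (2 - gamma))) * srcy rho x 0.
  by rewrite mulr_ge0// divr_ge0 ?(ltW d0)// mulr_ge0// sqr_ge0.
case: (ltP `|x| rho) => xr.
  have xr2 : x ^+ 2 <= rho ^+ 2.
    by rewrite -(real_normK (num_real x)) lerXn2r ?nnegrE ?(ltW r0) ?(ltW xr).
  have [hx h1x _] : [/\ h x 0 = 0, h1 x 0 = 0 & h2 x 0 = 0].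
    by apply: (barrier_core bar); rewrite expr0n addr0.
  move: xr; rewrite ltr_norml => /andP[xl xu].
  have zl : -1 < rho^-1 * x by rewrite ltr_pdivlMl// mulrN1.
  have zu : rho^-1 * x < 1 by rewrite ltr_pdivrMl// mulr1.
  rewrite patchE ifT; last by rewrite inE /oI11 /= in_itv /= zl zu.
  apply: (@le_trans _ _ ((gamma / (gamma - 2 * k) * lam / rho ^+ 2)%:E *
      ratio m g (rho^-1 * x)%R)%E); last by rewrite leeDl// lee_fin.
  apply: ratio_core => //; first exact: ltW.
    by rewrite /comp hx mulr0 addr0 clamp_id ?(ltW zl) ?(ltW zu)//; ring.
  rewrite /comp' h1x mulr0 addr0 /cutoff zl (ltW zu) /=; exact: mulrA.
apply: (@le_trans _ _ ((2 * glue ^+ 2 / (rho * (lam * (gamma - k) * (2 - gamma))) *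
    srcy rho x 0)%:E)); last first.
  rewrite leeDr// mule_ge0 ?lee_fin ?(ltW B0)// patchE.
  by case: ifP => // _; exact: ratio_ge0.
have x21 : x ^+ 2 + 0 ^+ 2 <= 1 by nra.
have /andP[hx0 hxH] := barrier_itv bar x21.
have gh : 0 <= glue * h x 0 <= glue * H.
  by rewrite mulr_ge0 ?glue_ge0//= ler_wpM2l// glue_ge0.
move/andP: gh => [gh0 ghH]; rewrite glueH in ghH.
apply: le_trans (@ratio_outer gamma (lam * (gamma - k)) (lam * (gamma - k) + glue * h x 0)
  comp comp' x g2 a0 _ _ _) _.
- slra.
- slra.
- by rewrite /comp prof_out//; ring.
have -> : comp' x = - glue * h1 x 0.
  (* The half-open interval of [cutoff] leaves the point x = rho, where the truncated slope vanishes
     because m 1 <= 1 - gamma. *)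
  rewrite /comp' /cutoff; case: ifP => [/andP[z1 z2]|_]; last by rewrite !mulr0 add0r.
  have [_ [m1 _]] := Mm; have [_ p1] := prof_end m1.
  have -> : rho^-1 * x = 1; last by rewrite p1 !mulr0 add0r.
  apply/eqP; rewrite eq_le z2 /=.
  move: xr; rewrite ler_normr => /orP[xr|xr].
    by rewrite ler_pdivlMl// mulr1.
  by move: z1; rewrite ltr_pdivlMl// mulrN1; slra.
rewrite lee_fin exprMn sqrrN.
have sl := ler_wpM2l (sqr_ge0 glue) (barrier_slope bar x).
have a2 : 0 < lam * (gamma - k) * (2 - gamma) by rewrite mulr_gt0// subr_gt0.
rewrite ler_pdivrMr//; apply: le_trans sl _.
rewrite le_eqVlt; apply/orP; left; apply/eqP; field.
by rewrite !gt_eqF ?subr_gt0//; slra.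
Qed.

(** Integrating [ratio_comp], the core gains a factor rho from the dilation, and the annulus is
    bounded by [flat_srcy]. *)
Lemma exchange_comp K : (\int[mu]_(x in @oI11 R) ratio m g x <= K%:E)%E ->
  (\int[mu]_(x in @oI11 R) ratio comp comp' x <=
   (gamma / (gamma - 2 * k) * lam / rho * K +
    2 * glue ^+ 2 / (rho * (lam * (gamma - k) * (2 - gamma))) * pi)%:E)%E.
Proof.
move=> hK; have mr := measurable_ratio Wm.
set B := gamma / (gamma - 2 * k) * lam / rho ^+ 2.
set C := 2 * glue ^+ 2 / (rho * (lam * (gamma - k) * (2 - gamma))).
have gk : 0 < gamma - 2 * k by slra.
have B0 : 0 < B by rewrite divr_gt0 ?exprn_gt0// mulr_gt0// divr_gt0.
have C0 : 0 <= C.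
  apply: divr_ge0; first by apply: mulr_ge0 => //; exact: sqr_ge0.
  apply: ltW; apply: mulr_gt0 => //.
  by apply: mulr_gt0; [apply: mulr_gt0 => //|]; slra.
pose F := (ratio m g \_ (@oI11 R)).
have mF : measurable_fun setT F by exact: (measurable_restrictT _ (@measurable_oI11 R)).1 mr.
have F0 x : (0 <= F x)%E by rewrite /F patchE; case: ifP => // _; exact: ratio_ge0.
have ri0 : 0 < rho^-1 by rewrite invr_gt0.
have mFd : measurable_fun setT (fun x => F (rho^-1 * x)).
  apply: measurableT_comp mF _; exact: measurable_funM.
have [_ [r' [t' [_ hq']]]] := @harm_src R _ r0; have cq' := C1u_cont hq'.
have bs : bdm (fun x => C * srcy rho x 0) by apply: bdmZ; exact: bdm_flat.
have s0 x : 0 <= C * srcy rho x 0.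
  apply: mulr_ge0 => //; rewrite /srcy divr_ge0 ?(ltW (den_gt0 _ _ r0))//.
  by rewrite addr_ge0 ?pospart_ge0// ltW.
apply: (@le_trans _ _ (\int[mu]_(x in @oI11 R) (B%:E * F (rho^-1 * x)%R +
    (C * srcy rho x 0)%:E))%E).
  apply: ge0_le_integral.
  - exact: measurable_oI11.
  - by move=> x _; exact: ratio_ge0.
  - exact: measurable_ratio W12_comp.
  - apply: emeasurable_funD.
      by apply: measurable_funeM; exact: measurable_funTS.
    by apply/measurable_EFinP; case: bs.
  - by move=> x; rewrite /oI11 /= in_itv /=; exact: ratio_comp.
rewrite ge0_integralD; first last.
- by apply/measurable_EFinP; case: bs.
- by move=> x _; rewrite lee_fin.
- by apply: measurable_funeM; exact: measurable_funTS.
- by move=> x _; rewrite mule_ge0// lee_fin ltW.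
- exact: measurable_oI11.
rewrite -EFin_flat// flatZ; last exact: bdm_flat.
rewrite EFinD; apply: leeD; last first.
  by rewrite lee_fin; apply: ler_wpM2l => //; exact: flat_srcy.
rewrite ge0_integralZl_EFin; first last.
- exact: ltW.
- exact: measurable_funTS.
- by move=> x _; exact: F0.
- exact: measurable_oI11.
have -> : gamma / (gamma - 2 * k) * lam / rho = B * rho.
  by rewrite /B; field; rewrite !gt_eqF.
rewrite [leRHS](_ : _ = (B%:E * (rho * K)%:E)%E); last by rewrite -EFinM mulrA.
apply: lee_wpmul2l; first by rewrite lee_fin ltW.
apply: (@le_trans _ _ (\int[mu]_x F (rho^-1 * x)%R)%E).
  apply: ge0_subset_integral; [exact: measurable_oI11|exact: measurableT|exact: mFd|..|by []].
  by move=> x _; exact: F0.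
have := @ge0_integral_dilation R rho^-1 F ri0 mF F0.
rewrite -integral_mkcond => E.
have -> : (\int[mu]_x F (rho^-1 * x)%R = rho%:E * \int[mu]_(x in @oI11 R) ratio m g x)%E.
  by rewrite E muleA -EFinM divff ?mul1e// gt_eqF.
by rewrite EFinM; apply: lee_wpmul2l => //; rewrite lee_fin ltW.
Qed.

(** The planar Dirichlet energy is invariant under dilation, so the core costs lam^2 b. Relaxation
    lets the competitor match the base trace only approximately; on the arc it equals gamma
    exactly. *)
Lemma dir_comp b U U1 U2 : adm gamma (fun x => 1 - m x) U U1 U2 ->
  (forall e, 0 < e -> exists N, forall n, (N <= n)%N -> `|energy (U1 n) (U2 n) - b| <= e) ->
  (dir_inf gamma comp <= (lam ^+ 2 * b + glue ^+ 2 * (pi * - ln rho))%:E)%E.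
Proof.
move=> ad Ub; apply: dir_inf_le_relaxed (W12_bdm W12_comp) _ => d d0.
have bm := W12_bdm Wm.
have bu : bdm (fun x => 1 - m x) by apply: bdmB => //; exact: bdm_cst.
have [Y [Y1 [Y2 [CY EY Y0 fY]]]] := compact_approx bu k0 d0 ad Ub.
have ri0 : 0 < rho^-1 by rewrite invr_gt0.
have Yout x y : rho ^+ 2 <= x ^+ 2 + y ^+ 2 ->
    [/\ Y (rho^-1 * x) (rho^-1 * y) = 0, Y1 (rho^-1 * x) (rho^-1 * y) = 0 &
        Y2 (rho^-1 * x) (rho^-1 * y) = 0].
  move=> xy; apply: Y0; rewrite !exprMn -mulrDr exprVn ler_pdivlMl ?exprn_gt0//.
  by rewrite mulr1.
have hC := barrier_C1 bar.
have CU := C1wD (C1w_cst (lam * (gamma - k)))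
  (C1wD (C1wZ (- lam) (C1w_dilate rho^-1 CY)) (C1wZ glue hC)).
exists (energy (fun x y => 0 + (- lam * (rho^-1 * Y1 (rho^-1 * x) (rho^-1 * y)) + glue * h1 x y))
  (fun x y => 0 + (- lam * (rho^-1 * Y2 (rho^-1 * x) (rho^-1 * y)) + glue * h2 x y))).
  do 3 eexists; split; [exact: CU| | |by []].
  - pose G z := (Y z 0 - ramp k (gamma - (1 - m z))) ^+ 2.
    have bG : bdm G.
      apply: bdm_sqr; apply: bdmB; first exact: bdm_flat (C1w_cont CY).
      apply: (@bdm_comp _ (ramp k)); first exact: continuous_ramp.
      by apply: bdmB => //; exact: bdm_cst.
    pose F := ((EFin \o G) \_ (@oI11 R)).
    have mF : measurable_fun setT F.
      apply: (measurable_restrictT _ (@measurable_oI11 R)).1.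
      by apply/measurable_EFinP; case: bG.
    have F0 z : (0 <= F z)%E.
      by rewrite /F patchE; case: ifP => // _; rewrite lee_fin sqr_ge0.
    have mFd : measurable_fun setT (fun x => F (rho^-1 * x)).
      by apply: measurableT_comp mF _; exact: measurable_funM.
    have bD : bdm (fun x => (lam * (gamma - k) + (- lam * Y (rho^-1 * x) (rho^-1 * 0) +
        glue * h x 0) - (1 - comp x)) ^+ 2).
      apply: bdm_sqr; apply: bdmB; first exact: bdm_flat (C1w_cont CU).
      by apply: bdmB; [exact: bdm_cst|exact: W12_bdm W12_comp].
    rewrite -lee_fin EFin_flat//.
    apply: (@le_trans _ _ (\int[mu]_(x in @oI11 R) F (rho^-1 * x)%R)%E).
      apply: ge0_le_integral; first exact: measurable_oI11.
      - by move=> x _; rewrite lee_fin sqr_ge0.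
      - by apply/measurable_EFinP; case: bD.
      - exact: measurable_funTS.
      move=> x _.
      rewrite [X in ((X ^+ 2)%:E <= _)%E](_ : _ = - lam * (Y (rho^-1 * x) 0 -
        ramp k (gamma - 1 + m (clamp (rho^-1 * x))))); last by rewrite /comp mulr0; ring.
      case: (ltP `|x| rho) => xr.
        move: (xr); rewrite ltr_norml => /andP[xl xu].
        have zl : -1 < rho^-1 * x by rewrite ltr_pdivlMl// mulrN1.
        have zu : rho^-1 * x < 1 by rewrite ltr_pdivrMl// mulr1.
        rewrite /F patchE ifT; last by rewrite inE /oI11 /= in_itv /= zl zu.
        rewrite /= lee_fin /G clamp_id ?(ltW zl) ?(ltW zu)//.
        rewrite (_ : gamma - (1 - m (rho^-1 * x)) = gamma - 1 + m (rho^-1 * x)); last by ring.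
        rewrite exprMn sqrrN ler_piMl ?sqr_ge0// exprn_ile1//; exact: ltW.
      have [e _ _] : [/\ Y (rho^-1 * x) (rho^-1 * 0) = 0, Y1 (rho^-1 * x) (rho^-1 * 0) = 0 &
          Y2 (rho^-1 * x) (rho^-1 * 0) = 0].
        apply: Yout; rewrite expr0n addr0 -(real_normK (num_real x)).
        by rewrite lerXn2r ?nnegrE// ltW.
      by rewrite mulr0 in e; rewrite e prof_out// subrr mulr0 expr0n.
    apply: (@le_trans _ _ (\int[mu]_x F (rho^-1 * x)%R)%E).
      apply: ge0_subset_integral; [exact: measurable_oI11|exact: measurableT|exact: mFd|..|by []].
      by move=> x _; exact: F0.
    have := @ge0_integral_dilation R rho^-1 F ri0 mF F0.
    rewrite -integral_mkcond => E.
    have -> : (\int[mu]_x F (rho^-1 * x)%R = rho%:E * \int[mu]_(x in @oI11 R) (G x)%:E)%E.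
      by rewrite E muleA -EFinM divff ?mul1e// gt_eqF.
    rewrite -EFin_flat// -EFinM lee_fin.
    have G0 : 0 <= flat G by apply: flat_ge0 => x; exact: sqr_ge0.
    by apply: le_trans fY; rewrite ler_piMl// ltW.
  - apply: (@le_trans _ _ 0); last exact: ltW.
    rewrite -(mul0r pi) -arc_cst le_eqVlt; apply/orP; left; apply/eqP.
    apply: eq_arc => x y xy; rewrite (barrier_arc bar xy) glueH.
    have [-> _ _] : [/\ Y (rho^-1 * x) (rho^-1 * y) = 0, Y1 (rho^-1 * x) (rho^-1 * y) = 0 &
        Y2 (rho^-1 * x) (rho^-1 * y) = 0].
      by apply: Yout; rewrite xy exprn_ile1// ltW.
    rewrite (_ : gamma - _ = 0); last by ring.
    by rewrite /sqp pospart_le0// expr0n.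
pose f x y := Y1 x y ^+ 2 + Y2 x y ^+ 2.
have cf : cont2 f by exact: cont2_energy CY.
have cfd : cont2 (fun x y => f (rho^-1 * x) (rho^-1 * y)).
  by apply: (cont2_subst cf); cont2_tac.
have ch := cont2_energy hC.
have -> : energy (fun x y => 0 + (- lam * (rho^-1 * Y1 (rho^-1 * x) (rho^-1 * y)) + glue * h1 x y))
    (fun x y => 0 + (- lam * (rho^-1 * Y2 (rho^-1 * x) (rho^-1 * y)) + glue * h2 x y)) =
  lam ^+ 2 * (rho^-1 ^+ 2 * II (fun x y => f (rho^-1 * x) (rho^-1 * y))) + glue ^+ 2 * energy h1 h2.
  have c1 := cont2M (@cont2_cst R (rho^-1 ^+ 2)) cfd.
  rewrite /energy -(IIZ _ cfd) -(IIZ _ c1) -(IIZ _ ch).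
  rewrite -(IID (cont2M (@cont2_cst _ _) c1) (cont2M (@cont2_cst _ _) ch)).
  apply: eq_II => x y _; rewrite /f.
  (* No cross term: one of the two gradients vanishes on either side of r = rho. *)
  case: (leP (x ^+ 2 + y ^+ 2) (rho ^+ 2)) => xy.
    by have [_ -> ->] := barrier_core bar xy; ring.
  by have [_ -> ->] := Yout _ _ (ltW xy); ring.
rewrite II_dilation//; last 2 first.
- by move=> x y; apply: addr_ge0; exact: sqr_ge0.
- by move=> x y xy; rewrite /f; have [_ -> ->] := Y0 _ _ xy; rewrite expr0n addr0.
have H1 : lam ^+ 2 * II f <= lam ^+ 2 * b + d.
  apply: (@le_trans _ _ (lam ^+ 2 * (b + d))).
    by apply: ler_wpM2l; [exact: sqr_ge0|exact: EY].
  rewrite mulrDr lerD2l ler_piMl ?(ltW d0)// exprn_ile1//; exact: ltW.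
have H2 := ler_wpM2l (sqr_ge0 glue) (barrier_energy bar).
by apply: le_trans (lerD H1 H2) _; rewrite addrAC.
Qed.

End construction.
End competitor.

(** * Comparison of the infima at two scales *)

Section step.
Context {R : realType}.
Local Notation mu := (@lebesgue_measure R).
Implicit Types (gamma eps k b x : R) (m g : R -> R).

Lemma bdm_measurable_ratio_le m g (C : R) : W12_1d m g ->
  (forall x, -1 < x < 1 -> (ratio m g x <= C%:E)%E) ->
  (\int[mu]_(x in @oI11 R) ratio m g x <= (2 * C)%:E)%E.
Proof.
move=> h rC; rewrite -flat_cst EFin_flat; last exact: bdm_cst.
apply: ge0_le_integral.
- exact: measurable_oI11.
- by move=> x _; exact: ratio_ge0.
- exact: measurable_ratio h.
- by apply/measurable_EFinP; exact: measurable_cst.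
- by move=> x; rewrite /oI11 /= in_itv /=; exact: rC.
Qed.

(** The explicit competitor 1 - gamma (x^2 + y^2) equals 1 - gamma on the arc, and its exchange
    density is at most 4 gamma / (2 - gamma). *)
Lemma inf_E_lty gamma eps : 0 < gamma < 2 -> 0 < eps -> (inf_E gamma eps < +oo)%E.
Proof.
move=> /andP[g0 g2] e0.
pose m x := 1 - gamma * x ^+ 2; pose g x := - (2 * gamma * x) : R.
have CU := C1wZ gamma (@C1w_sumsq R).
have h : W12_1d m g.
  apply: W12_C1.
    by move=> x; apply: cvgN; apply: cvgMl_tmp; exact: cvg_id.
  move=> x; have := C1w_d1 (C1wD (C1w_cst 1) (C1wZ (-1) CU)) x 0.
  rewrite (_ : (fun t => 1 + -1 * (gamma * (t ^+ 2 + 0 ^+ 2))) = m).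
    by move=> d; apply: is_derive_eq d _; rewrite /g; ring.
  by apply/funext => t; rewrite /m; ring.
have Mm : M_gamma gamma m.
  by rewrite /M_gamma /m expr0n mulr0 subr0 sqrrN expr1n mulr1.
apply: (@le_lt_trans _ _ (E_gamma gamma eps m g)).
  by apply: ereal_inf_lbound; exists m, g.
rewrite /E_gamma.
have D : (dir_inf gamma m <= (energy (fun x _ => gamma * (2 * x)) (fun _ y => gamma * (2 * y)))%:E)%E.
  apply: dir_inf_le_relaxed (W12_bdm h) _ => d d0.
  exists (energy (fun x _ => gamma * (2 * x)) (fun _ y => gamma * (2 * y))); last by rewrite lerDl ltW.
  do 3 eexists; split; [exact: CU| | |by []].
    apply: le_trans (ltW d0).
    rewrite (@eq_flat _ _ (fun=> 0)) ?flat_cst ?mulr0// => x _.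
    by rewrite /m; ring.
  apply: le_trans (ltW d0).
  rewrite (@eq_arc _ _ (fun _ _ => 0)) ?arc_cst ?mul0r// => x y ->.
  by rewrite mulr1 subrr /sqp pospart_le0// expr0n.
have K : (\int[mu]_(x in @oI11 R) ratio m g x <= (2 * (4 * gamma / (2 - gamma)))%:E)%E.
  have C0 : 0 <= 4 * gamma / (2 - gamma).
    by apply: divr_ge0; [apply: mulr_ge0 => //; exact: ltW|lra].
  apply: bdm_measurable_ratio_le h _ => x /andP[x1 x2].
  have [->|x0] := eqVneq x 0.
    rewrite ratio_eq0; last by rewrite /g mulr0 oppr0.
    by rewrite lee_fin.
  have xx : 0 < x ^+ 2 by rewrite exprn_even_gt0.
  have xx1 : x ^+ 2 < 1 by nra.
  have gx : 0 < gamma * x ^+ 2 by rewrite mulr_gt0.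
  have gx2 : gamma * x ^+ 2 <= gamma by nra.
  rewrite /ratio ifT; last by rewrite /m ltr_norml; apply/andP; split; lra.
  have e : 1 - m x ^+ 2 = gamma * x ^+ 2 * (2 - gamma * x ^+ 2) by rewrite /m; ring.
  rewrite e lee_fin ler_pdivrMr; last by rewrite mulr_gt0//; lra.
  rewrite [leLHS](_ : _ = 4 * gamma / (2 - gamma) * (gamma * x ^+ 2 * (2 - gamma))).
    apply: ler_wpM2l => //.
    by apply: ler_wpM2l; [exact: ltW|lra].
  by rewrite /g; field; rewrite subr_eq0 gt_eqF.
apply: (@le_lt_trans _ _ ((eps / 2)%:E * (2 * (4 * gamma / (2 - gamma)))%:E +
  (1 / 2)%:E * (energy (fun x _ => gamma * (2 * x)) (fun _ y => gamma * (2 * y)))%:E)%E).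
  by apply: leeD; apply: lee_wpmul2l => //; rewrite lee_fin divr_ge0// ltW.
by rewrite -!EFinM -EFinD ltry.
Qed.

Lemma inf_E_fin_num gamma eps : 0 < gamma < 2 -> 0 < eps -> inf_E gamma eps \is a fin_num.
Proof. by move=> g2 e0; rewrite ge0_fin_numE ?inf_E_ge0// inf_E_lty. Qed.

Lemma core_dilation (L L' : R) : 0 < L -> 0 < L' ->
  core L' / expR (L - L') = core L * L / L'.
Proof.
move=> L0 L0'; rewrite /core.
have -> : expR (- L') = expR (- L) * expR (L - L') by rewrite -expRD; congr expR; ring.
by field; rewrite !gt_eqF ?expR_gt0.
Qed.

(* Energy at the larger scale, by rescaling near-minimisers and gluing the
   logarithmic barrier in the outer annulus. *)
Lemma inf_E_step gamma k (L L' : R) : 0 < gamma < 2 -> 0 < k -> 2 * k < gamma ->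
  0 < L -> L + 2 * k < L' ->
  let c := (gamma - L / L' * (gamma - k)) / (L' - L - 2 * k) in
  L' ^+ 2 * fine (inf_E gamma (core L')) <=
    gamma / (gamma - 2 * k) * (L ^+ 2 * fine (inf_E gamma (core L))) +
    L' * expR (- L) * (pi * c ^+ 2 / (L / L' * (gamma - k) * (2 - gamma))) +
    2^-1 * (L' ^+ 2 * c ^+ 2 * (pi * (L' - L))).
Proof.
move=> g02 k0 kg L0 LL'; set c := _ / (L' - L - 2 * k) => /=; have /andP[g0 g2] := g02.
have L0' : 0 < L' by lra.
set lam := L / L'; set rho := expR (L - L').
have l0 : 0 < lam by rewrite divr_gt0.
have l1 : lam < 1 by rewrite ltr_pdivrMr// mul1r; lra.
have r0 : 0 < rho by exact: expR_gt0.
have r1 : rho < 1 by rewrite -expR0 ltr_expR; lra.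
have lr : - ln rho = L' - L by rewrite /rho expRK; ring.
have [h [h1 [h2 [H bar]]]] := barrier_exists r0 r1 k0.
have /andP[H1 H2] := barrier_height bar; rewrite lr in H1 H2.
have H0 : 0 < H by lra.
have p0 := pi_gt0 R.
have gk : 0 < gamma - 2 * k by lra.
set beta := gamma / (gamma - 2 * k).
have b1 : 1 <= beta by rewrite ler_pdivlMr// mul1r; lra.
have gl0 := glue_ge0 k0 kg g2 l0 l1 r0 r1 H0.
(* The barrier height is at least L' - L - 2 k. *)
have glc : glue gamma k lam H <= c.
  rewrite /glue /c; apply: ler_wpM2l.
    rewrite subr_ge0; apply: (@le_trans _ _ (lam * gamma)); first by rewrite ler_pM2l//; lra.
    by rewrite ler_piMl// ltW.
  by rewrite lef_pV2 ?posrE//; lra.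
have glc2 : glue gamma k lam H ^+ 2 <= c ^+ 2.
  by apply: lerXn2r; rewrite ?nnegrE// (le_trans gl0).
set X := inf_E gamma (core L); set X' := inf_E gamma (core L').
have fX : X \is a fin_num by apply: inf_E_fin_num => //; exact: core_gt0.
have fX' : X' \is a fin_num by apply: inf_E_fin_num => //; exact: core_gt0.
have a0 : 0 < lam * (gamma - k) * (2 - gamma).
  by rewrite mulr_gt0 ?subr_gt0// mulr_gt0// subr_gt0; lra.
suff S e : 0 < e -> L' ^+ 2 * fine X' <= beta * (L ^+ 2 * (fine X + e)) +
    L' * expR (- L) * (pi * c ^+ 2 / (lam * (gamma - k) * (2 - gamma))) +
    2^-1 * (L' ^+ 2 * c ^+ 2 * (pi * (L' - L))).
  apply/ler_addgt0Pr => e e0.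
  have q : 0 < beta * L ^+ 2 by rewrite mulr_gt0 ?exprn_gt0//; lra.
  apply: le_trans (S (e / (beta * L ^+ 2)) _) _; first by rewrite divr_gt0.
  rewrite le_eqVlt; apply/orP; left; apply/eqP.
  set T := L' * _ * _; set T' := 2^-1 * _; clearbody T T'.
  by field; rewrite (gt_eqF L0) gt_eqF//; lra.
move=> e0.
have [E [m [g [Mm [Wm ->]]]] Elt] := lb_ereal_inf_adherent e0 fX.
rewrite -/(inf_E gamma (core L)) -/X in Elt.
have c0 := core_gt0 L0; have c0' := core_gt0 L0'.
have Kge0 : (0 <= \int[mu]_(x in @oI11 R) ratio m g x)%E.
  by apply: integral_ge0 => x _; exact: ratio_ge0.
have D0 := dir_inf_ge0 gamma (W12_bdm Wm).
move: Elt; rewrite -(fineK fX) -EFinD /E_gamma => Elt.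
have T1 : (0 <= (core L / 2)%:E * \int[mu]_(x in @oI11 R) ratio m g x)%E.
  by apply: mule_ge0 => //; rewrite lee_fin divr_ge0// ltW.
have T2 : (0 <= (1 / 2)%:E * dir_inf gamma m)%E.
  by apply: mule_ge0 => //; rewrite lee_fin.
have fK : (\int[mu]_(x in @oI11 R) ratio m g x)%E \is a fin_num.
  rewrite ge0_fin_numE// ltey; apply/eqP => K; move: Elt.
  rewrite K gt0_muley; last by rewrite lte_fin divr_gt0.
  by rewrite addye ?ltNge ?leey// gt_eqF// (lt_le_trans _ T2).
have fD : dir_inf gamma m \is a fin_num.
  rewrite ge0_fin_numE// ltey; apply/eqP => K; move: Elt.
  rewrite K gt0_muley; last by rewrite lte_fin divr_gt0.
  by rewrite addey ?ltNge ?leey// gt_eqF// (lt_le_trans _ T1).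
set K := fine (\int[mu]_(x in @oI11 R) ratio m g x)%E.
set B := fine (dir_inf gamma m).
move: Elt; rewrite -(fineK fK) -(fineK fD) -!EFinM -EFinD lte_fin -/K -/B => Elt.
have hK : (\int[mu]_(x in @oI11 R) ratio m g x <= K%:E)%E by rewrite fineK.
have EX := exchange_comp k0 kg g2 l0 l1 r0 r1 Mm Wm bar H0 hK.
have DX d : 0 < d -> (dir_inf gamma (comp gamma k lam rho m h H) <=
    (lam ^+ 2 * (B + d) + c ^+ 2 * (pi * (L' - L)))%:E)%E.
  move=> d0; have [a da ad] := lb_ereal_inf_adherent d0 fD.
  have [U [U1 [U2 [adU [b [ab Ub]]]]]] := dir_valsP (W12_bdm Wm) da.
  apply: le_trans (dir_comp k0 kg g2 l0 l1 r0 r1 Mm Wm bar H0 adU Ub) _.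
  rewrite lee_fin lr; apply: lerD.
    apply: ler_wpM2l; first exact: sqr_ge0.
    by move: ad; rewrite ab -/(dir_inf gamma m) -(fineK fD) -EFinD lte_fin => /ltW.
  by apply: ler_wpM2r => //; rewrite mulr_ge0 ?(ltW p0)//; lra.
have DX0 : (dir_inf gamma (comp gamma k lam rho m h H) <=
    (lam ^+ 2 * B + c ^+ 2 * (pi * (L' - L)))%:E)%E.
  apply/lee_addgt0Pr => d d0; apply: le_trans (DX d d0) _.
  rewrite -EFinD lee_fin.
  have : lam ^+ 2 * d <= d by rewrite ler_piMl ?(ltW d0)// exprn_ile1// ltW.
  by move: (pi * (L' - L)) => p ?; lra.
have XE : (X' <= (core L' / 2)%:E * (beta * lam / rho * K +
      2 * glue gamma k lam H ^+ 2 / (rho * (lam * (gamma - k) * (2 - gamma))) * pi)%:E +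
      (1 / 2)%:E * (lam ^+ 2 * B + c ^+ 2 * (pi * (L' - L)))%:E)%E.
  apply: (@le_trans _ _ (E_gamma gamma (core L') (comp gamma k lam rho m h H)
     (comp' gamma k lam rho m g h1 H))).
    apply: ereal_inf_lbound; exists (comp gamma k lam rho m h H), (comp' gamma k lam rho m g h1 H).
    split; first exact: (M_gamma_comp g k0 kg g2 l0 l1 r0 r1 Mm bar H0).
    by split; first exact: (W12_comp k0 kg g2 l0 l1 r0 r1 Mm Wm bar H0).
  by apply: leeD; apply: lee_wpmul2l => //; rewrite lee_fin divr_ge0// ltW.
move: XE; rewrite -(fineK fX') -!EFinM -EFinD lee_fin => XE.
have L2 : 0 <= L' ^+ 2 by exact: sqr_ge0.
apply: le_trans (ler_wpM2l L2 XE) _.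
set G := glue gamma k lam H in gl0 glc2 *.
have B0 : 0 <= B by rewrite fine_ge0.
have K0 : 0 <= K by rewrite fine_ge0.
(* [core] makes the exchange term scale like the Dirichlet term: core L' / rho = core L * lam, so
   with the factor lam of the density it too gains lam^2. *)
have e1 : L' ^+ 2 * (core L' / 2 * (beta * lam / rho * K)) =
    beta * (L ^+ 2 * (core L / 2 * K)).
  have -> : core L' / 2 * (beta * lam / rho * K) = (core L' / rho) * (2^-1 * (beta * lam * K)).
    by field; rewrite gt_eqF.
  by rewrite core_dilation// /lam; field; rewrite gt_eqF.
have e2 : L' ^+ 2 * (core L' / 2 * (2 * G ^+ 2 / (rho * (lam * (gamma - k) * (2 - gamma))) * pi)) =
    L' * expR (- L) * (pi * G ^+ 2 / (lam * (gamma - k) * (2 - gamma))).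
  move: (lam * (gamma - k) * (2 - gamma)) a0 => A A0.
  have -> : core L' / 2 * (2 * G ^+ 2 / (rho * A) * pi) = (core L' / rho) * (pi * G ^+ 2 / A).
    by move: (pi) => p; field; rewrite !gt_eqF.
  rewrite core_dilation// /core; move: (pi) (expR _) => p E'; field; rewrite !gt_eqF//.
have e3 : L' ^+ 2 * lam ^+ 2 = L ^+ 2 by rewrite /lam; field; rewrite gt_eqF.
set S := lam * (gamma - k) * (2 - gamma) in a0 e2 *.
set D := pi * (L' - L).
rewrite mulrDr (mulrDr (core L' / 2)) (mulrDr (L' ^+ 2)) e1 e2 (mulrDr (1 / 2)) (mulrDr (L' ^+ 2)).
have F1 : L' * expR (- L) * (pi * G ^+ 2 / (lam * (gamma - k) * (2 - gamma))) <=
   L' * expR (- L) * (pi * c ^+ 2 / (lam * (gamma - k) * (2 - gamma))).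
  apply: ler_wpM2l; first by rewrite mulr_ge0 ?(ltW L0')// ltW// expR_gt0.
  apply: ler_wpM2r; first by rewrite invr_ge0 ltW.
  by apply: ler_wpM2l => //; exact: ltW.
have F2 : L' ^+ 2 * (1 / 2 * (lam ^+ 2 * B)) <= beta * (L ^+ 2 * (1 / 2 * B)).
  rewrite [leLHS](_ : _ = 1 * (L ^+ 2 * (1 / 2 * B))); last by rewrite -e3; ring.
  by apply: ler_wpM2r => //; rewrite mulr_ge0 ?sqr_ge0// mulr_ge0.
have F3 : beta * (L ^+ 2 * (core L / 2 * K + 1 / 2 * B)) <= beta * (L ^+ 2 * (fine X + e)).
  apply: ler_wpM2l; first by lra.
  by apply: ler_wpM2l; [exact: sqr_ge0|exact: ltW].
move: F1; rewrite -/S; set Z1 := L' * expR _ * _; set Z2 := L' * expR _ * _ => F1.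
move: F2 F3; rewrite (mulrDr (L ^+ 2)) (mulrDr beta).
clearbody Z1 Z2 D; set Q1 := beta * _; set Q2 := beta * (L ^+ 2 * (1 / 2 * B)).
set Q3 := beta * _; set Q4 := L' ^+ 2 * (1 / 2 * (lam ^+ 2 * B)).
have -> : L' ^+ 2 * (1 / 2 * (c ^+ 2 * D)) = 2^-1 * (L' ^+ 2 * c ^+ 2 * D) by field.
move: (2^-1 * _) => Q5; clearbody Q1 Q2 Q3 Q4; move: F1; clear; lra.
Qed.

End step.

(** * Convergence in L and transfer to epsilon *)

Section limit.
Context {R : realType}.
Implicit Types (gamma eps k L : R).

Definition scaled gamma L :=
  L ^+ 2 * fine (inf_E gamma (core L)) - pi * gamma ^+ 2 / 2 * L.

(** The limit k -> 0 of [inf_E_step]. Then c tends to gamma / L', the truncation factor to 1, and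
    the barrier energy to pi gamma^2 (L' - L) / 2, which the linear correction absorbs. *)
Lemma scaled_step gamma L (L' : R) : 0 < gamma < 2 -> 0 < L -> L < L' ->
  scaled gamma L' <= scaled gamma L + pi * gamma / (2 - gamma) * core L.
Proof.
move=> g02 L0 LL'; have /andP[g0 g2] := g02.
have L0' : 0 < L' by exact: lt_trans LL'.
rewrite /scaled lerBlDr.
set X := _ * fine (inf_E gamma (core L')); set A := _ * fine (inf_E gamma (core L)).
have cid : k @[k --> 0^'+] --> (0 : R) by exact/cvg_at_right_filter/cvg_id.
have c2k : 2 * k @[k --> 0^'+] --> (2 * 0 : R) by apply: cvgM; [exact: cvg_cst|exact: cid].
rewrite mulr0 in c2k.
pose c k := (gamma - L / L' * (gamma - k)) / (L' - L - 2 * k).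
have cgk : gamma - k @[k --> 0^'+] --> gamma - 0 by apply: cvgB; [exact: cvg_cst|exact: cid].
have cg2k : gamma - 2 * k @[k --> 0^'+] --> gamma - 0.
  by apply: cvgB; [exact: cvg_cst|exact: c2k].
have cc : c k @[k --> 0^'+] --> (gamma - L / L' * (gamma - 0)) / (L' - L - 0).
  apply: cvgM.
    apply: cvgB; first exact: cvg_cst.
    by apply: cvgM; [exact: cvg_cst|exact: cgk].
  apply: cvgV; first by rewrite subr0 gt_eqF// subr_gt0.
  by apply: cvgB; [exact: cvg_cst|exact: c2k].
rewrite !subr0 in cgk cg2k cc.
have e : (gamma - L / L' * gamma) / (L' - L) = gamma / L'.
  by field; rewrite !gt_eqF// subr_gt0.
rewrite e in cc.
have den : L / L' * gamma * (2 - gamma) != 0.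
  by rewrite gt_eqF// !mulr_gt0 ?invr_gt0// subr_gt0.
have Phi : gamma / (gamma - 2 * k) * A +
      L' * expR (- L) * (pi * c k ^+ 2 / (L / L' * (gamma - k) * (2 - gamma))) +
      2^-1 * (L' ^+ 2 * c k ^+ 2 * (pi * (L' - L))) @[k --> 0^'+] -->
    gamma / gamma * A +
      L' * expR (- L) * (pi * (gamma / L') ^+ 2 / (L / L' * gamma * (2 - gamma))) +
      2^-1 * (L' ^+ 2 * (gamma / L') ^+ 2 * (pi * (L' - L))).
  have cc2 : c k ^+ 2 @[k --> 0^'+] --> (gamma / L') ^+ 2 by apply: cvgM; exact: cc.
  apply: cvgD; first apply: cvgD.
  - apply: cvgM; last exact: cvg_cst.
    apply: cvgM; first exact: cvg_cst.
    by apply: cvgV; [rewrite gt_eqF|exact: cg2k].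
  - apply: cvgM; first exact: cvg_cst.
    apply: cvgM; first by apply: cvgM; [exact: cvg_cst|exact: cc2].
    apply: cvgV => //; apply: cvgM; last exact: cvg_cst.
    by apply: cvgM; [exact: cvg_cst|exact: cgk].
  - apply: cvgM; first exact: cvg_cst.
    apply: cvgM; last exact: cvg_cst.
    by apply: cvgM; [exact: cvg_cst|exact: cc2].
suff : X <= gamma / gamma * A +
      L' * expR (- L) * (pi * (gamma / L') ^+ 2 / (L / L' * gamma * (2 - gamma))) +
      2^-1 * (L' ^+ 2 * (gamma / L') ^+ 2 * (pi * (L' - L))).
  rewrite divff ?gt_eqF// mul1r => /le_trans; apply.
  rewrite le_eqVlt; apply/orP; left; apply/eqP; clearbody A; rewrite /core.
  move: (pi) (expR _) => p E; field.
  by rewrite !gt_eqF// subr_gt0.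
apply: (cvgr_to_ge Phi); near=> k.
apply: (inf_E_step g02 _ _ L0 _).
- by near: k; exact: nbhs_right_gt.
- rewrite -ltr_pdivlMl//; near: k; apply: nbhs_right_lt.
  by rewrite mulr_gt0.
- rewrite -ltrBrDl -ltr_pdivlMl//; near: k; apply: nbhs_right_lt.
  by rewrite mulr_gt0 ?subr_gt0// invr_gt0.
Unshelve. all: by end_near. Qed.

(** r L bounds the rise from L to any later point, not just the next step, so errors never
    accumulate and the limit is the infimum of G + r. *)
Lemma almost_nonincreasing_cvgy (G r : R -> R) (L0 b : R) :
  (forall L (L' : R), L0 <= L -> L < L' -> G L' <= G L + r L) ->
  (forall L, L0 <= L -> b <= G L) ->
  r L @[L --> +oo] --> 0 -> cvg (G L @[L --> +oo]).
Proof.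
move=> Gr Gb r0.
pose A := [set G L + r L | L in [set L | L0 <= L]].
have infA : has_inf A.
  split; first by exists (G L0 + r L0), L0 => /=.
  exists b => _ [L /= L0L <-]; apply: le_trans (Gr L (L + 1) L0L _); last by rewrite ltrDl.
  by apply: Gb; rewrite ler_wpDr.
apply/cvg_ex; exists (inf A); apply/cvgrPdist_le => e e0.
have [_ [L1 /= L01 <-] L1e] := inf_adherent e0 infA.
near=> L; rewrite ler_distlC; apply/andP; split.
  have AL : A (G L + r L) by exists L => //=; near: L; apply: nbhs_pinfty_ge; exact: num_real.
  have h := ge_inf (proj2 infA) AL; rewrite lerBlDr (le_trans h)// lerD2l.
  by apply: le_trans (ler_norm _) _; near: L; exact: (cvgr0_norm_le _ r0 _ e0).
apply: (le_trans _ (ltW L1e)); apply: (Gr _ _ L01).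
by near: L; apply: nbhs_pinfty_gt; exact: num_real.
Unshelve. all: by end_near. Qed.

Lemma cvgy_core : core L @[L --> +oo] --> (0 : R).
Proof.
apply: (@squeeze_cvgr _ _ _ _ (cst 0) (fun x : R => expR (- x))); last 2 first.
- exact: cvg_cst.
- exact: cvgr_expR.
near=> L; have L1 : 1 <= L by near: L; apply: nbhs_pinfty_ge; exact: num_real.
have L0 : 0 < L by exact: lt_le_trans L1.
by rewrite ltW ?core_gt0//= /core ler_pdivrMr// ler_peMr// ltW// expR_gt0.
Unshelve. all: by end_near. Qed.

(** ln L = 2 ln (sqrt L) <= 2 sqrt L, negligible against L. *)
Lemma cvgy_lnV : ln L / L @[L --> +oo] --> (0 : R).
Proof.
apply/cvgr0Pnorm_le => e e0; near=> L.
have L1 : 1 <= L by near: L; apply: nbhs_pinfty_ge; exact: num_real.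
have L0 : 0 < L by exact: lt_le_trans L1.
rewrite ger0_norm ?divr_ge0 ?ln_ge0// ?(ltW L0)// ler_pdivrMr//.
have s0 : 0 < Num.sqrt L by rewrite sqrtr_gt0.
have sL : Num.sqrt L ^+ 2 = L by rewrite sqr_sqrtr// ltW.
have -> : ln L = 2 * ln (Num.sqrt L) by rewrite -[in LHS]sL expr2 lnM ?posrE// mulrDl !mul1r.
have := ln_le_subr1 s0; move: (ln _) => l ls.
have : (2 / e) ^+ 2 <= L by near: L; apply: nbhs_pinfty_ge; exact: num_real.
rewrite -sL ler_sqr ?nnegrE; [|by rewrite divr_ge0// ltW|exact: ltW].
by rewrite ler_pdivrMr// => h; nra.
Unshelve. all: by end_near. Qed.

Lemma scaled_cvg gamma : 0 < gamma < 2 -> cvg (scaled gamma L @[L --> +oo]).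
Proof.
move=> g02; have /andP[g0 g2] := g02.
have [C [L0 [L01 h]]] := inf_E_lower g0.
apply: (@almost_nonincreasing_cvgy _ (fun L => pi * gamma / (2 - gamma) * core L) L0 (- C)).
- by move=> L L' L0L; apply: scaled_step => //; lra.
- move=> L L0L; have L0' : 0 < L by lra.
  have := h _ L0L; rewrite -(fineK (inf_E_fin_num g02 (core_gt0 L0'))) lee_fin.
  rewrite /scaled; move: (fine _) (pi) => X p.
  rewrite -(ler_pM2l (exprn_gt0 2 L0')) => hX.
  have e : L ^+ 2 * (p * gamma ^+ 2 / (2 * L) - C / L ^+ 2) = p * gamma ^+ 2 / 2 * L - C.
    by field; rewrite gt_eqF.
  by rewrite e in hX; move: hX; clear; lra.
- rewrite -[X in _ --> X](mulr0 (pi * gamma / (2 - gamma))).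
  by apply: cvgM; [exact: cvg_cst|exact: cvgy_core].
Qed.

Definition log_delta eps := ln (1 / delta eps).

(** ln (1 / core L) = L + ln L, hence delta = expR (- L) * (1 + ln L / L). *)
Lemma log_delta_core L : 1 <= L -> log_delta (core L) = L - ln (1 + ln L / L).
Proof.
move=> L1; have L0 : 0 < L by exact: lt_le_trans L1.
have l0 : 0 <= ln L by exact: ln_ge0.
have ll : ln (core L) = - L - ln L.
  by rewrite /core lnM ?posrE ?invr_gt0 ?expR_gt0// expRK lnV ?posrE.
have t0 : 0 < 1 + ln L / L by rewrite ltr_pwDl// divr_ge0// ltW.
have c0 := core_gt0 L0.
have lV : ln (core L)^-1 = L * (1 + ln L / L).
  by rewrite lnV ?posrE// ll; field; rewrite gt_eqF.
rewrite /log_delta /delta; move: (core L) c0 ll lV => K K0 ll lV.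
rewrite !div1r lV lnV ?posrE ?mulr_gt0//.
by rewrite lnM ?posrE ?mulr_gt0// ll lnM ?posrE//; ring.
Qed.

(** Replacing L by L - n with 0 <= n <= ln L / L changes the expression by - n ((2 L - n) X - q).
    Convergence of [scaled] keeps L X bounded, so the change is at most M ln L / L. *)
Lemma scaled_log_delta_cvg gamma : 0 < gamma < 2 ->
  log_delta (core L) ^+ 2 * fine (inf_E gamma (core L))
    - pi * gamma ^+ 2 / 2 * log_delta (core L) - scaled gamma L @[L --> +oo] --> 0.
Proof.
move=> g02; have /cvg_ex[l /= Gl] := scaled_cvg g02.
have := Gl; move/cvgrPdist_le => /(_ 1 ltr01) Gl1.
pose M := 2 * (`|l| + 1 + pi * gamma ^+ 2 / 2) + pi * gamma ^+ 2 / 2.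
have q0 : 0 <= pi * gamma ^+ 2 / 2 :> R.
  by rewrite divr_ge0// mulr_ge0 ?sqr_ge0// ltW// pi_gt0.
have cM : M * (ln L / L) @[L --> +oo] --> 0.
  by rewrite -[X in _ --> X](mulr0 M); apply: cvgM; [exact: cvg_cst|exact: cvgy_lnV].
apply: (@squeeze_cvgr _ _ _ _ (fun x : R => - (M * (ln x / x))) (fun x => M * (ln x / x))) => //; last first.
  by rewrite -[X in _ --> X]oppr0; exact: cvgN.
near=> L; rewrite -ler_norml.
have L1 : 1 <= L by near: L; apply: nbhs_pinfty_ge; exact: num_real.
have L0 : 0 < L by exact: lt_le_trans L1.
have GL : scaled gamma L <= `|l| + 1.
  have : `|l - scaled gamma L| <= 1 by near: L; exact: Gl1.
  by rewrite ler_distlC => /andP[_]; have := ler_norm l; lra.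
rewrite log_delta_core// /scaled in GL *.
have X0 : 0 <= fine (inf_E gamma (core L)) by rewrite fine_ge0 ?inf_E_ge0 ?core_gt0.
have l0 : 0 <= ln L by exact: ln_ge0.
have t0 : 0 <= ln L / L by rewrite divr_ge0// ltW.
have t1 : ln L / L <= 1.
  by rewrite ler_pdivrMr// mul1r; have := ln_le_subr1 L0; lra.
have n0 : 0 <= ln (1 + ln L / L) by rewrite ln_ge0// lerDl.
have n1 : ln (1 + ln L / L) <= ln L / L.
  have : 0 < 1 + ln L / L by rewrite ltr_pwDl.
  by move/ln_le_subr1; rewrite addrAC subrr add0r.
rewrite /M; move: t0 t1 n0 n1 q0 GL.
move: (ln L / L) (ln (1 + _)) (pi * _ / 2) (fine _) X0 `|l| (normr_ge0 l).
move=> t n q X X0 a a0 t0 t1 n0 n1 q0 GL.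
have LX : L * X <= a + 1 + q.
  by rewrite -(ler_pM2l L0); nra.
have -> : (L - n) ^+ 2 * X - q * (L - n) - (L ^+ 2 * X - q * L) =
    - n * ((2 * L - n) * X - q) by ring.
rewrite normrM normrN (ger0_norm n0) mulrC.
apply: ler_pM => //; rewrite ler_norml; apply/andP; split; nra.
Unshelve. all: by end_near. Qed.

(** The intermediate value theorem gives a large preimage of every small eps, enough to carry a
    limit in L over to eps without inverting [core]. *)
Lemma core_onto (B : R) : 1 <= B -> \forall eps \near 0^'+, exists2 L, B <= L & core L = eps.
Proof.
move=> B1; have B0 : 0 < B by exact: lt_le_trans B1.
near=> eps.
have e0 : 0 < eps by near: eps; exact: nbhs_right_gt.
have eB : eps <= core B by near: eps; apply: nbhs_right_ltW; exact: core_gt0.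
have [T [BT Te]] : exists T, B <= T /\ core T <= eps.
  have /cvgr0Pnorm_le/(_ _ e0) := cvgy_core => h.
  have [T [BT Te]] : exists T : R, B <= T /\ `|core T| <= eps.
    apply: (@filter_ex _ (pinfty_nbhs R)); apply: filterI => //.
    apply: nbhs_pinfty_ge; exact: num_real.
  by exists T; split => //; exact: le_trans (ler_norm _) Te.
have cC : {within `[B, T], continuous core}.
  apply: continuous_in_subspaceT => x /set_mem /=; rewrite in_itv/= => /andP[Bx _].
  apply: cvgM; first by apply: (continuous_comp (@oppr_continuous _ _ _)); exact: continuous_expR.
  by apply: cvgV; [rewrite gt_eqF// (lt_le_trans B0)|exact: cvg_id].
case: (IVT BT cC (v := eps)); last first.
  by move=> L; rewrite in_itv /= => /andP[BL _] <-; exists L.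
by rewrite ge_min le_max Te eB orbT.
Unshelve. all: by end_near. Qed.

End limit.

(** [fine] sends infinite values to 0, so finiteness of the infimum is asserted next to the
    limit. *)
Theorem theorem4p12 (R : realType) (gamma : R) :
  0 < gamma < 2 ->
  exists e : R,
    (\forall eps \near 0^'+, inf_E gamma eps \is a fin_num) /\
    ((ln (1 / delta eps)) ^+ 2 * fine (inf_E gamma eps)
       - pi * gamma ^+ 2 / 2 * ln (1 / delta eps)) @[eps --> 0^'+] --> e.
Proof.
move=> g02; have /cvg_ex[l /= Gl] := scaled_cvg g02.
exists l; split.
  near=> eps; apply: (inf_E_fin_num g02).
  by near: eps; exact: nbhs_right_gt.
pose W L := log_delta (core L) ^+ 2 * fine (inf_E gamma (core L))
  - pi * gamma ^+ 2 / 2 * log_delta (core L).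
have cW : W L - scaled gamma L + scaled gamma L @[L --> +oo] --> 0 + l.
  by apply: cvgD; [exact: scaled_log_delta_cvg|exact: Gl].
rewrite add0r in cW.
apply/cvgrPdist_le => e e0.
have [B [Breal hB]] : \forall L \near +oo, `|l - W L| <= e.
  by move/cvgrPdist_le: cW => /(_ e e0); apply: filterS => L; rewrite subrK.
have B1 : 1 <= Num.max 1 (B + 1) by rewrite le_max lexx.
apply: filterS (core_onto B1) => eps [L BL <-].
apply: hB; apply: lt_le_trans BL.
by rewrite lt_max ltrDl ltr01 orbT.
Unshelve. all: by end_near. Qed.
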